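(* Let $S$ be a finite set of prime numbers and let $k\geq 12$ be an even integer. Suppose that for each $p\in S$ there is some $t\in\{4,6,8,10,14\}$ (possibly depending on $p$) for which $(p-1)\mid (k-t)$. Then every normalized Hecke eigenform $f\in S_k$ is non-ordinary at every prime $p\in S$.
   Context: For even $k\geq 4$, $S_k$ denotes the $\mathbb{C}$-vector space of weight $k$ holomorphic cusp forms on $\mathrm{SL}_2(\mathbb{Z})$, and $q:=e^{2\pi i z}$. A normalized Hecke eigenform in $S_k$ is a form $f(z)=\sum_{n=1}^{\infty}a_f(n)q^n\in S_k$ which is an eigenfunction of all Hecke operators and satisfies $a_f(1)=1$; its coefficients lie in the ring of integers $O_L$ of some number field $L$. Such an $f\in S_k\cap O_L[[q]]$ is called non-ordinary at a prime $p$ if there is a prime ideal $\mathfrak{p}\subset O_L$ above $p$ for which $a_f(p)\equiv 0\pmod{\mathfrak{p}}$. *)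

(* Defs.v *)
From HB Require Import structures.
From mathcomp Require Export all_boot all_order all_algebra all_field.
From mathcomp Require Export all_classical all_reals all_analysis.
From mathcomp Require Export complex.

Set Implicit Arguments.
Unset Strict Implicit.
Unset Printing Implicit Defensive.

Import Order.TTheory GRing.Theory Num.Theory.
Import numFieldNormedType.Exports.

Local Open Scope classical_set_scope.
Local Open Scope ring_scope.
Local Open Scope complex_scope.

(* The complex numbers are [R[i]] for [R : realType].  A function on the upper
   half-plane is a total function on [R[i]] whose values off the half-plane are
   never used. *)
Definition upper_half_plane (R : realType) : set R[i] :=
  [set z | 0 < complex.Im z].
Arguments upper_half_plane : clear implicits.

(* The library has no complex exponential: this is e^(2 pi i z), in real and
   imaginary parts. *)
Definition qparam (R : realType) (z : R[i]) : R[i] :=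
  (expR (- (2 * pi * complex.Im z)))%:C *
    (cos (2 * pi * complex.Re z) +i* sin (2 * pi * complex.Re z)).

(* [derivable] over the scalar field [R[i]] in direction 1 is complex
   differentiability. *)
Definition holomorphic_on (R : realType) (D : set R[i]) (f : R[i] -> R[i]) :
    Prop :=
  forall z, D z -> derivable (f : R[i]^o -> R[i]^o) z 1.

Definition weakly_modular (R : realType) (k : nat) (f : R[i] -> R[i]) : Prop :=
  forall g : 'M[int]_2, \det g = 1 ->
  forall z, upper_half_plane R z ->
    f (((g 0 0)%:~R * z + (g 0 1)%:~R) / ((g 1 0)%:~R * z + (g 1 1)%:~R)) =
    ((g 1 0)%:~R * z + (g 1 1)%:~R) ^+ k * f z.

Definition has_qexpansion (R : realType) (f : R[i] -> R[i]) (a : nat -> R[i]) :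
    Prop :=
  forall z, upper_half_plane R z ->
    series (fun n => a n * qparam z ^+ n : R[i]^o) @ \oo --> (f z : R[i]^o).

(* Meaningful when [f] has a q-expansion, which is then unique. *)
Definition qcoef (R : realType) (f : R[i] -> R[i]) : nat -> R[i] :=
  xget (fun=> 0) [set a | has_qexpansion f a].

(* The existence of a q-expansion without negative powers is holomorphy at the
   cusp. *)
Definition cusp_form (R : realType) (k : nat) (f : R[i] -> R[i]) : Prop :=
  [/\ holomorphic_on (upper_half_plane R) f,
      weakly_modular k f,
      exists a, has_qexpansion f a &
      qcoef f 0 = 0].

(* (T_n f)(z) = n^(k-1) \sum_(ad = n, 0 <= b < d) d^(-k) f((az + b)/d). *)
Definition hecke (R : realType) (k n : nat) (f : R[i] -> R[i]) (z : R[i]) :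
    R[i] :=
  n%:R ^+ k.-1 *
  \sum_(d <- divisors n) \sum_(b < d)
     d%:R ^- k * f (((n %/ d)%N%:R * z + b%:R) / d%:R).

Definition normalized_hecke_eigenform (R : realType) (k : nat)
    (f : R[i] -> R[i]) : Prop :=
  [/\ cusp_form k f,
      forall n, (0 < n)%N -> exists lambda : R[i],
        forall z, upper_half_plane R z -> hecke k n f z = lambda * f z &
      qcoef f 1 = 1].

(* Number fields are finite extensions [L : fieldExtType rat]; their integers
   are the elements integral over the image of [int]. *)
Section RingOfIntegers.
Variable L : fieldExtType rat.

Definition algint : {pred L} :=
  [pred x | `[< integralOver (intr : int -> L) x >]].

Lemma algint_subring_closed : subring_closed algint.
Proof.
split=> [|x y|x y]; rewrite !inE.
- exact: (@integral1 int L intr).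
- exact: (@integral_sub int L intr).
- exact: (@integral_mul int L intr).
Qed.

HB.instance Definition _ :=
  GRing.isSubringClosed.Build L algint algint_subring_closed.

Record ringOfIntegers : predArgType :=
  RingOfIntegers { ringOfIntegers_val : L; _ : ringOfIntegers_val \in algint }.

HB.instance Definition _ := [isSub of ringOfIntegers for ringOfIntegers_val].
HB.instance Definition _ := [Choice of ringOfIntegers by <:].
HB.instance Definition _ :=
  [SubChoice_isSubComNzRing of ringOfIntegers by <:].

End RingOfIntegers.

(* The prime ideal P of O_L satisfies P \cap Z = p Z. *)
Definition lies_above (L : fieldExtType rat) (P : {pred ringOfIntegers L})
    (p : nat) : Prop :=
  forall m : int, (m%:~R \in P) = (p%:Z %| m)%Z.

(* [c] is f viewed in O_L[[q]] via the embedding [iota] of L into the complex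
   numbers.  The number field is existentially quantified; by going up and
   contracting prime ideals, the property does not depend on its choice. *)
Definition non_ordinary (R : realType) (f : R[i] -> R[i]) (p : nat) : Prop :=
  exists (L : fieldExtType rat) (iota : {rmorphism L -> R[i]})
         (c : nat -> ringOfIntegers L),
    (forall n, iota (val (c n)) = qcoef f n) /\
    exists P : prime_idealr (ringOfIntegers L),
      lies_above P p /\ c p \in P.

(* Main.v *)
(* Write g = k - 2.  Integrating f(z) Q(z) dz between cusps, for polynomials Q of
   degree at most g, gives a modular symbol Phi with T_l Phi = a_l Phi; by the
   Euclidean algorithm it is determined by its values on the path from 0 to oo,
   the periods of f.  Subtracting a multiple of the boundary symbol
   Q(y) - Q(x) removes the periods of 1 and X^g, and the result takes values, on
   integral Q, in the lattice Lambda spanned by the periods r_j of X^j,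
   0 < j < g.  Hence a_l Lambda is contained in Lambda for every prime l.  Not all
   r_j vanish: otherwise the (g+1)-fold integral of f would be, up to a constant,
   modular of weight -g, which is absurd.  So the a_n are algebraic integers in
   one number field.

   Let h = t - 2.  Modulo p Lambda, T_p Phi(x, y)(Q) involves Q only through its
   values on the projective line over F_p, so the same formula defines a symbol
   of weight h, because h = g modulo p - 1.  There are no cusp forms of weight t,
   and correspondingly the period relations, with an explicit integral
   certificate, force this symbol to be a multiple of the boundary symbol modulo
   p Lambda.  It follows that a_p^2 Lambda is contained in p Lambda: a_p^2 / p is
   an algebraic integer, and every prime ideal above p contains a_p. *)

From HB Require Import structures.
Require Import Defs.
From mathcomp Require Import ring lra zify.

Set Implicit Arguments.
Unset Strict Implicit.
Unset Printing Implicit Defensive.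

Import Order.TTheory GRing.Theory Num.Theory.
Import numFieldNormedType.Exports.
Local Open Scope classical_set_scope.
Local Open Scope ring_scope.
Local Open Scope complex_scope.

(** * Homogeneous substitution in binary forms *)

(** Two applications of T_p are needed. Modulo p, the values of a form of degree g on the projective
    line over F_p need not come from a form of degree h, so T_p Phi on X^j cannot be compared with
    weight h directly. But the first application leaves only values of Phi on the form Y^g along
    paths from b/p to oo with b nonzero, and Y^g and Y^h take the same values on that line; so the
    second application can be computed in weight h. There it is a multiple of the boundary symbol,
    whose value on Y^h along such a path is -p^h: this is where the factor p comes from.

    No path integral is formed. An antiderivative of f Q is written as a finite sum of Fourier
    series by integration by parts and carried to every cusp by SL_2(Z). The symbol is a difference
    of two antiderivatives; for the cusps 0 and oo it is constant because its derivative vanishes,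
    and the Euclidean algorithm extends this to all cusps.

    The denominators D of the certificates have no prime factor beyond h. For p at most 11, t - 2 is
    therefore replaced where needed by a smaller number congruent to it modulo p - 1. *)

Record mat2 (A : Type) := Mat2 { m00 : A; m01 : A; m10 : A; m11 : A }.

Definition mul2 (A : pzRingType) (M N : mat2 A) : mat2 A :=
  Mat2 (m00 M * m00 N + m01 M * m10 N) (m00 M * m01 N + m01 M * m11 N)
       (m10 M * m00 N + m11 M * m10 N) (m10 M * m01 N + m11 M * m11 N).

Definition det2 (A : pzRingType) (M : mat2 A) : A :=
  m00 M * m11 M - m01 M * m10 M.

Definition adj2 (A : pzRingType) (M : mat2 A) : mat2 A :=
  Mat2 (m11 M) (- m01 M) (- m10 M) (m00 M).

Definition map2 (A B : Type) (f : A -> B) (M : mat2 A) : mat2 B :=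
  Mat2 (f (m00 M)) (f (m01 M)) (f (m10 M)) (f (m11 M)).

(** [Q] stands for the binary form of degree [g] of which it is the dehomogenization. The degree is
    a parameter, so that one polynomial can be read in weight [g] and in weight [h]; coefficients
    beyond [g] are dropped. *)
Definition hev (A : comNzRingType) (g : nat) (Q : {poly A}) (x y : A) : A :=
  \sum_(j < g.+1) Q`_j * x ^+ j * y ^+ (g - j).

(** Substitution is evaluation over the polynomial ring at two linear forms, so facts about [hev]
    over an arbitrary ring apply to it. *)
Definition hact (A : comNzRingType) (g : nat) (M : mat2 A) (Q : {poly A}) :
    {poly A} :=
  hev g (map_poly polyC Q) (m00 M *: 'X + (m01 M)%:P) (m10 M *: 'X + (m11 M)%:P).

Section HomogeneousAction.
Variable A : comNzRingType.
Implicit Types (P Q : {poly A}) (M N : mat2 A) (x y : A).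

Lemma hevD g P Q x y : hev g (P + Q) x y = hev g P x y + hev g Q x y.
Proof.
by rewrite /hev -big_split; apply: eq_bigr => j _; rewrite coefD !mulrDl.
Qed.

Lemma hevZ g c Q x y : hev g (c *: Q) x y = c * hev g Q x y.
Proof.
by rewrite /hev mulr_sumr; apply: eq_bigr => j _; rewrite coefZ !mulrA.
Qed.

Lemma hev_sum g (I : Type) (r : seq I) (F : I -> {poly A}) x y :
  hev g (\sum_(i <- r) F i) x y = \sum_(i <- r) hev g (F i) x y.
Proof.
elim/big_rec2: _ => [|i u v _ <-]; last by rewrite hevD.
by rewrite /hev big1 // => j _; rewrite coef0 !mul0r.
Qed.

Lemma hevXn g n x y : (n <= g)%N -> hev g 'X^n x y = x ^+ n * y ^+ (g - n).
Proof.
move=> le_ng; rewrite /hev (bigD1 (inord n)) //= inordK ?ltnS //.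
rewrite coefXn eqxx mul1r big1 ?addr0 // => j.
rewrite -val_eqE /= inordK ?ltnS // coefXn => /negPf->; by rewrite !mul0r.
Qed.

Lemma poly_widen n Q : (size Q <= n)%N -> Q = \sum_(i < n) Q`_i *: 'X^i.
Proof.
move=> sQ; rewrite -poly_def; apply/polyP => i; rewrite coef_poly.
by case: ltnP => // h; rewrite nth_default // (leq_trans sQ).
Qed.

Lemma hevM m n P Q x y : (size P <= m.+1)%N -> (size Q <= n.+1)%N ->
  hev (m + n) (P * Q) x y = hev m P x y * hev n Q x y.
Proof.
move=> sP sQ; rewrite {1}(poly_widen sP) {1}(poly_widen sQ).
rewrite mulr_suml hev_sum /hev mulr_suml; apply: eq_bigr => i _.
rewrite mulr_sumr -/(hev _ _ _ _) hev_sum mulr_sumr; apply: eq_bigr => j _.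
have hi := ltn_ord i; have hj := ltn_ord j.
rewrite -scalerAl -scalerAr !hevZ -exprD hevXn; last by lia.
have -> : (m + n - (i + j) = (m - i) + (n - j))%N by lia.
rewrite !exprD; ring.
Qed.

Lemma hev_lin (a b x y : A) : hev 1 (a *: 'X + b%:P) x y = a * x + b * y.
Proof.
rewrite /hev !big_ord_recl big_ord0 /= !coefD !coefZ !coefC !coefX /=.
by rewrite !(mulr0, mulr1, add0r, addr0, expr0, expr1, subn0) addrC.
Qed.

Lemma size_lin (a b : A) : (size (a *: 'X + b%:P)%R <= 2)%N.
Proof.
apply: leq_trans (size_polyD _ _) _; rewrite geq_max.
rewrite (leq_trans (size_scale_leq _ _)) ?size_polyX //.
by rewrite (leq_trans (size_polyC_leq1 _)).
Qed.

Lemma size_expS Q n : (size Q <= 2)%N -> (size (Q ^+ n) <= n.+1)%N.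
Proof.
move=> sQ; apply: leq_trans (size_poly_exp_leq _ _) _; rewrite ltnS.
by case: (size Q) sQ => [|[|[|]]] //= _; rewrite ?mul1n ?mul0n.
Qed.

Lemma hev_linX (a b x y : A) n :
  hev n ((a *: 'X + b%:P) ^+ n) x y = (a * x + b * y) ^+ n.
Proof.
elim: n => [|n IH].
  by rewrite !expr0 /hev big_ord_recl big_ord0 coefC /= !mulr1 addr0.
rewrite exprS -add1n hevM ?size_lin ?hev_lin ?IH -?exprS //.
by apply/size_expS/size_lin.
Qed.

Lemma hactE g M Q : hact g M Q = \sum_(j < g.+1)
  Q`_j *: ((m00 M *: 'X + (m01 M)%:P) ^+ j * (m10 M *: 'X + (m11 M)%:P) ^+ (g - j)).
Proof.
by apply: eq_bigr => j _; rewrite coef_map /= -mulrA mul_polyC.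
Qed.

Lemma size_hact g M Q : (size (hact g M Q) <= g.+1)%N.
Proof.
rewrite hactE; apply: leq_trans (size_sum _ _ _) _; apply/bigmax_leqP => j _.
apply: leq_trans (size_scale_leq _ _) _.
apply: leq_trans (size_polyMleq _ _) _.
have h1 := size_expS j (size_lin (m00 M) (m01 M)).
have h2 := size_expS (g - j) (size_lin (m10 M) (m11 M)).
have hj := ltn_ord j; move: h1 h2.
set u := size _; set v := size _ => h1 h2; lia.
Qed.

Lemma hev_hact g M Q x y :
  hev g (hact g M Q) x y = hev g Q (m00 M * x + m01 M * y) (m10 M * x + m11 M * y).
Proof.
rewrite hactE hev_sum; apply: eq_bigr => j _.
rewrite hevZ -mulrA; congr (_ * _).
have hj := ltn_ord j; rewrite -{1}(subnKC (_ : j <= g)%N) //.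
by rewrite hevM ?hev_linX //; apply/size_expS/size_lin.
Qed.

Lemma hactD g M P Q : hact g M (P + Q) = hact g M P + hact g M Q.
Proof.
by rewrite !hactE -big_split; apply: eq_bigr => j _; rewrite coefD scalerDl.
Qed.

Lemma hactZ g M c Q : hact g M (c *: Q) = c *: hact g M Q.
Proof.
by rewrite !hactE scaler_sumr; apply: eq_bigr => j _; rewrite coefZ scalerA.
Qed.

Lemma hact_id g Q : (size Q <= g.+1)%N -> hact g (Mat2 1 0 0 1) Q = Q.
Proof.
move=> sQ; rewrite /hact /hev /= !scale0r scale1r addr0 add0r polyC1.
rewrite [RHS](poly_widen sQ); apply: eq_bigr => j _.
by rewrite coef_map /= expr1n mulr1 mul_polyC.
Qed.

Lemma hev_coef1 g Q : hev g Q 1 0 = Q`_g.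
Proof.
rewrite /hev big_ord_recr /= subnn expr0 expr1n !mulr1 big1 ?add0r // => j _.
have hj := ltn_ord j; by rewrite expr0n subn_eq0 leqNgt hj mulr0.
Qed.

Lemma hev_coef0 g Q : hev g Q 0 1 = Q`_0.
Proof.
rewrite /hev big_ord_recl /= expr0 expr1n !mulr1 big1 ?addr0 // => j _.
by rewrite exprS mul0r mulr0 mul0r.
Qed.

Lemma hev_scale g Q (t x y : A) : hev g Q (t * x) (t * y) = t ^+ g * hev g Q x y.
Proof.
rewrite /hev mulr_sumr; apply: eq_bigr => j _; have hj := ltn_ord j.
rewrite -[in t ^+ g](subnKC (_ : j <= g)%N) // exprD !exprMn; ring.
Qed.

Lemma horner_hev g Q (x : A) : (size Q <= g.+1)%N -> Q.[x] = hev g Q x 1.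
Proof.
move=> sQ; rewrite {1}(poly_widen sQ) horner_sum; apply: eq_bigr => j _.
by rewrite hornerZ hornerXn expr1n mulr1.
Qed.

End HomogeneousAction.

Lemma hev_map (A B : comNzRingType) (f : {rmorphism A -> B}) g (Q : {poly A}) x y :
  hev g (map_poly f Q) (f x) (f y) = f (hev g Q x y).
Proof.
by rewrite /hev rmorph_sum; apply: eq_bigr => j _; rewrite coef_map !rmorphM !rmorphXn.
Qed.

Lemma hact_map (A B : comNzRingType) (f : {rmorphism A -> B}) g M (Q : {poly A}) :
  map_poly f (hact g M Q) = hact g (map2 f M) (map_poly f Q).
Proof.
rewrite /hact -hev_map -!map_poly_comp.
have -> : map_poly (map_poly f \o polyC) Q = map_poly (polyC \o f) Q.
  by apply: eq_map_poly => c; rewrite /= map_polyC.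
by rewrite !rmorphD /= !map_polyZ /= map_polyX !map_polyC.
Qed.

(** The outer substitution is an evaluation over [{poly A}], where [hev_hact] applies to the inner
    one. The order of the product is reversed: this is a right action. *)
Lemma hact_comp (A : comNzRingType) g (M N : mat2 A) (Q : {poly A}) :
  hact g M (hact g N Q) = hact g (mul2 N M) Q.
Proof.
rewrite {1}/hact (hact_map polyC) hev_hact /hact; congr hev => /=;
  rewrite !(polyCD, polyCM) -!mul_polyC !(polyCD, polyCM); ring.
Qed.

(** * Cusps and Hecke operators *)

(** A cusp is represented by any nonzero integer vector on its line, not only by a primitive one:
    matrices of determinant p then act without renormalization. *)
Notation vec := (int * int)%type.

Definition vact (M : mat2 int) (x : vec) : vec :=
  (m00 M * x.1 + m01 M * x.2, m10 M * x.1 + m11 M * x.2).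

Definition vscale (m : int) (x : vec) : vec := (m * x.1, m * x.2).

Definition Smat : mat2 int := Mat2 0 (-1) 1 0.
Definition Tmat (n : int) : mat2 int := Mat2 1 n 0 1.
Definition cusp_oo : vec := (1, 0).
Definition cusp_0 : vec := (0, 1).

Lemma vec_neq0 (x : vec) : (x != 0) = (x.1 != 0) || (x.2 != 0).
Proof. by case: x => a b; rewrite -negb_and. Qed.

Lemma vact_mul M N x : vact M (vact N x) = vact (mul2 M N) x.
Proof. by rewrite /vact /=; congr pair; ring. Qed.

Lemma vact_neq0 M (x : vec) : det2 M != 0 -> x != 0 -> vact M x != 0.
Proof.
case: x => x y dM; rewrite !vec_neq0 /= => xn0.
rewrite -negb_and; apply: contra dM => /andP[/eqP e1 /eqP e2].
have : det2 M * x = 0.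
  transitivity (m11 M * (m00 M * x + m01 M * y) - m01 M * (m10 M * x + m11 M * y)).
    by rewrite /det2; ring.
  by rewrite e1 e2 !mulr0 subrr.
have : det2 M * y = 0.
  transitivity (m00 M * (m10 M * x + m11 M * y) - m10 M * (m00 M * x + m01 M * y)).
    by rewrite /det2; ring.
  by rewrite e1 e2 !mulr0 subrr.
move=> /eqP; rewrite mulf_eq0 => /orP[->//|/eqP y0] /eqP.
by rewrite mulf_eq0 => /orP[->//|/eqP x0]; move: xn0; rewrite x0 y0 eqxx.
Qed.

(* The Euclidean algorithm on the second coordinate. *)
Lemma cusp_rel_total (Z : vec -> vec -> Prop) :
  (forall x y, Z x y -> Z y x) ->
  (forall x y z : vec, x != 0 -> y != 0 -> z != 0 -> Z x y -> Z y z -> Z x z) ->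
  (forall (m : int) (x : vec), m != 0 -> x != 0 -> Z x (vscale m x)) ->
  (forall x y : vec, x != 0 -> y != 0 -> Z x y -> Z (vact Smat x) (vact Smat y)) ->
  (forall (n : int) (x y : vec), x != 0 -> y != 0 -> Z x y -> Z (vact (Tmat n) x) (vact (Tmat n) y)) ->
  Z cusp_0 cusp_oo ->
  forall x y : vec, x != 0 -> y != 0 -> Z x y.
Proof.
move=> Zsym Ztr Zsc ZS ZT Z0.
suff H (x : vec) : x != 0 -> Z cusp_oo x.
  by move=> x y x0 y0; apply: (Ztr _ cusp_oo) => //; [apply: Zsym; apply: H|apply: H].
move: {2}(`|x.2|%N).+1 (ltnSn `|x.2|%N) => n.
elim: n x => // n IH [a c] /= hc; have [->|c0] := eqVneq c 0 => xn0.
  have a0 : a != 0 by move: xn0; rewrite vec_neq0 /= ?eqxx ?orbF.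
  have := Zsc a cusp_oo a0 isT; by rewrite /vscale /= mulr1 mulr0.
set q := (a %/ c)%Z; set r := (a %% c)%Z.
have ea : a = q * c + r by exact: divz_eq.
have hr0 : 0 <= r by exact: modz_ge0.
have hr : r < `|c| by exact: ltz_mod.
have cr0 : (c, - r) != 0 by rewrite vec_neq0 /= c0.
have rc0 : (r, c) != 0 by rewrite vec_neq0 /= c0 orbT.
(* [Smat] sends oo and (c, -r) to 0 and (r, c). After a detour through 0, [Tmat q] fixes oo and
   sends (r, c) to (a, c). *)
have h1 : Z cusp_oo (c, - r) by apply: IH => //=; lia.
have h2 := ZS cusp_oo _ isT cr0 h1.
have h3 : Z cusp_0 (r, c).
  move: h2; congr Z; rewrite /vact /=; congr pair; ring.
have h4 : Z cusp_oo (r, c) by apply: (Ztr _ cusp_0) => //; exact: Zsym.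
have h5 := ZT q cusp_oo _ isT rc0 h4.
move: h5; congr Z; rewrite /vact /= ?ea; congr pair; ring.
Qed.

(** * The Hecke operator T_p and its compatibility with S and T *)

Definition Mup (p : nat) (b : int) : mat2 int := Mat2 1 b 0 p%:Z.
Definition Mdiag (p : nat) : mat2 int := Mat2 p%:Z 0 0 1.

(** The last argument ranges over an arbitrary type [D] because the operator serves twice: for
    symbols it is the second cusp, for antiderivatives a point of the half-plane. The adjugate
    stands in for the inverse and keeps the forms integral. Indexing by ['F_p] makes b -> b + n and,
    on nonzero indices, b -> -1/b into permutations. *)
Definition heckeT (C : zmodType) (D : Type) (act : mat2 int -> D -> D)
    (p g : nat) (G : vec -> {poly int} -> D -> C) (x : vec) (Q : {poly int})
    (z : D) : C :=
  \sum_(b : 'F_p) G (vact (Mup p (b : nat)) x) (hact g (adj2 (Mup p (b : nat))) Q)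
                    (act (Mup p (b : nat)) z)
  + G (vact (Mdiag p) x) (hact g (adj2 (Mdiag p)) Q) (act (Mdiag p) z).

Definition equivariant (C : zmodType) (D : Type) (dom : D -> Prop)
    (act : mat2 int -> D -> D) (g : nat) (G : vec -> {poly int} -> D -> C) :=
  forall (M : mat2 int) (x : vec) (Q : {poly int}) z, det2 M = 1 -> x != 0 -> dom z -> (size Q <= g.+1)%N ->
    G (vact M x) Q (act M z) = G x (hact g M Q) z.

Lemma det_Mup p b : det2 (Mup p b) = p%:Z.
Proof. by rewrite /det2 /=; ring. Qed.

Lemma det_Mdiag p : det2 (Mdiag p) = p%:Z.
Proof. by rewrite /det2 /=; ring. Qed.

Section FpIndex.
Variables (p : nat) (p_pr : prime p).

Lemma Fp_val_lt (b : 'F_p) : (b < p)%N.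
Proof. by have := ltn_ord b; rewrite [X in (_ < X)%N]Fp_cast. Qed.

Lemma Fp_natE (n : nat) : ((n%:R : 'F_p) : nat) = (n %% p)%N.
Proof. by rewrite val_Fp_nat. Qed.

(** With b' = -1/b, this says that the matrix (b, -e; p, -b') has determinant 1. It is the matrix
    that moves one term of T_p to another under S. *)
Lemma Fp_negV (b : 'F_p) : b != 0 ->
  exists e : int, (b : nat)%:Z * ((- b^-1 : 'F_p) : nat)%:Z + 1 = p%:Z * e.
Proof.
move=> b0; set b' := - b^-1.
have h : ((b * b' + 1)%N%:R : 'F_p) = 0.
  rewrite natrD natrM !natr_Zp mulrN divff // addNr //.
have : ((b * b' + 1) %% p)%N = 0%N by rewrite -Fp_natE h.
move=> /eqP hd; have /dvdnP[e he] : (p %| b * b' + 1)%N by [].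
by exists e%:Z; rewrite -!PoszM -PoszD he mulnC.
Qed.

Lemma Fp_addz (b : 'F_p) (n : int) :
  exists e : int, (b : nat)%:Z + n = (((b + n%:~R)%R : 'F_p) : nat)%:Z + p%:Z * e.
Proof.
have p0 : p%:Z != 0 by have := prime_gt0 p_pr; lia.
set m := `|((b : nat)%:Z + n) %% p%:Z|%Z%N.
have hm : (((b : nat)%:Z + n) %% p%:Z)%Z = m%:Z by rewrite gez0_abs // modz_ge0.
have e1 := divz_eq ((b : nat)%:Z + n) p%:Z.
have -> : b + n%:~R = m%:R :> 'F_p.
  have := congr1 (fun z : int => z%:~R : 'F_p) e1.
  rewrite hm !rmorphD /= rmorphM /= -!pmulrn natr_Zp => ->.
  by rewrite (_ : p%:R = 0 :> 'F_p) ?mulr0 ?add0r // pchar_Fp_0.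
rewrite Fp_natE modn_small.
  by exists (((b : nat)%:Z + n) %/ p%:Z)%Z; rewrite {1}e1 hm addrC mulrC.
by rewrite -ltz_nat -hm ltz_pmod // ; have := prime_gt0 p_pr; lia.
Qed.

Lemma Fp_sum_negV (V : zmodType) (F : 'F_p -> V) :
  \sum_(b | b != 0) F (- b^-1) = \sum_(b | b != 0) F b.
Proof.
have inv : involutive (fun b : 'F_p => - b^-1) by move=> b; rewrite invrN invrK opprK.
rewrite [RHS](reindex_inj (inv_inj inv)); apply: eq_bigl => b.
by rewrite oppr_eq0 invr_eq0.
Qed.

Lemma Fp_sum_add (V : zmodType) (F : 'F_p -> V) (c : 'F_p) :
  \sum_b F (b + c) = \sum_b F b.
Proof. by rewrite [RHS](reindex_inj (addIr c)). Qed.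

End FpIndex.

Section HeckeEquivariance.
Variables (C : zmodType) (D : Type) (dom : D -> Prop) (act : mat2 int -> D -> D).
Variables (p g : nat) (p_pr : prime p).
Hypothesis act_dom : forall (M : mat2 int) z, 0 < det2 M -> dom z -> dom (act M z).
Hypothesis act_mul : forall (M N : mat2 int) z, 0 < det2 M -> 0 < det2 N -> dom z ->
  act M (act N z) = act (mul2 M N) z.
Variable G : vec -> {poly int} -> D -> C.
Hypothesis G_eqv : equivariant dom act g G.

Let p_gt0 : 0 < p%:Z. Proof. by have := prime_gt0 p_pr; lia. Qed.

(** A representative [M] times [del] is an element [gam] of SL_2(Z) times another representative
    [N]. The first matrix identity moves the cusp and the point, the second one the polynomial, and
    equivariance under [gam] does the rest. *)
Lemma heckeT_term (M N gam del : mat2 int) (x : vec) Q z :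
  det2 del = 1 -> det2 gam = 1 -> det2 M = p%:Z -> det2 N = p%:Z ->
  mul2 M del = mul2 gam N -> mul2 (adj2 M) gam = mul2 del (adj2 N) ->
  x != 0 -> dom z ->
  G (vact M (vact del x)) (hact g (adj2 M) Q) (act M (act del z)) =
  G (vact N x) (hact g (adj2 N) (hact g del Q)) (act N z).
Proof.
move=> ddel dgam dM dN e1 e2 x0 dz.
rewrite vact_mul act_mul ?dM ?ddel // e1 -vact_mul -act_mul ?dN ?dgam //.
rewrite G_eqv ?size_hact //.
- by rewrite !hact_comp e2.
- by apply: vact_neq0; rewrite ?dN ?gt_eqF.
- by apply: act_dom; rewrite ?dN.
Qed.

(** S acts on the p + 1 terms as on the projective line over F_p: it exchanges 0 and oo and sends b
    to -1/b. *)
Lemma heckeT_S (x : vec) Q z : x != 0 -> dom z ->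
  heckeT act p g G (vact Smat x) Q (act Smat z) =
  heckeT act p g G x (hact g Smat Q) z.
Proof.
move=> x0 dz; rewrite /heckeT (bigD1 (0 : 'F_p)) //= [in RHS](bigD1 (0 : 'F_p)) //=.
have E (a b c a' b' c' : C) : a = c' -> c = a' -> b = b' ->
    a + b + c = a' + b' + c'.
  by move=> -> -> ->; rewrite addrC [c' + _]addrC addrA.
apply: E.
- apply: (@heckeT_term _ _ Smat); rewrite ?det_Mup ?det_Mdiag //;
    congr Mat2; rewrite /=; ring.
- apply: (@heckeT_term _ _ Smat); rewrite ?det_Mup ?det_Mdiag //;
    congr Mat2; rewrite /=; ring.
rewrite -[RHS]Fp_sum_negV; apply: eq_bigr => b b0.
have [e he] := Fp_negV p_pr b0; set b' := - b^-1 in he *.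
(* This matrix is [Mup p b] times S times the inverse of [Mup p b']; it is integral of determinant 1
   by [he]. *)
apply: (@heckeT_term _ _ (Mat2 (b : nat)%:Z (- e) p%:Z (- (b' : nat)%:Z)));
  rewrite ?det_Mup ?det_Mdiag //.
all: rewrite /det2 /mul2 /=; move: (Posz (b : nat)) (Posz (b' : nat)) (Posz p) he.
all: move=> B B' P he; try (congr Mat2); lia.
Qed.

Lemma heckeT_T n (x : vec) Q z : x != 0 -> dom z ->
  heckeT act p g G (vact (Tmat n) x) Q (act (Tmat n) z) =
  heckeT act p g G x (hact g (Tmat n) Q) z.
Proof.
move=> x0 dz; rewrite /heckeT; congr (_ + _); last first.
  apply: (@heckeT_term _ _ (Tmat (p%:Z * n))); rewrite ?det_Mdiag //;
    rewrite /det2 /mul2 /=; try (congr Mat2); ring.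
rewrite -[RHS](Fp_sum_add _ (n%:~R)); apply: eq_bigr => b _.
have [e he] := Fp_addz p_pr b n.
apply: (@heckeT_term _ _ (Tmat e)); rewrite ?det_Mup //;
  rewrite /det2 /mul2 /=; move: (Posz (b : nat)) (Posz ((b + n%:~R)%R : 'F_p)) (Posz p) he
    => B B' P he; try (congr Mat2); lia.
Qed.
End HeckeEquivariance.

(** On a concrete list this nested evaluation unfolds to an explicit expression in x and y, so that
    [ring] can check the certificates. *)
Fixpoint heval (s : seq int) (n : nat) (x y : int) : int :=
  if s is c :: s' then c * y ^+ n + x * heval s' n.-1 x y else 0.

Lemma hev_Poly s h (x y : int) : (size s <= h.+1)%N ->
  hev h (Poly s) x y = heval s h x y.
Proof.
move=> sh; transitivity (\sum_(j < h.+1) s`_j * x ^+ j * y ^+ (h - j)).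
  by apply: eq_bigr => j _; rewrite coef_Poly.
elim: s h sh => [|c s IH] h /=.
  by move=> _; rewrite big1 // => j _; rewrite nth_nil !mul0r.
rewrite ltnS big_ord_recl /= expr0 mulr1 subn0 => sh; congr (_ + _).
case: h sh => [|h] /= sh.
  by rewrite big_ord0; move: sh; rewrite leqn0 size_eq0 => /eqP ->; rewrite mulr0.
rewrite -IH // mulr_sumr; apply: eq_bigr => j _.
by rewrite exprS; ring.
Qed.

(* Entry j-1 of [period_cert h] is (D, A, B) with
   D X^j Y^(h-j) = A (1 + S) + B (1 + U + U^2), U of order 3; it was found by
   integer linear algebra. *)
Definition period_cert (h : nat) : seq (nat * seq int * seq int) :=
  match h with
  | 2 => [:: (1%N, [:: 1]%Z, [:: 0; (-1)]%Z)]
  | 4 => [:: (8%N, [:: 1; 2; 3; (-2); 1]%Z, [:: (-1)]%Z);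
     (2%N, [:: 0; 0; 1]%Z, [::]);
     (8%N, [:: 1; (-2); 3; 2; 1]%Z, [:: (-1)]%Z)]
  | 6 => [:: (36%N, [:: 3; 9; 7; 0; 8; (-9); 3]%Z, [:: 0; 2; (-3); (-4); (-1)]%Z);
     (10%N, [:: 0; 1; 3; 0; 2; (-1)]%Z, [:: (-1); 2]%Z);
     (6%N, [:: 0; 0; 1; 0; 2]%Z, [:: 0; (-1); 1]%Z);
     (10%N, [:: 0; (-1); 3; 0; 2; 1]%Z, [:: 1; (-2)]%Z);
     (36%N, [:: 3; (-9); 7; 0; 8; 9; 3]%Z, [:: 0; 2; (-3); (-4); (-1)]%Z)]
  | 8 => [:: (48%N, [:: 3; 12; 14; 0; (-7); 0; 14; (-12); 3]%Z, [:: 0; 1; 0; (-1); (-7); 1]%Z);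
     (14%N, [:: 0; 1; 3; 3; 0; (-4); 4; (-1)]%Z, [:: 0; 0; 0; 1; 0; (-1)]%Z);
     (6%N, [:: 0; 0; 1; 1; 2; (-2)]%Z, [:: (-2); 0; 1; 2; (-3); 0; 1; 1; 1]%Z);
     (2%N, [:: 0; 0; 0; 0; 1]%Z, [::]);
     (6%N, [:: 0; 0; 1; (-1); 2; 2]%Z, [:: (-2); 0; 1; 2; (-3); 0; 1; 1; 1]%Z);
     (14%N, [:: 0; (-1); 3; (-3); 0; 4; 4; 1]%Z, [:: 0; 0; 0; (-1); 0; 1]%Z);
     (48%N, [:: 3; (-12); 14; 0; (-7); 0; 14; 12; 3]%Z, [:: 0; 1; 0; (-1); (-7); 1]%Z)]
  | 12 => [:: (72%N, [:: 3; 18; 33; 0; (-49); 0; 66; 0; (-50); 0; 33; (-18); 3]%Z, [:: 0; (-7); 6; 15; (-7); (-2); (-16); (-2); (-7); 15; (-1)]%Z);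
     (66%N, [:: 0; 3; 17; 27; 0; (-33); 0; 33; 0; (-28); 16; (-3)]%Z, [:: 0; 0; 0; (-5); 5; 8; 0; (-8); (-5); 5]%Z);
     (60%N, [:: 0; 0; 3; 15; 23; 0; (-21); 0; 22; (-15); 3]%Z, [:: 0; 2; (-2); (-3); 0; 3; 0; 3; 0; (-3)]%Z);
     (18%N, [:: 0; 0; 0; 1; 5; 6; 0; (-6); 4; (-1)]%Z, [:: 0; (-1); 0; 1; 3; (-4); 0; 0; 7; (-11); 5]%Z);
     (24%N, [:: 0; 0; 0; 0; 1; 6; 9; (-6); 2]%Z, [:: (-208); 72; 22; (-11); (-13); 3; 8; (-3); (-14); 1; 25; 62; 132]%Z);
     (2%N, [:: 0; 0; 0; 0; 0; 0; 1]%Z, [::]);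
     (24%N, [:: 0; 0; 0; 0; 1; (-6); 9; 6; 2]%Z, [:: (-208); 72; 22; (-11); (-13); 3; 8; (-3); (-14); 1; 25; 62; 132]%Z);
     (18%N, [:: 0; 0; 0; (-1); 5; (-6); 0; 6; 4; 1]%Z, [:: 0; 1; 0; (-1); (-3); 4; 0; 0; (-7); 11; (-5)]%Z);
     (60%N, [:: 0; 0; 3; (-15); 23; 0; (-21); 0; 22; 15; 3]%Z, [:: 0; 2; (-2); (-3); 0; 3; 0; 3; 0; (-3)]%Z);
     (66%N, [:: 0; (-3); 17; (-27); 0; 33; 0; (-33); 0; 28; 16; 3]%Z, [:: 0; 0; 0; 5; (-5); (-8); 0; 8; 5; (-5)]%Z);
     (72%N, [:: 3; (-18); 33; 0; (-49); 0; 66; 0; (-50); 0; 33; 18; 3]%Z, [:: 0; (-7); 6; 15; (-7); (-2); (-16); (-2); (-7); 15; (-1)]%Z)]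
  | _ => [::]
  end.

(** The points (-y, x), (x - y, x) and (-y, x - y) are the images of (x, y) under S, U and U^2,
    where U = (1, -1; 1, 0). *)
Definition cert_ok (h j : nat) (c : nat * seq int * seq int) :=
  forall x y : int, (c.1.1)%:Z * (x ^+ j * y ^+ (h - j)) =
    (heval c.1.2 h x y + heval c.1.2 h (- y) x)
    + (heval c.2 h x y + heval c.2 h (x - y) x + heval c.2 h (- y) (x - y)).

Lemma period_certP h j : h \in [:: 2; 4; 6; 8; 12]%N -> (j < h.-1)%N ->
  cert_ok h j.+1 (nth (0%N, [::], [::]) (period_cert h) j).
Proof.
rewrite !inE => /or4P[|||/orP[]] /eqP -> /=;
  by do 12?[case: j => [|j]] => // _ x y /=; ring.
Qed.

(* The pairs (h, p) for which p divides no D of the table. *)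
Definition good_weight (p h : nat) :=
  [|| h == 2, (h == 4) && (4 < p), (h == 6) && (6 < p), (h == 8) && (8 < p)
    | (h == 12) && (12 < p)]%N.

(** In weight 2 the only D is 1. In the other weights the primes dividing some D are at most h, and
    [good_weight] puts h below p. *)
Lemma period_cert_coprime p h j : prime p -> good_weight p h -> (j < h.-1)%N ->
  coprime (nth (0%N, [::], [::]) (period_cert h) j).1.1 p.
Proof.
move=> p_pr gh hj; rewrite coprime_sym prime_coprime //; move: gh hj.
have dv m D : (m < p)%N -> (0 < D)%N -> all (fun q => (q <= m)%N) (primes D) ->
    ~~ (p %| D)%N.
  move=> mp D0 /allP H; apply/negP => pD.
  have : p \in primes D by rewrite mem_primes p_pr D0.
  by move/H; rewrite leqNgt mp.
rewrite /good_weight => /orP[/eqP ->|/or4P[] /andP[/eqP -> hp]];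
  do 12?[case: j => [|j]] => //= _; [apply: (dv 1%N)|apply: (dv _ _ hp)..] => //.
by rewrite prime_gt1.
Qed.

(** * Modular symbols *)

(** Three subgroups of the complex numbers occur: 0, the lattice of periods, and p times this
    lattice. Equalities, integrality and congruences are thereby treated by the same lemmas. *)
Definition subgrp (V : zmodType) (K : V -> Prop) :=
  K 0 /\ forall x y, K x -> K y -> K (x - y).

Section Subgroup.
Variables (V : zmodType) (K : V -> Prop) (hK : subgrp K).

Lemma subgrp0 : K 0. Proof. exact: hK.1. Qed.
Lemma subgrpB x y : K x -> K y -> K (x - y). Proof. exact: hK.2. Qed.
Lemma subgrpN x : K x -> K (- x).
Proof. by move=> kx; rewrite -sub0r; apply: subgrpB => //; exact: subgrp0. Qed.
Lemma subgrpD x y : K x -> K y -> K (x + y).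
Proof. by move=> kx ky; rewrite -[y]opprK; apply/subgrpB/subgrpN. Qed.
Lemma subgrp_sum (I : Type) (r : seq I) (P : pred I) F :
  (forall i, P i -> K (F i)) -> K (\sum_(i <- r | P i) F i).
Proof.
by move=> h; elim/big_rec: _ => [|i x Pi kx]; [exact: subgrp0|apply: subgrpD => //; exact: h].
Qed.
Lemma subgrpMn x n : K x -> K (x *+ n).
Proof. by move=> kx; elim: n => [|n IH]; [exact: subgrp0|rewrite mulrS; exact: subgrpD]. Qed.
Lemma subgrpMz x n : K x -> K (x *~ n).
Proof.
move=> kx; case: n => n; first exact: subgrpMn.
by rewrite NegzE mulrNz; apply/subgrpN/subgrpMn.
Qed.
Lemma subgrp_congr x y : K (x - y) -> K y -> K x.
Proof. by move=> h ky; rewrite -[x](subrK y); exact: subgrpD. Qed.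
Lemma subgrp_trans x y z : K (x - y) -> K (y - z) -> K (x - z).
Proof. by move=> h1 h2; rewrite -[x](subrK y) -addrA; exact: subgrpD. Qed.
End Subgroup.

Lemma subgrp_intl (C : pzRingType) (K : C -> Prop) (n : int) x :
  subgrp K -> K x -> K (n%:~R * x).
Proof. by move=> hK kx; rewrite mulrzl; exact: subgrpMz. Qed.

(** Modular symbols of weight [g + 2]. Together with additivity, the third clause makes a value
    depend only on the cusps, not on the vectors chosen; the fourth one is invariance under SL_2(Z),
    acting on cusps and polynomials at once. *)
Definition symbol (C : numFieldType) (g : nat) (Phi : vec -> vec -> {poly int} -> C) :=
  [/\ forall x y P Q, Phi x y (P + Q) = Phi x y P + Phi x y Q,
      forall (x y z : vec) Q, x != 0 -> y != 0 -> z != 0 ->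
        Phi x y Q + Phi y z Q = Phi x z Q,
      forall (m : int) (x : vec) Q, m != 0 -> x != 0 -> Phi x (vscale m x) Q = 0 &
      equivariant (fun y : vec => y != 0) vact g (fun x Q y => Phi x y Q)].

Definition symT (C : numFieldType) p g (Phi : vec -> vec -> {poly int} -> C) x y Q :=
  heckeT vact p g (fun x Q y => Phi x y Q) x Q y.

Lemma vscale_neq0 (m : int) (x : vec) : m != 0 -> x != 0 -> vscale m x != 0.
Proof. by rewrite !vec_neq0 /= !mulf_eq0 => /negPf ->. Qed.

Lemma vact_scale M m x : vact M (vscale m x) = vscale m (vact M x).
Proof. by rewrite /vact /vscale /=; congr pair; ring. Qed.

Section SymbolModulo.
Variables (C : numFieldType) (g : nat) (K : C -> Prop) (hK : subgrp K).
Variable D : vec -> vec -> {poly int} -> C.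
Hypothesis D_add : forall (x y z : vec) Q, x != 0 -> y != 0 -> z != 0 ->
  K (D x y Q + D y z Q - D x z Q).
Hypothesis D_scale : forall (m : int) (x : vec) Q, m != 0 -> x != 0 ->
  K (D x (vscale m x) Q).
Hypothesis D_S : forall (x y : vec) (Q : {poly int}), x != 0 -> y != 0 -> (size Q <= g.+1)%N ->
  K (D (vact Smat x) (vact Smat y) Q - D x y (hact g Smat Q)).
Hypothesis D_T : forall n (x y : vec) (Q : {poly int}), x != 0 -> y != 0 -> (size Q <= g.+1)%N ->
  K (D (vact (Tmat n) x) (vact (Tmat n) y) Q - D x y (hact g (Tmat n) Q)).
Hypothesis D_base : forall Q : {poly int}, (size Q <= g.+1)%N -> K (D cusp_0 cusp_oo Q).

Lemma symbol_mod_diag (x : vec) Q : x != 0 -> K (D x x Q).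
Proof.
move=> x0; have := D_scale Q (isT : 1 != 0 :> int) x0.
by rewrite /vscale !mul1r -surjective_pairing.
Qed.

Lemma symbol_mod_anti (x y : vec) Q : x != 0 -> y != 0 -> K (D x y Q + D y x Q).
Proof.
move=> x0 y0; rewrite -[_ + _](subrK (D x x Q)); apply: (subgrpD hK).
  exact: D_add.
exact: symbol_mod_diag.
Qed.

(** Manin's trick relative to a subgroup [K]: lying in [K] for every polynomial is a relation
    between two cusps, and [cusp_rel_total] applies to it. With [K] = 0 it proves identities, with
    the lattice integrality, with p times the lattice congruences. *)
Lemma symbol_mod_total (x y : vec) (Q : {poly int}) :
  x != 0 -> y != 0 -> (size Q <= g.+1)%N -> K (D x y Q).
Proof.
move=> x0 y0; move: Q.
pose Z (x y : vec) := x != 0 -> y != 0 ->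
  forall Q : {poly int}, (size Q <= g.+1)%N -> K (D x y Q).
suff : Z x y by move=> h Q; exact: h.
apply: (@cusp_rel_total Z) => // {x y x0 y0}.
- move=> x y h y0 x0 Q sQ; apply: (subgrp_congr hK (y := - D x y Q)).
    by rewrite opprK; exact: symbol_mod_anti.
  by apply: subgrpN => //; exact: h.
- move=> x y z x0 y0 z0 h1 h2 _ _ Q sQ; rewrite -[D x z Q]opprK.
  apply: subgrpN => //; apply: (subgrp_congr hK (y := - (D x y Q + D y z Q))).
    by rewrite opprK addrC; exact: D_add.
  by apply: subgrpN => //; apply: subgrpD => //; [exact: h1|exact: h2].
- by move=> m x m0 x0 _ _ Q _; exact: D_scale.
- move=> x y x0 y0 h _ _ Q sQ; apply: (subgrp_congr hK (D_S x0 y0 sQ)).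
  by apply: h => //; exact: size_hact.
- move=> n x y x0 y0 h _ _ Q sQ; apply: (subgrp_congr hK (D_T n x0 y0 sQ)).
  by apply: h => //; exact: size_hact.
- by move=> _ _; exact: D_base.
Qed.
End SymbolModulo.

Section SymbolTheory.
Variables (C : numFieldType) (g : nat).
Implicit Types Phi : vec -> vec -> {poly int} -> C.

Lemma symbol0 Phi x y : symbol g Phi -> Phi x y 0 = 0.
Proof. by case=> lin _ _ _; apply: (addrI (Phi x y 0)); rewrite -lin !addr0. Qed.

Lemma symbolN Phi x y Q : symbol g Phi -> Phi x y (- Q) = - Phi x y Q.
Proof.
move=> h; have [lin _ _ _] := h.
by apply/eqP; rewrite -addr_eq0 -lin addNr (symbol0 _ _ h).
Qed.

Lemma symbolZ Phi x y (n : int) Q : symbol g Phi -> Phi x y (n *: Q) = n%:~R * Phi x y Q.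
Proof.
move=> h; have [lin _ _ _] := h; rewrite mulrzl.
have H (m : nat) : Phi x y (m%:Z *: Q) = Phi x y Q *+ m.
  elim: m => [|m IH]; first by rewrite scale0r (symbol0 _ _ h).
  by rewrite intS scalerDl scale1r lin IH -mulrS.
case: n => m; first exact: H.
by rewrite NegzE scaleNr (symbolN _ _ _ h) H mulrNz.
Qed.

Lemma symbol_sum Phi x y (I : Type) (r : seq I) (P : pred I) (F : I -> {poly int}) :
  symbol g Phi -> Phi x y (\sum_(i <- r | P i) F i) = \sum_(i <- r | P i) Phi x y (F i).
Proof.
move=> h; have [lin _ _ _] := h.
by elim/big_rec2: _ => [|i u v _ <-]; [exact: symbol0|rewrite lin].
Qed.

Lemma symbol_anti Phi (x y : vec) Q : symbol g Phi -> x != 0 -> y != 0 ->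
  Phi y x Q = - Phi x y Q.
Proof.
move=> [_ add sc _] x0 y0; apply/eqP; rewrite -addr_eq0 add //.
have := sc 1 y Q isT y0; by rewrite /vscale !mul1r -surjective_pairing => ->.
Qed.

Lemma symbol_scaler Phi (m : int) (x y : vec) Q : symbol g Phi -> m != 0 ->
  x != 0 -> y != 0 -> Phi x (vscale m y) Q = Phi x y Q.
Proof.
move=> [_ add sc _] m0 x0 y0; rewrite -(add x y) ?sc ?addr0 //.
exact: vscale_neq0.
Qed.

Lemma symbol_scalel Phi (m : int) (x y : vec) Q : symbol g Phi -> m != 0 ->
  x != 0 -> y != 0 -> Phi (vscale m x) y Q = Phi x y Q.
Proof.
move=> h m0 x0 y0; rewrite symbol_anti // ?vscale_neq0 // symbol_scaler //.
by rewrite symbol_anti // opprK.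
Qed.

Lemma symbolD_comb Phi1 Phi2 (c : C) : symbol g Phi1 -> symbol g Phi2 ->
  symbol g (fun x y Q => Phi1 x y Q - c * Phi2 x y Q).
Proof.
move=> [l1 a1 s1 e1] [l2 a2 s2 e2]; split.
- by move=> x y P Q; rewrite l1 l2; ring.
- by move=> x y z Q x0 y0 z0; rewrite -(a1 x y z) // -(a2 x y z) //; ring.
- by move=> m x Q m0 x0; rewrite s1 ?s2 // mulr0 subr0.
- by move=> M x Q y dM x0 y0 sQ; rewrite e1 // e2.
Qed.

Section Hecke.
Variables (p : nat) (p_pr : prime p).

Let p_gt0 : 0 < p%:Z. Proof. by have := prime_gt0 p_pr; lia. Qed.
Let vdom (M : mat2 int) (z : vec) : 0 < det2 M -> z != 0 -> vact M z != 0.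
Proof. by move=> h; apply: vact_neq0; rewrite gt_eqF. Qed.

Lemma Mup_neq0 b (x : vec) : x != 0 -> vact (Mup p b) x != 0.
Proof. by apply: vdom; rewrite det_Mup. Qed.
Lemma Mdiag_neq0 (x : vec) : x != 0 -> vact (Mdiag p) x != 0.
Proof. by apply: vdom; rewrite det_Mdiag. Qed.

Lemma symT_S Phi (x y : vec) Q : symbol g Phi -> x != 0 -> y != 0 ->
  symT p g Phi (vact Smat x) (vact Smat y) Q = symT p g Phi x y (hact g Smat Q).
Proof.
move=> [_ _ _ e] x0 y0; apply: (heckeT_S (dom := fun y : vec => y != 0)) => //.
by move=> M N z _ _ _; exact: vact_mul.
Qed.

Lemma symT_T Phi n (x y : vec) Q : symbol g Phi -> x != 0 -> y != 0 ->
  symT p g Phi (vact (Tmat n) x) (vact (Tmat n) y) Q = symT p g Phi x y (hact g (Tmat n) Q).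
Proof.
move=> [_ _ _ e] x0 y0; apply: (heckeT_T (dom := fun y : vec => y != 0)) => //.
by move=> M N z _ _ _; exact: vact_mul.
Qed.

Lemma symT_add Phi (x y z : vec) Q : symbol g Phi -> x != 0 -> y != 0 -> z != 0 ->
  symT p g Phi x y Q + symT p g Phi y z Q = symT p g Phi x z Q.
Proof.
move=> [_ a _ _] x0 y0 z0; rewrite /symT /heckeT addrACA -big_split /=.
congr (_ + _); last by apply: a; exact: Mdiag_neq0.
by apply: eq_bigr => b _; apply: a; exact: Mup_neq0.
Qed.

Lemma symT_scale Phi m (x : vec) Q : symbol g Phi -> m != 0 -> x != 0 ->
  symT p g Phi x (vscale m x) Q = 0.
Proof.
move=> [_ _ s _] m0 x0; rewrite /symT /heckeT big1 => [|b _].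
  by rewrite vact_scale s ?addr0 // Mdiag_neq0.
by rewrite vact_scale s // Mup_neq0.
Qed.

(* Both sides are determined by their values on the path from 0 to oo. *)
Lemma symT_eigen Phi Phi' (a s : C) : symbol g Phi -> symbol g Phi' ->
  (forall Q : {poly int}, (size Q <= g.+1)%N -> symT p g Phi cusp_0 cusp_oo Q
     = a * Phi cusp_0 cusp_oo Q + s * Phi' cusp_0 cusp_oo Q) ->
  forall (x y : vec) (Q : {poly int}), x != 0 -> y != 0 -> (size Q <= g.+1)%N ->
    symT p g Phi x y Q = a * Phi x y Q + s * Phi' x y Q.
Proof.
move=> h h' base x y Q x0 y0 sQ; have [_ ad sc ev] := h; have [_ ad' sc' ev'] := h'.
suff : symT p g Phi x y Q - (a * Phi x y Q + s * Phi' x y Q) = 0.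
  by move/eqP; rewrite subr_eq0 => /eqP.
apply: (@symbol_mod_total C g (fun c => c = 0) _ (fun x y Q =>
  symT p g Phi x y Q - (a * Phi x y Q + s * Phi' x y Q))) => // {x y Q x0 y0 sQ}.
- by split=> // x y -> ->; rewrite subrr.
- move=> x y z Q x0 y0 z0; rewrite -(symT_add Q h x0 y0 z0) -(ad x y z) //.
  by rewrite -(ad' x y z) //; ring.
- by move=> m x Q m0 x0; rewrite symT_scale // sc // sc' // !mulr0 addr0 subr0.
- move=> x y Q x0 y0 sQ; rewrite symT_S //.
  by rewrite [Phi _ _ _]ev // [Phi' _ _ _]ev' // subrr.
- move=> n x y Q x0 y0 sQ; rewrite symT_T //.
  by rewrite [Phi (vact _ _) _ _]ev // ?[Phi' (vact _ _) _ _]ev' // ?subrr // /det2 /=; ring.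
- by move=> Q sQ; rewrite base // subrr.
Qed.
End Hecke.
End SymbolTheory.

(** * The boundary symbol *)

Section BoundarySymbol.

Definition vgcd (x : vec) : int := gcdz x.1 x.2.
Definition primv (x : vec) : vec := ((x.1 %/ vgcd x)%Z, (x.2 %/ vgcd x)%Z).

Lemma vgcd_neq0 (x : vec) : x != 0 -> vgcd x != 0.
Proof. by rewrite vec_neq0 /vgcd gcdz_eq0 negb_and. Qed.

Lemma primvK (x : vec) : vscale (vgcd x) (primv x) = x.
Proof.
by case: x => a b; rewrite /vscale /primv /vgcd /= mulrC divzK ?dvdz_gcdl //
  mulrC divzK ?dvdz_gcdr.
Qed.

Lemma vscale_inj (d : int) : d != 0 -> injective (vscale d).
Proof. by move=> d0 [a b] [a' b'] [/(mulfI d0) -> /(mulfI d0) ->]. Qed.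

Lemma vscale_mul d e x : vscale d (vscale e x) = vscale (d * e) x.
Proof. by rewrite /vscale /= !mulrA. Qed.

Lemma vgcd_dvd_act M x : (vgcd x %| vgcd (vact M x))%Z.
Proof.
by rewrite dvdz_gcd /= !rpredD // ?dvdz_mull // ?dvdz_gcdl ?dvdz_gcdr.
Qed.

Lemma vact_adjK M x : det2 M = 1 -> vact (adj2 M) (vact M x) = x.
Proof.
case: x => a b dM; rewrite /vact /=; congr pair.
  by rewrite -[RHS]mul1r -dM /det2; ring.
by rewrite -[RHS]mul1r -dM /det2; ring.
Qed.

(** The gcd of x divides that of M x; the adjugate, which is the inverse of M, gives the
    converse. *)
Lemma vgcd_act M x : det2 M = 1 -> vgcd (vact M x) = vgcd x.
Proof.
move=> dM; have h1 := vgcd_dvd_act M x.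
have := vgcd_dvd_act (adj2 M) (vact M x); rewrite vact_adjK // => h2.
move: h1 h2; rewrite !dvdzE => h1 h2.
have e y : vgcd y = `|vgcd y|%N by [].
by rewrite (e (vact M x)) (e x); congr Posz; apply/eqP; rewrite eqn_dvd h1 h2.
Qed.

Lemma primv_act M (x : vec) : det2 M = 1 -> x != 0 -> primv (vact M x) = vact M (primv x).
Proof.
move=> dM x0; apply: (vscale_inj (vgcd_neq0 x0)).
by rewrite -{1}(vgcd_act x dM) primvK -vact_scale primvK.
Qed.

Lemma primv_scale m (x : vec) : m != 0 -> x != 0 ->
  primv (vscale m x) = vscale (sgz m) (primv x).
Proof.
move=> m0 x0; have md0 : `|m| * vgcd x != 0 by rewrite mulf_neq0 ?normr_eq0 // vgcd_neq0.
have e : vgcd (vscale m x) = `|m| * vgcd x.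
  by rewrite /vgcd /vscale /gcdz /= !abszM -muln_gcdr PoszM abszE.
apply: (vscale_inj md0); rewrite -{1}e primvK vscale_mul.
rewrite -[in LHS](primvK x) vscale_mul; congr vscale.
by rewrite [in LHS](intEsg m) abszE; ring.
Qed.

Lemma primv_coprime (x : vec) : coprimez x.1 x.2 -> primv x = x.
Proof. by case: x => a b /eqP h; rewrite /primv /vgcd /= h !divz1. Qed.

Variables (C : numFieldType) (g : nat).

(** To evaluate a form at a cusp a primitive vector is chosen. It is unique up to sign, and a form
    of even degree does not see the sign. *)
Definition boundary (x y : vec) (Q : {poly int}) : C :=
  (hev g Q (primv y).1 (primv y).2 - hev g Q (primv x).1 (primv x).2)%:~R.

Hypothesis g_even : ~~ odd g.

Lemma hev_sign (m : int) (Q : {poly int}) (x y : int) : m != 0 ->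
  hev g Q (sgz m * x) (sgz m * y) = hev g Q x y.
Proof.
move=> m0; rewrite hev_scale.
have {1}-> : g = (2 * g./2)%N by rewrite mul2n -[LHS]odd_double_half (negPf g_even).
rewrite exprM.
have -> : sgz m ^+ 2 = 1 by case: sgzP m0 => // ->; rewrite eqxx.
by rewrite expr1n mul1r.
Qed.

Lemma boundary_symbol : symbol g boundary.
Proof.
split.
- by move=> x y P Q; rewrite /boundary -rmorphD /= !hevD; congr _%:~R; ring.
- by move=> x y z Q _ _ _; rewrite /boundary -rmorphD /=; congr _%:~R; ring.
- move=> m x Q m0 x0; rewrite /boundary primv_scale // /vscale /=.
  by rewrite hev_sign // subrr.
- move=> M x Q y dM x0 y0 _; rewrite /boundary !primv_act // !hev_hact.
  by [].
Qed.

Lemma boundary_0_oo Q : boundary cusp_0 cusp_oo Q = (Q`_g - Q`_0)%:~R.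
Proof. by rewrite /boundary !primv_coprime //= hev_coef1 hev_coef0. Qed.

End BoundarySymbol.

(** * Binary forms modulo p *)

Section FpReduction.
Variables (p : nat) (p_pr : prime p).

Lemma intr_Fp_eq0 (c : int) : ((c%:~R : 'F_p) == 0) = (p%:Z %| c)%Z.
Proof.
have H (n : nat) : ((n%:R : 'F_p) == 0) = (p %| n)%N.
  by rewrite -(dvdn_pcharf (pchar_Fp p_pr)).
case: c => n; first by rewrite -pmulrn H /dvdz.
by rewrite NegzE rmorphN oppr_eq0 /= -pmulrn H dvdzE abszN.
Qed.

Lemma intr_Fp_eq (c d : int) : c%:~R = d%:~R :> 'F_p -> exists e, c = d + p%:Z * e.
Proof.
move=> /eqP; rewrite -subr_eq0 -rmorphB /= intr_Fp_eq0 => /dvdzP[e he].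
by exists e; rewrite mulrC -he addrC subrK.
Qed.

(** The quotient by p keeps the degree bound, which matters because a symbol is known to be integral
    only on forms of degree at most g. *)
Lemma poly_Fp_eq (P Q : {poly int}) n : (size P <= n)%N -> (size Q <= n)%N ->
  map_poly (intr : int -> 'F_p) P = map_poly intr Q ->
  exists2 R : {poly int}, (size R <= n)%N & P = Q + p%:Z *: R.
Proof.
move=> sP sQ e; pose R := \poly_(i < n) ((P`_i - Q`_i) %/ p%:Z)%Z.
exists R; first exact: size_poly.
apply/polyP => i; rewrite coefD coefZ coef_poly.
case: ltnP => hi; last by rewrite !nth_default ?mulr0 ?addr0 // (leq_trans _ hi).
have /polyP/(_ i) := e; rewrite !coef_map /= => /eqP.
by rewrite -subr_eq0 -rmorphB /= intr_Fp_eq0 => hd; rewrite mulrC divzK // addrC subrK.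
Qed.

(** Q(pX - bY, Y) is congruent to Q(-b, 1) Y^g: only the value at one point of the projective line
    survives. [hact_Mdiag_mod] is the same for the point oo, where Q(X, pY) is congruent to Q(1, 0)
    X^g. *)
Lemma hact_Mup_mod g (Q : {poly int}) (b : int) :
  exists2 R : {poly int}, (size R <= g.+1)%N &
    hact g (adj2 (Mup p b)) Q = (hev g Q (- b) 1)%:P + p%:Z *: R.
Proof.
apply: poly_Fp_eq; first exact: size_hact.
  by rewrite (leq_trans (size_polyC_leq1 _)).
rewrite (hact_map (intr : {rmorphism int -> 'F_p})) map_polyC /=.
rewrite -(hev_map (intr : {rmorphism int -> 'F_p})) hactE /hev raddf_sum.
apply: eq_bigr => j _ /=; rewrite !rmorphN rmorph1 /=.
rewrite (_ : (Posz p)%:~R = 0 :> 'F_p); last first.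
  by apply/eqP; rewrite intr_Fp_eq0.
by rewrite !rmorph0 oppr0 !scale0r !add0r !expr1n !mulr1 -polyCN -polyC_exp -mul_polyC -polyCM.
Qed.

Lemma hact_Mdiag_mod g (Q : {poly int}) :
  exists2 R : {poly int}, (size R <= g.+1)%N &
    hact g (adj2 (Mdiag p)) Q = hev g Q 1 0 *: 'X^g + p%:Z *: R.
Proof.
apply: poly_Fp_eq; first exact: size_hact.
  by rewrite (leq_trans (size_scale_leq _ _)) // size_polyXn.
rewrite (hact_map (intr : {rmorphism int -> 'F_p})) map_polyZ /= map_polyXn.
rewrite -(hev_map (intr : {rmorphism int -> 'F_p})) hactE /hev scaler_suml.
apply: eq_bigr => j _ /=; rewrite oppr0 rmorph0 rmorph1 /=.
rewrite (_ : (Posz p)%:~R = 0 :> 'F_p); last first.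
  by apply/eqP; rewrite intr_Fp_eq0.
rewrite !scale0r scale1r addr0 add0r expr1n mulr1.
have hj := ltn_ord j; case: (ltngtP j g) => [lt|gt|->]; last first.
- by rewrite subnn !expr0 !mulr1.
- by move: gt; rewrite ltnNge -ltnS hj.
by rewrite !expr0n subn_eq0 leqNgt lt !mulr0 scale0r scaler0.
Qed.

(** Fermat's little theorem; the exponents are positive because 0^0 = 1 would break it at a = 0. *)
Lemma Fp_expr_congr (a : 'F_p) m n : (0 < m)%N -> (0 < n)%N ->
  m = n %[mod p.-1] -> a ^+ m = a ^+ n.
Proof.
move=> m0 n0; wlog le_mn : m n m0 n0 / (m <= n)%N.
  by move=> H h; case: (leqP m n) => [|/ltnW] hl; [apply: H|apply/esym/H].
have [->|a0] := eqVneq a 0; first by rewrite !expr0n !gtn_eqF.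
move=> /esym/eqP; rewrite eqn_mod_dvd // => /dvdnP[e he].
rewrite -(subnKC le_mn) exprD he mulnC exprM.
suff -> : a ^+ p.-1 = 1 by rewrite expr1n mulr1.
apply: (mulfI a0); rewrite -exprS prednK ?prime_gt0 // mulr1.
by have := expf_card a; rewrite card_Fp.
Qed.
End FpReduction.

(** * Hecke operators modulo p *)

Section PeriodRelations.
Variables (C : numFieldType) (p h : nat) (p_pr : prime p) (h_good : good_weight p h).
Variables (K L : C -> Prop) (hK : subgrp K) (pL_K : forall c, L c -> K (p%:R * c)).
Variable psi : {poly int} -> C.
Hypothesis psi_hev : forall P Q, (forall x y : int, hev h P x y = hev h Q x y) ->
  psi P = psi Q.
Hypothesis psiD : forall P Q, psi (P + Q) = psi P + psi Q.
Hypothesis psiZ : forall (n : int) Q, psi (n *: Q) = n%:~R * psi Q.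
Hypothesis psi_L : forall Q : {poly int}, (size Q <= h.+1)%N -> L (psi Q).
Hypothesis psi_S : forall Q : {poly int}, (size Q <= h.+1)%N -> K (psi Q + psi (hact h Smat Q)).
Let U := Mat2 1 (-1) 1 0 : mat2 int.
Hypothesis psi_U : forall Q : {poly int}, (size Q <= h.+1)%N ->
  K (psi Q + psi (hact h U Q) + psi (hact h (mul2 U U) Q)).

Lemma good_weight_mem : h \in [:: 2; 4; 6; 8; 12]%N.
Proof.
by move: h_good; rewrite /good_weight !inE =>
  /orP[->|/or4P[] /andP[-> _]]; rewrite ?orbT.
Qed.

Lemma period_cert_size j : (j < h.-1)%N ->
  let c := nth (0%N, [::], [::]) (period_cert h) j in
  (size c.1.2 <= h.+1)%N && (size c.2 <= h.+1)%N.
Proof.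
have := good_weight_mem; rewrite !inE => /or4P[|||/orP[]] /eqP -> /=;
  by do 12?[case: j => [|j]].
Qed.

(** The certificate makes [D psi(X^j)] a sum of one two-term and one three-term relation, so it lies
    in [K]. Modulo p the integer D is invertible, and p psi(X^j) lies in [K] as well. *)
Lemma period_vanish j : (0 < j < h)%N -> K (psi 'X^j).
Proof.
case: j => // j /= hj; have hj' : (j < h.-1)%N by lia.
have := period_cert_coprime p_pr h_good hj'.
have /andP[] := period_cert_size hj'; have := period_certP good_weight_mem hj'.
case: (nth _ _ _) => [[D A] B] /= cok sA sB cop.
have sPA : (size (Poly A) <= h.+1)%N by apply: leq_trans (size_Poly _) _.
have sPB : (size (Poly B) <= h.+1)%N by apply: leq_trans (size_Poly _) _.
have KD : K (D%:R * psi 'X^(j.+1)).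
  have -> : D%:R * psi 'X^(j.+1) = (psi (Poly A) + psi (hact h Smat (Poly A)))
      + (psi (Poly B) + psi (hact h U (Poly B)) + psi (hact h (mul2 U U) (Poly B))).
    rewrite -!psiD [_%:R]pmulrn -psiZ; apply: psi_hev => x y.
    rewrite !hevD !hev_hact hevZ hevXn ?(ltnW hj) //.
    rewrite !hev_Poly // cok /=.
    by congr (_ + _ + (_ + _ + _)); congr heval; ring.
  by apply: (subgrpD hK); [exact: psi_S|exact: psi_U].
have D0 : (0 < D)%N.
  case: D cop {cok KD} => [|//]; rewrite /coprime gcd0n => /eqP e1.
  by move: (prime_gt1 p_pr); rewrite e1.
(* Bezout: u D = v p + 1. *)
have [u v e _] := egcdnP p D0.
move: cop; rewrite /coprime => /eqP cop; rewrite cop in e.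
have -> : psi 'X^(j.+1) = u%:R * (D%:R * psi 'X^(j.+1)) - p%:R * (v%:R * psi 'X^(j.+1)).
  rewrite !mulrA -!natrM e [(p * v)%N]mulnC natrD mulrDl mul1r.
  by rewrite addrAC subrr add0r.
rewrite [p%:R * _]mulrCA !pmulrn; apply: (subgrpB hK); apply: subgrp_intl => //.
by rewrite -pmulrn; apply: pL_K; apply: psi_L; rewrite size_polyXn ltnS ltnW.
Qed.
End PeriodRelations.

Section HeckeModP.
Variables (C : numFieldType) (g p h : nat) (p_pr : prime p).
Hypotheses (g_gt0 : (0 < g)%N) (g_even : ~~ odd g).
Hypotheses (h_good : good_weight p h) (gh : g = h %[mod p.-1]).
Variables (Phi : vec -> vec -> {poly int} -> C) (hPhi : symbol g Phi).
Variables (L : C -> Prop) (hL : subgrp L).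
Hypothesis Phi_L : forall (x y : vec) (Q : {poly int}), x != 0 -> y != 0 ->
  (size Q <= g.+1)%N -> L (Phi x y Q).

Definition multiples (c : C) := exists2 l, L l & c = p%:R * l.

Lemma multiples_subgrp : subgrp multiples.
Proof.
split; first by exists 0; rewrite ?mulr0 //; exact: subgrp0.
by move=> _ _ [x Lx ->] [y Ly ->]; exists (x - y); rewrite ?mulrBr //; exact: subgrpB.
Qed.
Let hK := multiples_subgrp.

Lemma multiples_congr (c d : int) l : c%:~R = d%:~R :> 'F_p -> L l ->
  multiples (c%:~R * l - d%:~R * l).
Proof.
move=> /(intr_Fp_eq p_pr)[e ->] Ll; exists (e%:~R * l); first exact: subgrp_intl.
by rewrite rmorphD rmorphM /=; ring.
Qed.

Lemma good_weight_gt0 : (0 < h)%N.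
Proof. by have := good_weight_mem h_good; rewrite !inE; lia. Qed.

Lemma good_weight_even : ~~ odd h.
Proof. by have := good_weight_mem h_good; rewrite !inE => /or4P[|||/orP[]] /eqP ->. Qed.

Let m_up (b : 'F_p) (x y : vec) :=
  Phi (vact (Mup p (b : nat)) x) (vact (Mup p (b : nat)) y) 1.
Let m_diag (x y : vec) := Phi (vact (Mdiag p) x) (vact (Mdiag p) y) 'X^g.

(* The mod p reduction of [symT]: a polynomial enters only through its values
   on the projective line over 'F_p, so its weight [w] only matters modulo p-1. *)
Definition symTmod w (x y : vec) (Q : {poly int}) : C :=
  \sum_(b : 'F_p) (hev w Q (- (b : nat)%:Z) 1)%:~R * m_up b x y
  + (hev w Q 1 0)%:~R * m_diag x y.

Lemma m_up_L b (x y : vec) : x != 0 -> y != 0 -> L (m_up b x y).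
Proof. by move=> x0 y0; apply: Phi_L; rewrite ?Mup_neq0 // size_poly1. Qed.
Lemma m_diag_L (x y : vec) : x != 0 -> y != 0 -> L (m_diag x y).
Proof. by move=> x0 y0; apply: Phi_L; rewrite ?Mdiag_neq0 // size_polyXn. Qed.

Lemma symTmod_L w (x y : vec) Q : x != 0 -> y != 0 -> L (symTmod w x y Q).
Proof.
move=> x0 y0; apply: (subgrpD hL).
  by apply: subgrp_sum => // b _; apply: subgrp_intl => //; exact: m_up_L.
by apply: subgrp_intl => //; exact: m_diag_L.
Qed.

(** The remainders in [hact_Mup_mod] and [hact_Mdiag_mod] are p times forms of degree at most g, on
    which [Phi] takes values in [L]. *)
Lemma symT_mod (x y : vec) Q : x != 0 -> y != 0 ->
  multiples (symT p g Phi x y Q - symTmod g x y Q).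
Proof.
move=> x0 y0; rewrite /symT /heckeT /symTmod opprD addrACA -sumrB.
have [lin _ _ _] := hPhi; apply: (subgrpD hK).
  apply: subgrp_sum => // b _; have [R sR ->] := hact_Mup_mod p_pr g Q (b : nat)%:Z.
  rewrite lin -alg_polyC !(symbolZ _ _ _ _ hPhi) addrAC subrr add0r.
  by exists (Phi (vact (Mup p (b : nat)) x) (vact (Mup p (b : nat)) y) R) => //;
     apply: Phi_L => //; exact: Mup_neq0.
have [R sR ->] := hact_Mdiag_mod p_pr g Q.
rewrite lin !(symbolZ _ _ _ _ hPhi) addrAC subrr add0r.
by exists (Phi (vact (Mdiag p) x) (vact (Mdiag p) y) R) => //;
     apply: Phi_L => //; exact: Mdiag_neq0.
Qed.

Lemma symTmod_add w (x y z : vec) Q : x != 0 -> y != 0 -> z != 0 ->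
  symTmod w x y Q + symTmod w y z Q = symTmod w x z Q.
Proof.
have [_ a _ _] := hPhi; move=> x0 y0 z0; rewrite /symTmod addrACA -big_split /=.
congr (_ + _); last by rewrite -mulrDr a ?Mdiag_neq0.
by apply: eq_bigr => b _; rewrite -mulrDr a ?Mup_neq0.
Qed.

Lemma symTmod_scale w m (x : vec) Q : m != 0 -> x != 0 -> symTmod w x (vscale m x) Q = 0.
Proof.
have [_ _ s _] := hPhi; move=> m0 x0; rewrite /symTmod /m_up /m_diag.
rewrite big1 => [|b _]; rewrite !vact_scale s ?mulr0 ?addr0 //.
  exact: Mdiag_neq0.
exact: Mup_neq0.
Qed.

Lemma symTmod_hev w (x y : vec) P Q :
  (forall a b : int, hev w P a b = hev w Q a b) -> symTmod w x y P = symTmod w x y Q.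
Proof. by move=> e; rewrite /symTmod e; congr (_ + _); apply: eq_bigr => b _; rewrite e. Qed.

Lemma symTmodD w (x y : vec) P Q :
  symTmod w x y (P + Q) = symTmod w x y P + symTmod w x y Q.
Proof.
rewrite /symTmod addrACA -big_split /= hevD rmorphD mulrDl; congr (_ + _).
by apply: eq_bigr => b _; rewrite hevD rmorphD mulrDl.
Qed.

Lemma symTmodZ w (x y : vec) (n : int) Q : symTmod w x y (n *: Q) = n%:~R * symTmod w x y Q.
Proof.
rewrite /symTmod mulrDr hevZ rmorphM mulrA mulr_sumr; congr (_ + _).
by apply: eq_bigr => b _; rewrite hevZ rmorphM mulrA.
Qed.

Lemma m_up_transport (b b' : 'F_p) (gam del : mat2 int) (x y : vec) :
  det2 gam = 1 -> mul2 (Mup p (b : nat)) del = mul2 gam (Mup p (b' : nat)) ->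
  x != 0 -> y != 0 ->
  m_up b (vact del x) (vact del y) =
  Phi (vact (Mup p (b' : nat)) x) (vact (Mup p (b' : nat)) y) (hact g gam 1).
Proof.
have [_ _ _ ev] := hPhi; move=> dg e x0 y0.
by rewrite /m_up !vact_mul e -!vact_mul [LHS]ev ?Mup_neq0 ?size_poly1.
Qed.

Lemma hact_one M : hact g M 1 = (m10 M *: 'X + (m11 M)%:P) ^+ g :> {poly int}.
Proof.
rewrite hactE big_ord_recl /= coefC /= scale1r expr0 mul1r subn0 big1 ?addr0 // => j _.
by rewrite coefC /= scale0r.
Qed.

Lemma lin_pow_mod (c : int) : exists2 R : {poly int}, (size R <= g.+1)%N &
  (p%:Z *: 'X + c%:P) ^+ g = (c ^+ g)%:P + p%:Z *: R.
Proof.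
apply: (poly_Fp_eq p_pr); first by apply/size_expS/size_lin.
  by rewrite (leq_trans (size_polyC_leq1 _)).
rewrite rmorphXn rmorphD /= map_polyZ /= !map_polyC /= (_ : (Posz p)%:~R = 0 :> 'F_p).
  by rewrite scale0r add0r rmorphXn polyC_exp.
by apply/eqP; rewrite intr_Fp_eq0.
Qed.

(** The matrix (b, -e; p, -b') turns the form 1 into (pX - b')^g, congruent to the constant (-b')^g.
    Since g = h modulo p - 1, this factor of weight g equals (-b')^h in F_p; hence the formula is
    equivariant in weight h although [Phi] has weight g. *)
Lemma symTmod_S_term (b b' : 'F_p) (x y : vec) (Q : {poly int}) : b != 0 ->
  b' = - b^-1 -> x != 0 -> y != 0 ->
  multiples ((hev h Q (- (b : nat)%:Z) 1)%:~R * m_up b (vact Smat x) (vact Smat y)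
    - (hev h (hact h Smat Q) (- (b' : nat)%:Z) 1)%:~R * m_up b' x y).
Proof.
move=> b0 eb' x0 y0; have [e] := Fp_negV p_pr b0; rewrite -eb' => he.
rewrite (@m_up_transport b b' (Mat2 (b : nat)%:Z (- e) p%:Z (- (b' : nat)%:Z))) //;
  first last.
- rewrite /mul2 /=; move: (Posz (b : nat)) (Posz (b' : nat)) (Posz p) he => B B' P he.
  by congr Mat2; lia.
- rewrite /det2 /=; move: (Posz (b : nat)) (Posz (b' : nat)) (Posz p) he => B B' P he; lia.
rewrite hact_one /=.
have [R sR ->] := lin_pow_mod (- (b' : nat)%:Z).
have [lin _ _ _] := hPhi; rewrite lin -alg_polyC !(symbolZ _ _ _ _ hPhi) -/(m_up b' x y).
rewrite mulrDr addrAC; apply: (subgrpD hK); last first.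
  rewrite -pmulrn mulrCA; eexists; last by [].
  by apply: subgrp_intl => //; apply: Phi_L => //; exact: Mup_neq0.
rewrite mulrA -rmorphM; apply: multiples_congr; last exact: m_up_L.
have nb : (b : nat)%:R = b :> 'F_p by rewrite natr_Zp.
have : (b' : nat)%:R = - b^-1 :> 'F_p by rewrite natr_Zp.
move: (b : nat) (b' : nat) nb => m m' nb nb'.
rewrite rmorphM rmorphXn /= hev_hact /= -!(hev_map (intr : {rmorphism int -> 'F_p})).
rewrite !(rmorphD, rmorphM, rmorphN, rmorph0, rmorph1) /= -!pmulrn nb nb'.
(* Then (-b')^h Q(-b, 1) = Q(b b', -b') = Q(-1, -b'), as b b' = -1 in F_p. *)
rewrite (@Fp_expr_congr p p_pr _ g h) ?good_weight_gt0 // mulrC -hev_scale.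
rewrite !(mul0r, mul1r, mulr0, mulr1, addr0, add0r); congr hev.
by rewrite mulrN opprK mulVf.
Qed.

Lemma symTmod_S (x y : vec) (Q : {poly int}) : x != 0 -> y != 0 ->
  multiples (symTmod h (vact Smat x) (vact Smat y) Q - symTmod h x y (hact h Smat Q)).
Proof.
move=> x0 y0; have [lin _ _ ev] := hPhi.
have e0 : m_up 0 (vact Smat x) (vact Smat y) = m_diag x y.
  rewrite /m_up /m_diag !vact_mul (_ : mul2 _ _ = mul2 Smat (Mdiag p)).
    rewrite -!vact_mul [LHS]ev ?Mdiag_neq0 ?size_poly1 // hact_one /=.
    by rewrite scale1r addr0.
  by congr Mat2; rewrite /=; ring.
have eoo : m_diag (vact Smat x) (vact Smat y) = m_up 0 x y.
  rewrite /m_up /m_diag !vact_mul (_ : mul2 _ _ = mul2 Smat (Mup p 0)).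
    rewrite -!vact_mul [LHS]ev ?Mup_neq0 ?size_polyXn // hactE.
    rewrite big_ord_recr /= big1 => [|j _]; last first.
      by rewrite coefXn ltn_eqF ?scale0r.
    rewrite coefXn eqxx scale1r subnn expr0 mulr1 add0r scale0r add0r polyCN.
    by rewrite -signr_odd (negPf g_even) expr0.
  by congr Mat2; rewrite /=; ring.
have hS (a b : int) : hev h (hact h Smat Q) a b = hev h Q (- b) a.
  by rewrite hev_hact /=; congr hev; ring.
(* Needed for the pair 0, oo: the form transformed by S has at (0, 1) the value Q(-1, 0), which must
   be Q(1, 0). *)
have hneg (a b : int) : hev h Q (- a) (- b) = hev h Q a b.
  rewrite -[- a]mulN1r -[- b]mulN1r hev_scale -signr_odd.
  by rewrite (negPf good_weight_even) expr0 mul1r.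
have -> : symTmod h (vact Smat x) (vact Smat y) Q - symTmod h x y (hact h Smat Q)
  = \sum_(b : 'F_p | b != 0)
     ((hev h Q (- (b : nat)%:Z) 1)%:~R * m_up b (vact Smat x) (vact Smat y)
    - (hev h (hact h Smat Q) (- ((- b^-1 : 'F_p) : nat)%:Z) 1)%:~R * m_up (- b^-1) x y).
  rewrite sumrB (@Fp_sum_negV p _ (fun b : 'F_p =>
     (hev h (hact h Smat Q) (- (b : nat)%:Z) 1)%:~R * m_up b x y)).
  rewrite /symTmod (bigD1 (0 : 'F_p)) //= [in X in _ - X](bigD1 (0 : 'F_p)) //=.
  have h1 := hneg 1 0; rewrite oppr0 in h1; rewrite e0 eoo !hS ?oppr0 h1; ring.
by apply: (subgrp_sum hK) => b b0; exact: symTmod_S_term.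
Qed.

(** Translations require no change of weight: [Tmat e] fixes the form 1, and X^g becomes (X +
    pnY)^g, congruent to X^g. *)
Lemma symTmod_T n (x y : vec) (Q : {poly int}) : x != 0 -> y != 0 ->
  multiples (symTmod h (vact (Tmat n) x) (vact (Tmat n) y) Q
    - symTmod h x y (hact h (Tmat n) Q)).
Proof.
move=> x0 y0; have [lin _ _ ev] := hPhi.
rewrite /symTmod opprD addrACA; apply: (subgrpD hK); last first.
  rewrite hev_hact /= !(mulr1, mulr0, mul0r, addr0, add0r) -mulrBr.
  apply: (subgrp_intl _ hK); rewrite /m_diag !vact_mul.
  rewrite (_ : mul2 _ _ = mul2 (Tmat (p%:Z * n)) (Mdiag p)); last first.
    by congr Mat2; rewrite /=; ring.
  rewrite -!vact_mul [X in X - _]ev ?Mdiag_neq0 ?size_polyXn //; last first.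
    by rewrite /det2 /=; ring.
  have [R sR ->] : exists2 R : {poly int}, (size R <= g.+1)%N &
      hact g (Tmat (p%:Z * n)) 'X^g = 'X^g + p%:Z *: R.
    apply: (poly_Fp_eq p_pr); rewrite ?size_hact ?size_polyXn //.
    rewrite (hact_map (intr : {rmorphism int -> 'F_p})) map_polyXn /map2 /=.
    rewrite rmorphM /= (_ : (Posz p)%:~R = 0 :> 'F_p) ?mul0r ?hact_id ?size_polyXn //.
    by apply/eqP; rewrite intr_Fp_eq0.
  rewrite lin (symbolZ _ _ _ _ hPhi) addrAC subrr add0r -pmulrn.
  by eexists; last by []; apply: Phi_L => //; exact: Mdiag_neq0.
rewrite -[X in _ - X](@Fp_sum_add p _ _ (n%:~R)) -sumrB.
apply: (subgrp_sum hK) => b _; have [e] := Fp_addz p_pr b n.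
have [b' eb'] : exists b' : 'F_p, b' = b + n%:~R by eexists.
rewrite -!eb' => he.
rewrite (@m_up_transport b b' (Tmat e)) //; first last.
- rewrite /mul2 /=; move: (Posz (b : nat)) (Posz (b' : nat)) (Posz p) he => B B' P he.
  by congr Mat2; lia.
- by rewrite /det2 /=; ring.
rewrite hact_one /= scale0r add0r polyC1 expr1n.
apply: multiples_congr; last by apply: Phi_L; rewrite ?Mup_neq0 ?size_poly1.
rewrite hev_hact -!(hev_map (intr : {rmorphism int -> 'F_p})).
rewrite !(rmorphD, rmorphM, rmorphN, rmorph0, rmorph1) /= -!pmulrn !natr_Zp eb'.
by congr hev; ring.
Qed.

Lemma symTmod_U (x y : vec) (Q : {poly int}) : x != 0 -> y != 0 ->
  multiples (symTmod h (vact (Mat2 1 (-1) 1 0) x) (vact (Mat2 1 (-1) 1 0) y) Q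
    - symTmod h x y (hact h (Mat2 1 (-1) 1 0) Q)).
Proof.
move=> x0 y0; have eU : Mat2 1 (-1) 1 0 = mul2 (Tmat 1) Smat by [].
rewrite eU -!vact_mul -hact_comp.
apply: (subgrp_trans hK); last exact: symTmod_S.
by apply: symTmod_T; apply: vact_neq0.
Qed.

(** S exchanges 0 and oo, and U permutes 0, oo, 1 cyclically. A path and its reverse cancel, and so
    do the three sides of the triangle; equivariance turns these cancellations into the relations
    that [period_vanish] asks for. *)
Lemma symTmod_period j : (0 < j < h)%N -> multiples (symTmod h cusp_0 cusp_oo 'X^j).
Proof.
have nz0 : cusp_0 != 0 by []. have nzoo : cusp_oo != 0 by [].
have nz1 : (1, 1) != 0 :> vec by [].
have diag (x : vec) Q : x != 0 -> symTmod h x x Q = 0.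
  move=> x0; have := symTmod_scale h Q (isT : 1 != 0 :> int) x0.
  by rewrite /vscale !mul1r -surjective_pairing.
have neg (x y : vec) Q : x != 0 -> y != 0 -> symTmod h (vscale (-1) x) y Q = symTmod h x y Q.
  move=> x0 y0; have nx0 := vscale_neq0 (isT : -1 != 0 :> int) x0.
  by rewrite -[RHS](symTmod_add _ _ x0 nx0 y0) symTmod_scale // add0r.
apply: (@period_vanish C p h p_pr h_good multiples L hK _ (symTmod h cusp_0 cusp_oo)).
- by move=> c Lc; exists c.
- by move=> P Q; exact: symTmod_hev.
- by move=> P Q; exact: symTmodD.
- by move=> n Q; exact: symTmodZ.
- by move=> Q _; exact: symTmod_L.
- move=> Q sQ; have := subgrpN hK (symTmod_S Q nz0 nzoo); rewrite opprB.
  have -> : vact Smat cusp_0 = vscale (-1) cusp_oo by [].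
  have -> : vact Smat cusp_oo = cusp_0 by [].
  rewrite neg // -[X in _ - X](addKr (symTmod h cusp_0 cusp_oo Q)).
  by rewrite symTmod_add // diag // addr0 opprK addrC.
move=> Q sQ; set U := Mat2 1 (-1) 1 0.
have h1 := symTmod_U Q nz0 nzoo.
have h2 := symTmod_U Q (_ : vact U cusp_0 != 0) (_ : vact U cusp_oo != 0).
have h3 := symTmod_U (hact h U Q) nz0 nzoo.
rewrite -hact_comp -/U in h1 h2 h3 *.
have e : symTmod h cusp_0 cusp_oo Q + symTmod h (vact U cusp_0) (vact U cusp_oo) Q
   + symTmod h (vact U (vact U cusp_0)) (vact U (vact U cusp_oo)) Q = 0.
  have -> : vact U cusp_0 = vscale (-1) cusp_oo by [].
  have -> : vact U cusp_oo = (1, 1) by [].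
  have -> : vact U (vscale (-1) cusp_oo) = vscale (-1) (1, 1) by [].
  have -> : vact U (1, 1) = cusp_0 by [].
  by rewrite !neg // !symTmod_add // diag.
set A := symTmod h cusp_0 cusp_oo Q in e *.
set B := symTmod h (vact U cusp_0) _ Q in e h1 *.
set B' := symTmod h cusp_0 cusp_oo (hact h U Q) in h1 *.
have -> : A + B' + symTmod h cusp_0 cusp_oo (hact h U (hact h U Q)) =
  - (B - B') - (symTmod h (vact U (vact U cusp_0)) (vact U (vact U cusp_oo)) Q
        - symTmod h (vact U cusp_0) (vact U cusp_oo) (hact h U Q))
  - (symTmod h (vact U cusp_0) (vact U cusp_oo) (hact h U Q)
        - symTmod h cusp_0 cusp_oo (hact h U (hact h U Q))).
  by rewrite -[LHS]subr0 -e; ring.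
apply: (subgrpB hK) => //; apply: (subgrpB hK); last exact: h2.
exact: subgrpN.
Qed.

(** The factor u is the value on X^h along the path from 0 to oo. On this path the difference is 0
    modulo p in degree h by the choice of u, in the middle degrees by [symTmod_period], and in
    degree 0 by the relation for S, since the boundary symbol is 1 on X^h and -1 on 1. *)
Lemma symTmod_boundary : exists2 u, L u & forall (x y : vec) (Q : {poly int}),
  x != 0 -> y != 0 -> (size Q <= h.+1)%N ->
  multiples (symTmod h x y Q - u * boundary C h x y Q).
Proof.
have nz0 : cusp_0 != 0 by []. have nzoo : cusp_oo != 0 by [].
have h0 := good_weight_gt0; have he := good_weight_even.
pose u := symTmod h cusp_0 cusp_oo 'X^h.
have Lu : L u by exact: symTmod_L.
exists u => // x y Q x0 y0 sQ.
have [bD badd bsc bev] := boundary_symbol C he.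
apply: (@symbol_mod_total C h multiples hK (fun x y Q =>
  symTmod h x y Q - u * boundary C h x y Q)) => // {x y Q x0 y0 sQ}.
- move=> x y z Q x0 y0 z0; rewrite -(symTmod_add h Q x0 y0 z0) -(badd x y z) //.
  by rewrite (_ : _ - _ = 0); [exact: subgrp0|ring].
- move=> m x Q m0 x0; rewrite symTmod_scale // bsc // mulr0 subr0; exact: subgrp0.
- move=> x y Q x0 y0 sQ; rewrite [boundary C h (vact _ _) _ _]bev //.
  rewrite [X in multiples X](_ : _ = symTmod h (vact Smat x) (vact Smat y) Q
    - symTmod h x y (hact h Smat Q)); last by ring.
  exact: symTmod_S.
- move=> n x y Q x0 y0 sQ; rewrite [boundary C h (vact _ _) _ _]bev //; last first.
    by rewrite /det2 /=; ring.
  rewrite [X in multiples X](_ : _ = symTmod h (vact (Tmat n) x) (vact (Tmat n) y) Q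
    - symTmod h x y (hact h (Tmat n) Q)); last by ring.
  exact: symTmod_T.
move=> Q sQ; rewrite boundary_0_oo.
have lin (F : 'I_h.+1 -> {poly int}) : symTmod h cusp_0 cusp_oo (\sum_i F i)
    = \sum_i symTmod h cusp_0 cusp_oo (F i).
  elim/big_rec2: _ => [|i v w _ <-]; last by rewrite symTmodD.
  by rewrite -(scale0r 0) symTmodZ mul0r.
rewrite {1}(poly_widen sQ) lin.
rewrite (bigD1 ord_max) // (bigD1 ord0) /=; last by rewrite -val_eqE /= ltn_eqF.
rewrite !symTmodZ -/u.
have hS : multiples (u + symTmod h cusp_0 cusp_oo 'X^0).
  have := symTmod_S 'X^h nz0 nzoo.
  have -> : vact Smat cusp_0 = vscale (-1) cusp_oo by [].
  have -> : vact Smat cusp_oo = cusp_0 by [].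
  have -> : hact h Smat 'X^h = 'X^0.
    rewrite hactE big_ord_recr /= big1 => [|j _]; last first.
      by rewrite coefXn ltn_eqF ?scale0r.
    rewrite coefXn eqxx scale1r subnn expr0 mulr1 add0r scale0r add0r polyCN.
    by rewrite -signr_odd (negPf he).
  move=> hh; have := subgrpN hK hh; rewrite opprB addrC.
  have nx0 := vscale_neq0 (isT : -1 != 0 :> int) nzoo.
  rewrite -(symTmod_add _ _ nx0 nzoo nz0).
  have -> : symTmod h (vscale (-1) cusp_oo) cusp_oo 'X^h = 0.
    by have := symTmod_scale h 'X^h (isT : -1 != 0 :> int) nx0; rewrite vscale_mul.
  rewrite add0r.
  have -> : symTmod h cusp_oo cusp_0 'X^h = - u.
    apply/eqP; rewrite -addr_eq0 /u symTmod_add //.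
    by have := symTmod_scale h 'X^h (isT : 1 != 0 :> int) nzoo => ->.
  by rewrite opprK.
set S0 := \sum_(i < _ | _) _; have KS : multiples S0.
  apply: (subgrp_sum hK) => j /andP[j1 j2]; rewrite symTmodZ.
  apply: (subgrp_intl _ hK); apply: symTmod_period.
  by move: j1 j2 (ltn_ord j); rewrite -!val_eqE /=; lia.
have -> : (Q`_h)%:~R * u + ((Q`_0)%:~R * symTmod h cusp_0 cusp_oo 'X^0 + S0)
   - u * (Q`_h - Q`_0)%:~R
   = (Q`_0)%:~R * (u + symTmod h cusp_0 cusp_oo 'X^0) + S0.
  by rewrite rmorphB /=; ring.
by apply: (subgrpD hK) => //; apply: (subgrp_intl _ hK).
Qed.

Variables (a s : C).
Hypothesis Phi_T : forall (x y : vec) (Q : {poly int}), x != 0 -> y != 0 ->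
  (size Q <= g.+1)%N -> symT p g Phi x y Q = a * Phi x y Q + s * boundary C g x y Q.
Hypotheses (aL : forall c, L c -> L (a * c)) (Ls : L s).

(** On the path from 0 to oo the boundary symbol vanishes on X^j, so one factor a can be replaced by
    T_p; modulo p this leaves values of [Phi] on the form 1. The other factor a becomes T_p on the
    form 1, where weight g may be replaced by weight h. *)
Lemma hecke_square_mod j : (0 < j < g)%N -> multiples (a * a * Phi cusp_0 cusp_oo 'X^j).
Proof.
move=> /andP[j0 jg]; have nz0 : cusp_0 != 0 by []. have nzoo : cusp_oo != 0 by [].
have h0 := good_weight_gt0.
have aK c : multiples c -> multiples (a * c).
  by move=> [l Ll ->]; exists (a * l); [exact: aL|rewrite mulrCA].
have e : a * Phi cusp_0 cusp_oo 'X^j = symT p g Phi cusp_0 cusp_oo 'X^j.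
  rewrite Phi_T ?size_polyXn ?ltnS 1?ltnW // boundary_0_oo !coefXn.
  by rewrite (gtn_eqF jg) (ltn_eqF j0) subrr mulr0 addr0.
rewrite -mulrA e; apply: (subgrp_congr hK (y := a * symTmod g cusp_0 cusp_oo 'X^j)).
  by rewrite -mulrBr; apply/aK/symT_mod.
rewrite /symTmod (hevXn _ _ (ltnW jg)) expr1n mul1r expr0n subn_eq0 leqNgt jg mul0r addr0.
rewrite mulr_sumr; apply: (subgrp_sum hK) => b _.
rewrite (hevXn _ _ (ltnW jg)) expr1n mulr1 mulrCA.
(* The term b = 0 drops out because j > 0. It has to: (0, p) is not primitive, and the boundary
   symbol on its path is -1 instead of a multiple of p. *)
have [->|b0] := eqVneq b 0.
  by rewrite oppr0 expr0n (gtn_eqF j0) mul0r; exact: subgrp0.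
apply: (subgrp_intl _ hK); rewrite /m_up.
set x := vact _ cusp_0; set y := vact _ cusp_oo.
have x0 : x != 0 by exact: Mup_neq0.
have y0 : y != 0 by exact: Mup_neq0.
have ex : x = ((b : nat)%:Z, p%:Z) by rewrite /x /vact /=; congr pair; ring.
have ey : y = (1, 0) by rewrite /y /vact /=; congr pair; ring.
have px : primv x = x.
  rewrite ex; apply: primv_coprime; rewrite /coprimez /gcdz /= eqz_nat -/(coprime _ _).
  rewrite coprime_sym prime_coprime // gtnNdvd ?Fp_val_lt //.
  by rewrite lt0n; apply: contra b0 => /eqP b0; apply/eqP/val_inj; rewrite /= b0.
have py : primv y = y by rewrite ey primv_coprime.
have one w (c d : int) : hev w 1 c d = d ^+ w.
  by rewrite -(expr0 'X) hevXn // expr0 mul1r subn0.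
(* Y^w is 0 at (1, 0) and p^w at the primitive vector (b, p). *)
have bd w : (0 < w)%N -> boundary C w x y 1 = - (p%:R * p%:R ^+ w.-1).
  move=> w0; rewrite /boundary px py !one ex ey /=.
  by rewrite expr0n gtn_eqF // sub0r rmorphN rmorphXn /= -pmulrn -exprS prednK.
have Kp c w : L c -> (0 < w)%N -> multiples (c * boundary C w x y 1).
  move=> Lc w0; rewrite bd // mulrN; apply: (subgrpN hK).
  exists (c * p%:R ^+ w.-1); last by rewrite mulrCA.
  by rewrite mulrC -natrX pmulrn; exact: subgrp_intl.
(* Y^g and Y^h are both 1 at every (-b, 1) and 0 at (1, 0). *)
have ew : symTmod g x y 1 = symTmod h x y 1.
  rewrite /symTmod !one !expr0n !gtn_eqF //; congr (_ + _).
  by apply: eq_bigr => c _; rewrite !one !expr1n.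
have [u Lu hu] := symTmod_boundary.
have := Phi_T x0 y0 (_ : (size (1 : {poly int})%R <= g.+1)%N); rewrite size_poly1 => /(_ isT).
move/eqP; rewrite -subr_eq => /eqP <-.
apply: (subgrpB hK); last exact: Kp.
apply: (subgrp_congr hK (symT_mod 1 x0 y0)); rewrite ew.
apply: (subgrp_congr hK (hu x y 1 x0 y0 _)); last exact: Kp.
by rewrite size_poly1.
Qed.

End HeckeModP.

(** * The lattice of periods *)

Section EigenSymbol.
Variables (C : numFieldType) (g : nat) (g_gt1 : (1 < g)%N) (g_even : ~~ odd g).
Variables (Phi : vec -> vec -> {poly int} -> C) (hPhi : symbol g Phi).
Variable a : nat -> C.
Hypothesis Phi_T : forall l (Q : {poly int}), prime l -> (size Q <= g.+1)%N ->
  symT l g Phi cusp_0 cusp_oo Q = a l * Phi cusp_0 cusp_oo Q.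

Let g_gt0 : (0 < g)%N. Proof. exact: ltnW. Qed.
Let nz0 : cusp_0 != 0. Proof. by []. Qed.
Let nzoo : cusp_oo != 0. Proof. by []. Qed.

Lemma primv_axis1 (m : int) : 0 < m -> primv (m, 0) = (1, 0).
Proof.
move=> m0; have -> : (m, 0) = vscale m (1, 0) :> vec by rewrite /vscale /= mulr1 mulr0.
rewrite primv_scale ?gt_eqF // gtr0_sgz // primv_coprime //.
Qed.

Lemma primv_axis2 (m : int) : 0 < m -> primv (0, m) = (0, 1).
Proof.
move=> m0; have -> : (0, m) = vscale m (0, 1) :> vec by rewrite /vscale /= mulr1 mulr0.
rewrite primv_scale ?gt_eqF // gtr0_sgz // primv_coprime //.
Qed.

Lemma primv_Mup p (b : 'F_p) : prime p -> b != 0 ->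
  primv ((b : nat)%:Z, p%:Z) = ((b : nat)%:Z, p%:Z).
Proof.
move=> p_pr b0; apply: primv_coprime; rewrite /coprimez /gcdz /= eqz_nat -/(coprime _ _).
rewrite coprime_sym prime_coprime // gtnNdvd ?Fp_val_lt //.
by rewrite lt0n; apply: contra b0 => /eqP b0; apply/eqP/val_inj; rewrite /= b0.
Qed.

(** The eigenvalue of the Eisenstein series. At oo, each of the l matrices [Mup] contributes l^g and
    [Mdiag] contributes 1. At 0, [Mup l 0] contributes 1, while the other l - 1 and [Mdiag]
    contribute l^g. *)
Lemma boundary_T l (Q : {poly int}) : prime l ->
  symT l g (boundary C g) cusp_0 cusp_oo Q =
  (1 + l%:R ^+ g.+1) * boundary C g cusp_0 cusp_oo Q.
Proof.
move=> l_pr; have l0 : 0 < l%:Z by have := prime_gt0 l_pr; lia.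
have ev1 (t : int) : hev g Q t 0 = t ^+ g * Q`_g.
  by rewrite -hev_coef1 -hev_scale mulr1 mulr0.
have ev2 (t : int) : hev g Q 0 t = t ^+ g * Q`_0.
  by rewrite -(hev_coef0 g) -hev_scale mulr1 mulr0.
have eoo (b : int) : vact (Mup l b) cusp_oo = (1, 0).
  by rewrite /vact /=; congr pair; ring.
have e0 (b : int) : vact (Mup l b) cusp_0 = (b, l%:Z).
  by rewrite /vact /=; congr pair; ring.
rewrite boundary_0_oo /symT /heckeT (bigD1 (0 : 'F_l)) //=.
rewrite (eq_bigr (fun=> ((l%:Z ^+ g) * (Q`_g - Q`_0))%:~R)) => [|b b0]; last first.
  rewrite /boundary eoo e0 primv_axis1 // (primv_Mup l_pr b0) !hev_hact /=.
  rewrite !(mul0r, mulr0, mulr1, mul1r, oppr0, addr0, add0r).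
  have -> : l%:Z * (b : nat)%:Z + - (b : nat)%:Z * l%:Z = 0 by ring.
  by rewrite ev1 ev2 mulrBr.
have -> : vact (Mdiag l) cusp_oo = (l%:Z, 0).
  by rewrite /vact /=; congr pair; ring.
have -> : vact (Mdiag l) cusp_0 = (0, 1).
  by rewrite /vact /=; congr pair; ring.
rewrite eoo e0 /boundary !primv_axis1 // !primv_axis2 // !hev_hact /=.
rewrite !(mul0r, mulr0, mulr1, mul1r, oppr0, addr0, add0r).
rewrite !ev1 !ev2 sumr_const cardC1 card_Fp // expr1n !mul1r.
rewrite -[_ *+ l.-1]mulr_natl !(rmorphB, rmorphM, rmorphXn, rmorphD) /= -!pmulrn exprS.
set t := l%:R ^+ g; have -> : l%:R = l.-1%:R + 1 :> C by rewrite natr1 prednK ?prime_gt0.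
ring.
Qed.

Definition period j : C := Phi cusp_0 cusp_oo 'X^j.

Definition period_span (c : C) :=
  exists n : nat -> int, c = \sum_(i < g.-1) (n i)%:~R * period i.+1.

Lemma period_span_subgrp : subgrp period_span.
Proof.
split; first by exists (fun=> 0); rewrite big1 // => i _; rewrite mul0r.
move=> _ _ [m ->] [n ->]; exists (fun i => m i - n i).
by rewrite -sumrB; apply: eq_bigr => i _; rewrite rmorphB mulrBl.
Qed.

Lemma period_span_ind (K : C -> Prop) : subgrp K ->
  (forall j, (0 < j < g)%N -> K (period j)) -> forall c, period_span c -> K c.
Proof.
move=> hK h c [n ->]; apply: (subgrp_sum hK) => i _.
by apply: subgrp_intl => //; apply: h; have := ltn_ord i; lia.
Qed.

(* Subtracting a boundary symbol removes the two extreme periods. *)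
Definition reduced (x y : vec) (Q : {poly int}) : C :=
  Phi x y Q - period g * boundary C g x y Q.

Lemma reduced_symbol : symbol g reduced.
Proof. by apply: symbolD_comb => //; exact: boundary_symbol. Qed.

(** S reverses the path from 0 to oo and sends X^g to (-1)^g = 1. *)
Lemma period0 : period 0 = - period g.
Proof.
have [_ ad sc ev] := hPhi.
have := ev Smat cusp_0 'X^g cusp_oo erefl nz0 nzoo.
rewrite size_polyXn leqnn => /(_ isT).
have -> : vact Smat cusp_0 = vscale (-1) cusp_oo by [].
have -> : vact Smat cusp_oo = cusp_0 by [].
rewrite (symbol_scalel _ hPhi) // (symbol_anti _ hPhi) // => e.
rewrite /period e; congr (Phi _ _ _).
rewrite hactE big_ord_recr /= big1 => [|j _]; last first.
  by rewrite coefXn ltn_eqF ?scale0r.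
rewrite coefXn eqxx scale1r subnn expr0 mulr1 add0r scale0r add0r polyCN.
by rewrite -signr_odd (negPf g_even).
Qed.

Lemma reduced_0_oo (Q : {poly int}) : (size Q <= g.+1)%N ->
  reduced cusp_0 cusp_oo Q = \sum_(i < g.-1) (Q`_i.+1)%:~R * period i.+1.
Proof.
move=> sQ; rewrite /reduced boundary_0_oo {1}(poly_widen sQ) (symbol_sum _ _ _ _ _ hPhi).
under eq_bigr => j _ do rewrite (symbolZ _ _ _ _ hPhi).
have [n en] : exists n, g = n.+1 by exists g.-1; rewrite prednK.
move: (period0); rewrite /period en => h0; rewrite big_ord_recr big_ord_recl /= h0.
by rewrite rmorphB /=; ring.
Qed.

(** On the path from 0 to oo the value is by [reduced_0_oo] an integral combination of the inner
    periods; Manin's trick carries this to every path. *)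
Lemma reduced_span (x y : vec) (Q : {poly int}) : x != 0 -> y != 0 ->
  (size Q <= g.+1)%N -> period_span (reduced x y Q).
Proof.
have [_ ad sc ev] := reduced_symbol.
have h0 : period_span 0 by exact: subgrp0 period_span_subgrp.
apply: (symbol_mod_total period_span_subgrp) => {x y Q}.
- by move=> x y z Q x0 y0 z0; rewrite ad // subrr.
- by move=> m x Q m0 x0; rewrite sc.
- by move=> x y Q x0 y0 sQ; rewrite [X in X - _]ev // subrr.
- move=> n x y Q x0 y0 sQ; rewrite [X in X - _]ev // ?subrr //.
  by rewrite /det2 /=; ring.
by move=> Q sQ; rewrite reduced_0_oo //; exists (fun i => Q`_i.+1).
Qed.

Section OnePrime.
Variables (l : nat) (l_pr : prime l).
Let s := (a l - (1 + l%:R ^+ g.+1)) * period g.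

(** [Phi] and the boundary symbol have the distinct eigenvalues a_l and 1 + l^(g+1). Their
    combination is an eigenvector only up to the correction [s]. *)
Lemma reduced_T (x y : vec) (Q : {poly int}) : x != 0 -> y != 0 ->
  (size Q <= g.+1)%N ->
  symT l g reduced x y Q = a l * reduced x y Q + s * boundary C g x y Q.
Proof.
move: x y Q; apply: (symT_eigen l_pr reduced_symbol (boundary_symbol C g_even)).
move=> Q sQ; have -> : symT l g reduced cusp_0 cusp_oo Q =
    symT l g Phi cusp_0 cusp_oo Q - period g * symT l g (boundary C g) cusp_0 cusp_oo Q.
  rewrite /symT /heckeT mulrDr opprD addrACA mulr_sumr -sumrB.
  by congr (_ + _); apply: eq_bigr.
by rewrite Phi_T // boundary_T // /reduced /s; ring.
Qed.

Lemma symT_reduced_span (Q : {poly int}) : (size Q <= g.+1)%N ->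
  period_span (symT l g reduced cusp_0 cusp_oo Q).
Proof.
move=> sQ; apply: (subgrpD period_span_subgrp).
  apply: (subgrp_sum period_span_subgrp) => b _.
  by apply: reduced_span; rewrite ?Mup_neq0 ?size_hact.
by apply: reduced_span; rewrite ?Mdiag_neq0 ?size_hact.
Qed.

Lemma reduced_period j : (0 < j < g)%N -> reduced cusp_0 cusp_oo 'X^j = period j.
Proof.
move=> /andP[j0 jg]; rewrite /reduced boundary_0_oo !coefXn.
by rewrite (gtn_eqF jg) (ltn_eqF j0) subrr mulr0 subr0.
Qed.

Lemma hecke_period_span c : period_span c -> period_span (a l * c).
Proof.
apply: (@period_span_ind (fun c => period_span (a l * c))).
  split; first by rewrite mulr0; exact: subgrp0 period_span_subgrp.
  by move=> x y hx hy; rewrite mulrBr; exact: subgrpB period_span_subgrp _ _ _ _.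
move=> j hj; have /andP[j0 jg] := hj.
have sX : (size ('X^j : {poly int})%R <= g.+1)%N by rewrite size_polyXn ltnS ltnW.
have := symT_reduced_span sX; rewrite reduced_T // reduced_period //.
by rewrite boundary_0_oo !coefXn (gtn_eqF jg) (ltn_eqF j0) subrr mulr0 addr0.
Qed.

(** On X^g along the path from 0 to oo, [reduced] is 0 and the boundary symbol is 1. There
    [reduced_T] exhibits [s] as a value of T_l [reduced], which is integral. *)
Lemma hecke_shift_span : period_span s.
Proof.
have sX : (size ('X^g : {poly int})%R <= g.+1)%N by rewrite size_polyXn.
have := symT_reduced_span sX; rewrite reduced_T //.
have -> : reduced cusp_0 cusp_oo 'X^g = 0.
  rewrite reduced_0_oo // big1 // => i _; rewrite coefXn ltn_eqF ?mul0r //.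
  by have := ltn_ord i; lia.
by rewrite boundary_0_oo !coefXn eqxx (ltn_eqF g_gt0) subr0 mulr1 mulr0 add0r.
Qed.

Lemma hecke_square_span h c : good_weight l h -> g = h %[mod l.-1] ->
  period_span c -> multiples l period_span (a l * a l * c).
Proof.
move=> hg gh; apply: (@period_span_ind (fun c => multiples l period_span (a l * a l * c))).
  have hm := multiples_subgrp l period_span_subgrp.
  split; first by rewrite mulr0; exact: subgrp0 hm.
  by move=> x y hx hy; rewrite mulrBr; exact: subgrpB hm _ _ _ _.
move=> j hj; rewrite -reduced_period //.
apply: (hecke_square_mod l_pr g_gt0 g_even hg gh reduced_symbol period_span_subgrp
  reduced_span reduced_T hecke_period_span hecke_shift_span hj).
Qed.
End OnePrime.
End EigenSymbol.

(** * Stable lattices and number fields *)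

Section StableLattice.
Variables (C : numFieldType) (n : nat) (r : nat -> C).

Definition int_span (c : C) :=
  exists m : nat -> int, c = \sum_(i < n) (m i)%:~R * r i.

(** The multiplier ring of the lattice spanned by the r_i, which may be linearly dependent. *)
Definition stabilizer (c : C) := forall x, int_span x -> int_span (c * x).

Hypothesis r_neq0 : exists2 i, (i < n)%N & r i != 0.

Lemma int_span_gen i : (i < n)%N -> int_span (r i).
Proof.
move=> hi; exists (fun j => (j == i)%:R); rewrite (bigD1 (Ordinal hi)) //= eqxx mul1r.
rewrite big1 ?addr0 // => j; rewrite -val_eqE /= => /negPf ->; by rewrite mul0r.
Qed.

Lemma int_span_subgrp : subgrp int_span.
Proof.
split; first by exists (fun=> 0); rewrite big1 // => i _; rewrite mul0r.
move=> _ _ [m ->] [m' ->]; exists (fun i => m i - m' i).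
by rewrite -sumrB; apply: eq_bigr => i _; rewrite rmorphB mulrBl.
Qed.

Lemma stabilizer1 : stabilizer 1. Proof. by move=> x; rewrite mul1r. Qed.
Lemma stabilizerB c d : stabilizer c -> stabilizer d -> stabilizer (c - d).
Proof.
move=> hc hd x hx; rewrite mulrBl.
by apply: (subgrpB int_span_subgrp); [exact: hc|exact: hd].
Qed.
Lemma stabilizerM c d : stabilizer c -> stabilizer d -> stabilizer (c * d).
Proof. by move=> hc hd x hx; rewrite -mulrA; apply/hc/hd. Qed.
Lemma stabilizer0 : stabilizer 0.
Proof. by rewrite -(subrr 1); apply: stabilizerB; exact: stabilizer1. Qed.
Lemma stabilizerN c : stabilizer c -> stabilizer (- c).
Proof. by move=> h; rewrite -sub0r; apply: stabilizerB => //; exact: stabilizer0. Qed.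
Lemma stabilizerD c d : stabilizer c -> stabilizer d -> stabilizer (c + d).
Proof. by move=> hc hd; rewrite -[d]opprK; apply/stabilizerB/stabilizerN. Qed.
Lemma stabilizerMn c m : stabilizer c -> stabilizer (c *+ m).
Proof.
move=> h; elim: m => [|m IH]; first exact: stabilizer0.
by rewrite mulrS; exact: stabilizerD.
Qed.
Lemma stabilizer_nat m : stabilizer m%:R.
Proof. exact/stabilizerMn/stabilizer1. Qed.

(** The generators form a nonzero eigenvector, with eigenvalue c, of an integral matrix. Its size is
    n for every c, which bounds all degrees at once. *)
Lemma stabilizer_char_poly c : stabilizer c ->
  exists p : {poly int}, [/\ p \is monic, size p = n.+1 & root (map_poly intr p) c].
Proof.
move=> hc; have /choice[m hm] (i : 'I_n) : exists m : nat -> int,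
    c * r i = \sum_(j < n) (m j)%:~R * r j.
  by apply: hc; exact: int_span_gen.
pose A : 'M[int]_n := \matrix_(j, i) m i j.
exists (char_poly A); split; [exact: char_poly_monic|exact: size_char_poly|].
rewrite map_char_poly -eigenvalue_root_char; apply/eigenvalueP.
exists (\row_i r i).
  apply/rowP => i; rewrite !mxE hm; apply: eq_bigr => j _.
  by rewrite !mxE mulrC.
have [i hi ri] := r_neq0; apply: contra ri => /eqP /rowP /(_ (Ordinal hi)).
by rewrite !mxE => ->.
Qed.

Lemma stabilizer_integral c : stabilizer c -> integralOver (intr : int -> C) c.
Proof. by move=> /stabilizer_char_poly[p [h1 _ h2]]; exists p. Qed.

Definition min_rat_poly (c : C) (p : {poly rat}) :=
  [/\ p != 0, root (map_poly ratr p) c &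
      forall q : {poly rat}, root (map_poly ratr q) c -> q != 0 -> (size p <= size q)%N].

Lemma min_rat_poly_exists c : stabilizer c ->
  exists2 p, min_rat_poly c p & (size p <= n.+1)%N.
Proof.
move=> /stabilizer_char_poly[p [mp sp rp]].
pose P k := `[< exists q : {poly rat}, [/\ q != 0, root (map_poly ratr q) c & size q = k] >].
have P0 : P n.+1.
  apply/asboolP; exists (map_poly intr p); split.
  - by rewrite -size_poly_gt0 size_map_inj_poly ?sp //; exact: intr_inj.
  - rewrite -map_poly_comp; congr (root _ c): rp; apply: eq_map_poly => z /=.
    by rewrite ratr_int.
  - by rewrite size_map_inj_poly //; exact: intr_inj.
have [k /asboolP[q [q0 rq sq]] kmin] := ex_minnP (ex_intro (fun k => is_true (P k)) _ P0).
exists q; last by rewrite sq; exact: kmin.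
split=> // q' rq' q'0; rewrite sq; apply: kmin; apply/asboolP.
by exists q'.
Qed.

(** Degrees are bounded, so x may be taken of maximal degree. Given y, the primitive element theorem
    yields z = m y - x with x and y in Q(z). This z is again a multiplier, so its degree is at most
    that of x; hence Q(z) = Q(x), which contains y. *)
Lemma primitive_element : exists2 x, stabilizer x &
  forall y, stabilizer y -> exists q : {poly rat}, y = (map_poly ratr q).[x].
Proof.
pose P k := `[< exists x, stabilizer x /\ exists2 p, min_rat_poly x p & size p = k >].
have P0 : exists k, P k.
  have [p hp _] := min_rat_poly_exists stabilizer1.
  by exists (size p); apply/asboolP; exists 1; split; [exact: stabilizer1|exists p].
have bnd k : P k -> (k <= n.+1)%N.
  move=> /asboolP[x [sx [p hp <-]]].
  have [p' [p'0 rp' _] sp'] := min_rat_poly_exists sx.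
  by case: hp => _ _ /(_ p' rp' p'0) /leq_trans; apply.
have [d /asboolP[x [sx [px hpx spx]]] dmax] := ex_maxnP P0 bnd.
exists x => // y sy; have [px0 rpx minx] := hpx.
have [py [py0 rpy _] _] := min_rat_poly_exists sy.
have [m] := pchar0_PET px0 rpx py0 rpy (pchar_num _).
set z := y *+ m - x => -[[qx ex] [qy ey]].
have sz : stabilizer z by apply: stabilizerB => //; exact: stabilizerMn.
have [q hq _] := min_rat_poly_exists sz; have [q0 rq minq] := hq.
have sqd : (size q <= d)%N by apply: dmax; apply/asboolP; exists z; split => //; exists q.
have irr_q : irreducible_poly q by apply/(subfx_irreducibleP rq q0).
pose Lz := SubFieldExtType rq irr_q.
pose inj : {rmorphism Lz -> C} := @subfx_inj _ _ (ratr : {rmorphism rat -> C}) z q.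
have injE (s : {poly rat}) (u : Lz) : inj (map_poly (in_alg Lz) s).[u] = (map_poly ratr s).[inj u].
  rewrite -horner_map -map_poly_comp; congr (_.[_]); apply: eq_map_poly => t /=.
  exact: (fmorph_eq_rat (inj \o in_alg Lz)%FUN t).
have inR (s : {poly rat}) : exists u : Lz, inj u = (map_poly ratr s).[z].
  exists (map_poly (in_alg Lz) s).[subfx_root (ratr : {rmorphism rat -> C}) z q].
  by rewrite injE; congr (_.[_]); exact: subfx_inj_root.
have [u eu] := inR qx; rewrite ex in eu.
(* The minimal polynomial of u, the preimage of x, has size at least d because u is sent to x, while
   Q(z) has dimension at most d - 1. So u generates Q(z). *)
have ufull : (<<1; u>> = fullv)%VS.
  apply/eqP; rewrite eqEdim subvf /= dim_Fadjoin dimv1 muln1 dimvf.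
  have dimL : dim Lz = (size q).-1 by [].
  rewrite dimL -ltnS -size_minPoly prednK ?size_poly_gt0 //.
  apply: leq_trans sqd _; rewrite -spx.
  have /polyOver1P[w ew] := minPolyOver 1 u.
  have sw : size (minPoly 1 u) = size w by rewrite ew size_map_poly.
  rewrite sw; apply: minx.
    by rewrite -eu /root -injE -ew minPolyxx rmorph0.
  by rewrite -size_poly_gt0 -sw size_minPoly.
have [w ew] : exists w : Lz, inj w = y by have [w ew] := inR qy; exists w; rewrite ew ey.
have : w \in <<1; u>>%VS by rewrite ufull memvf.
by move=> /Fadjoin1_polyP[s es]; exists s; rewrite -ew es injE eu.
Qed.

Lemma stabilizer_number_field : exists (L : fieldExtType rat) (iota : {rmorphism L -> C}),
  forall y, stabilizer y -> exists u, iota u = y.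
Proof.
have [x sx gen] := primitive_element.
have [q [q0 rq minq] _] := min_rat_poly_exists sx.
have irr_q : irreducible_poly q by apply/(subfx_irreducibleP rq q0).
pose Lx := SubFieldExtType rq irr_q.
pose inj : {rmorphism Lx -> C} := @subfx_inj _ _ (ratr : {rmorphism rat -> C}) x q.
exists Lx, inj => y /gen[s ->].
exists (map_poly (in_alg Lx) s).[subfx_root (ratr : {rmorphism rat -> C}) x q].
rewrite -horner_map -map_poly_comp /=.
rewrite (_ : inj (subfx_root _ x q) = x); last exact: subfx_inj_root.
by congr (_.[_]); apply: eq_map_poly => t; exact: (fmorph_eq_rat (inj \o in_alg Lx)%FUN t).
Qed.
End StableLattice.

(** * Prime ideals above p *)

Section PrimeIdeal.
Variables (R : comNzRingType) (x : R).
Hypothesis x_nonunit : forall y, y * x <> 1.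

(** The last clause says that a nonempty member contains [x]. In this form the empty set qualifies,
    as it must: it is the union of the empty chain in Zorn's lemma. *)
Definition ideal_avoiding_1 (I : set R) :=
  [/\ forall a u v, I u -> I v -> I (a * u + v), ~ I 1 & forall u, I u -> I x].

Lemma max_ideal_avoiding_1 : exists I : set R, [/\ ideal_avoiding_1 I, I x &
  forall J : set R, ideal_avoiding_1 J -> I `<=` J -> J `<=` I].
Proof.
have [F FP totF|I [[Il I1 Ix] Imax]] := @Zorn_bigcup R ideal_avoiding_1.
  split.
  - move=> a u v [X FX Xu] [Y FY Yv].
    have [XY|YX] := totF _ _ FX FY.
      by exists Y => //; have [h _ _] := FP _ FY; apply: h => //; exact: XY.
    by exists X => //; have [h _ _] := FP _ FX; apply: h => //; exact: YX.
  - by move=> [X FX X1]; have [_ /(_ X1)] := FP _ FX.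
  - by move=> u [X FX Xu]; exists X => //; have [_ _ h] := FP _ FX; exact: h Xu.
have max J : ideal_avoiding_1 J -> I `<=` J -> J `<=` I.
  by move=> hJ IJ; apply: contrapT => nJI; exact: (Imax J (conj IJ nJI)).
(* The ideal generated by x is a member, so a maximal member is not empty. *)
pose Jx : set R := [set y | exists a, y = a * x].
have hJx : ideal_avoiding_1 Jx.
  split.
  - by move=> a _ _ [b ->] [c ->]; exists (a * b + c); rewrite mulrDl mulrA.
  - by move=> [a /esym]; exact: x_nonunit.
  - by move=> _ _; exists 1; rewrite mul1r.
exists I; split => //; apply: contrapT => nIx.
have I0 u : ~ I u by move=> /Ix.
by apply: nIx; apply: (max _ hJx) => [u /I0//|]; exists 1; rewrite mul1r.
Qed.

(** A maximal ideal is prime: for u and v outside, 1 = (i + a u)(j + b v) with i and j inside, so u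
    v inside would force 1 inside. *)
Lemma prime_ideal_over_nonunit : exists P : prime_idealr R, x \in P.
Proof.
have [I [[Il I1 _] Ix Imax]] := max_ideal_avoiding_1.
have I0 : I 0 by have := Il (-1) x x Ix Ix; rewrite mulN1r addNr.
have IM a u : I u -> I (a * u) by move=> Iu; have := Il a u 0 Iu I0; rewrite addr0.
have ID u v : I u -> I v -> I (u + v) by move=> Iu Iv; have := Il 1 u v Iu Iv; rewrite mul1r.
pose P : {pred R} := fun u => `[< I u >].
have PE u : (u \in P) = `[< I u >] by [].
have idP : idealr_closed P.
  split; rewrite ?PE; first exact/asboolP.
    exact/asboolPn.
  by move=> a u v; rewrite !PE => /asboolP hu /asboolP hv; apply/asboolP; exact: Il.
have comax u : ~ I u -> exists a i, I i /\ i + a * u = 1.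
  move=> nIu; apply: contrapT => h.
  pose J : set R := [set y | exists a i, I i /\ y = i + a * u].
  apply: nIu; apply: (Imax J).
  - split.
    + move=> c _ _ [a [i [Ii ->]]] [b [j [Ij ->]]]; exists (c * a + b), (c * i + j).
      by split; [exact: Il|rewrite mulrDl !mulrDr !mulrA addrACA].
    + by move=> [a [i [Ii e]]]; apply: h; exists a, i.
    + by move=> _ _; exists 0, x; rewrite mul0r addr0.
  - by move=> i Ii; exists 0, i; rewrite mul0r addr0.
  - by exists 1, 0; rewrite mul1r add0r.
have prP : prime_idealr_closed P.
  move=> u v; rewrite !PE => /asboolP Iuv; apply/orP.
  have [Iu|nIu] := pselect (I u); first by left; exact/asboolP.
  have [Iv|nIv] := pselect (I v); first by right; exact/asboolP.
  exfalso; have [a [i [Ii ei]]] := comax _ nIu; have [b [j [Ij ej]]] := comax _ nIv.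
  apply: I1; rewrite -(mulr1 1) -{1}ei -ej.
  have -> : (i + a * u) * (j + b * v) = (j + b * v) * i + (a * u * j + a * b * (u * v)) by ring.
  by apply: (ID _ _ (IM _ _ Ii)); apply: ID; exact: IM.
pose m1 := isIdealr.Build R P idP.
pose m2 := isPrimeIdealrClosed.Build R P prP.
pose PP : prime_idealr R := HB.pack P m1 m2.
by exists PP; apply/asboolP.
Qed.
End PrimeIdeal.

Section PrimesOfIntegers.
Variables (L : fieldExtType rat) (p : nat) (p_pr : prime p).

(** An integral equation of degree n for 1/p, multiplied by p^n, would exhibit 1 as a multiple of
    p. *)
Lemma integral_inv_nat (y : L) : integralOver (intr : int -> L) y -> y * p%:R <> 1.
Proof.
move=> [q mq rq] e; have qn0 : (0 < size q)%N by rewrite size_poly_gt0 monic_neq0.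
have np1 : ~~ (p%:Z %| (1%R : int))%Z.
  by rewrite dvdz1 /=; apply: contraL (prime_gt1 p_pr) => /eqP ->.
apply: (negP np1) => {np1}.
have intrL : injective (intr : int -> L).
  move=> a b; rewrite -(rmorph_int (in_alg L)) -[RHS](rmorph_int (in_alg L)).
  by move=> /fmorph_inj/intr_inj.
pose n := (size q).-1.
have e2 : \sum_(i < n.+1) q`_i * p%:Z ^+ (n - i) = 0.
  apply: (intrL); rewrite rmorph_sum rmorph0 /=.
  have sq : size (map_poly (intr : int -> L) q) = size q.
    apply: size_map_inj_poly; [exact: intrL|by []].
  move/rootP: rq; rewrite horner_coef sq.
  rewrite -[size q]prednK // -/n => /(congr1 (fun t => t * p%:R ^+ n)).
  rewrite mul0r mulr_suml => {2}<-; apply: eq_bigr => i _.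
  rewrite coef_map /= rmorphM rmorphXn /= -mulrA; congr (_ * _).
  move: (nat_of_ord i) (ltn_ord i) => j; rewrite ltnS => jn.
  by rewrite -[in p%:R ^+ n](subnKC jn) exprD mulrA -exprMn e expr1n mul1r -pmulrn.
move: e2; rewrite big_ord_recr /= subnn expr0 mulr1.
have qn : q`_n = 1 by exact/monicP.
rewrite qn addrC => /eqP; rewrite addr_eq0 => /eqP ->; rewrite rpredN.
apply: rpred_sum => i _; apply: dvdz_mull; have hi := ltn_ord i.
by rewrite -(prednK (_ : 0 < n - i)%N) ?subn_gt0 // exprS dvdz_mulr.
Qed.

(** A prime ideal containing p cannot contain an integer m prime to p, since Bezout would put 1 in
    it. *)
Lemma ringOfIntegers_prime_above : exists P : prime_idealr (ringOfIntegers L), lies_above P p.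
Proof.
have [y|P hP] := @prime_ideal_over_nonunit (ringOfIntegers L) p%:R.
  move=> /(congr1 val); rewrite rmorphM rmorph1 rmorph_nat.
  by apply: integral_inv_nat; case: y => y /= /asboolP.
exists P => m; apply/idP/idP => [mP|/dvdzP[e ->]]; last first.
  by rewrite rmorphM /= -pmulrn; exact: idealMr.
apply: contraT => npm.
have : coprimez p%:Z m.
  rewrite /coprimez /gcdz eqz_nat /= -/(coprime _ _) prime_coprime //.
have [u [v e]] := Bezoutz p%:Z m; rewrite /coprimez => /eqP cop; rewrite cop in e.
have := idealr1 P; rewrite (_ : 1 = u%:~R * p%:R + v%:~R * m%:~R).
  by rewrite rpredD // idealMr.
by rewrite pmulrn -!intrM -intrD e.
Qed.
End PrimesOfIntegers.

(** * Fourier series on the upper half-plane *)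

Section ComplexModulus.
Variable R : realType.
Local Notation C := R[i].
Implicit Types (z w : C) (x y : R).

(** The norm of [R[i]] takes its values in [R[i]]; its real part lives in [R], where estimates can
    use the order and the real exponential. *)
Definition cabs z : R := complex.Re `|z|.

Lemma cabsE z : `|z| = (cabs z)%:C.
Proof. by rewrite /cabs RRe_real // normr_real. Qed.

Lemma cabs_ge0 z : 0 <= cabs z. Proof. by rewrite -ler0c -cabsE. Qed.
Lemma cabsM z w : cabs (z * w) = cabs z * cabs w.
Proof. by apply: complexI; rewrite rmorphM /= -!cabsE normrM. Qed.
Lemma cabsX z n : cabs (z ^+ n) = cabs z ^+ n.
Proof. by apply: complexI; rewrite rmorphXn /= -!cabsE normrX. Qed.
Lemma cabsV z : cabs z^-1 = (cabs z)^-1.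
Proof. by apply: complexI; rewrite fmorphV /= -!cabsE normfV. Qed.
Lemma cabsD z w : cabs (z + w) <= cabs z + cabs w.
Proof. by rewrite -lecR rmorphD /= -!cabsE ler_normD. Qed.
Lemma cabsN z : cabs (- z) = cabs z.
Proof. by rewrite /cabs normrN. Qed.
Lemma cabsB z w : cabs (z - w) <= cabs z + cabs w.
Proof. by rewrite -(cabsN w) cabsD. Qed.
Lemma cabs0 : cabs 0 = 0. Proof. by rewrite /cabs normr0. Qed.
Lemma cabs1 : cabs 1 = 1. Proof. by rewrite /cabs normr1. Qed.
Lemma cabs_eq0 z : (cabs z == 0) = (z == 0).
Proof.
rewrite -(normr_eq0 z) cabsE; apply/eqP/eqP => [->|] //.
by move/complexI.
Qed.
Lemma cabs_gt0 z : (0 < cabs z) = (z != 0).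
Proof. by rewrite lt_def cabs_ge0 andbT cabs_eq0. Qed.
Lemma cabs_nat n : cabs n%:R = n%:R.
Proof. by apply: complexI; rewrite -cabsE normr_nat rmorph_nat. Qed.
Lemma cabs_real x : cabs x%:C = `|x|.
Proof.
by apply: complexI; rewrite -cabsE normc_def /= expr0n addr0 sqrtr_sqr.
Qed.
Lemma cabs_sum (I : Type) (r : seq I) (P : pred I) (F : I -> C) :
  cabs (\sum_(i <- r | P i) F i) <= \sum_(i <- r | P i) cabs (F i).
Proof.
elim/big_rec2: _ => [|i u v _ h]; first by rewrite cabs0.
by apply: le_trans (cabsD _ _) _; rewrite lerD2l.
Qed.
Lemma cabs_ge_Re z : `|complex.Re z| <= cabs z.
Proof. by rewrite -lecR -cabsE normc_ge_Re. Qed.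
Lemma cabs_sqr z : cabs z ^+ 2 = complex.Re z ^+ 2 + complex.Im z ^+ 2.
Proof. by apply: complexI; rewrite rmorphXn /= -cabsE add_Re2_Im2. Qed.
Lemma cabs_ge_Im z : `|complex.Im z| <= cabs z.
Proof.
rewrite -[_ <= _](@ler_pXn2r _ 2) ?nnegrE ?cabs_ge0 // cabs_sqr real_normK ?num_real //.
by rewrite lerDr sqr_ge0.
Qed.
Lemma cabs_le_ReIm z : cabs z <= `|complex.Re z| + `|complex.Im z|.
Proof.
case: z => a b /=; have -> : a +i* b = a%:C + 'i%C * b%:C by rewrite [LHS]complexE.
apply: le_trans (cabsD _ _) _; rewrite cabsM !cabs_real lerD2l.
rewrite (_ : cabs 'i%C = 1) ?mul1r //.
have := cabs_sqr 'i%C; rewrite /= expr0n expr1n add0r => /eqP.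
by rewrite sqrf_eq1 => /orP[/eqP //|/eqP e]; have := cabs_ge0 'i%C; rewrite e ler0N1.
Qed.
Lemma cabs_small_eq0 z : (forall e, 0 < e -> cabs z < e) -> z = 0.
Proof.
move=> h; apply/eqP; rewrite -cabs_eq0 eq_le cabs_ge0 andbT leNgt.
by apply/negP => /h; rewrite ltxx.
Qed.

Definition csum_to (u : nat -> C) (s : C) := forall e : R, 0 < e ->
  exists N, forall n, (N <= n)%N -> cabs (\sum_(i < n) u i - s) < e.

Lemma csum_to_unique u s t : csum_to u s -> csum_to u t -> s = t.
Proof.
move=> hs ht; apply/eqP; rewrite -subr_eq0; apply/eqP; apply: cabs_small_eq0 => e e0.
have e2 : 0 < e / 2 by rewrite divr_gt0.
have [N hN] := hs _ e2; have [M hM] := ht _ e2.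
have := hN _ (leq_maxl N M); have := hM _ (leq_maxr N M).
set S := \sum_(i < _) _ => h1 h2.
have -> : s - t = (S - t) - (S - s) by ring.
by apply: le_lt_trans (cabsB _ _) _; rewrite (splitr e) ltrD.
Qed.

Lemma csum_toD u v s t : csum_to u s -> csum_to v t ->
  csum_to (fun n => u n + v n) (s + t).
Proof.
move=> hs ht e e0; have e2 : 0 < e / 2 by rewrite divr_gt0.
have [N hN] := hs _ e2; have [M hM] := ht _ e2.
exists (maxn N M) => n; rewrite geq_max => /andP[/hN h1 /hM h2].
rewrite big_split /= opprD addrACA; apply: le_lt_trans (cabsD _ _) _.
by rewrite (splitr e) ltrD.
Qed.

Lemma csum_toZ c u s : csum_to u s -> csum_to (fun n => c * u n) (c * s).
Proof.
move=> hs e e0; have [->|c0] := eqVneq c 0.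
  exists 0%N => n _; rewrite mul0r subr0 big1 ?cabs0 // => i _; exact: mul0r.
have c1 : 0 < cabs c by rewrite cabs_gt0.
have [N hN] := hs (e / cabs c) (divr_gt0 e0 c1).
exists N => n /hN; rewrite -mulr_sumr -mulrBr cabsM ltr_pdivlMr // mulrC //.
Qed.

Lemma csum_to0 : csum_to (fun=> 0) 0.
Proof. by move=> e e0; exists 0%N => n _; rewrite big1 // subrr cabs0. Qed.

Lemma csum_to_ext u v s : u =1 v -> csum_to u s -> csum_to v s.
Proof. by move=> /funext ->. Qed.

Lemma csum_to_sum (I : Type) (r : seq I) (u : I -> nat -> C) (s : I -> C) :
  (forall i, csum_to (u i) (s i)) ->
  csum_to (fun n => \sum_(i <- r) u i n) (\sum_(i <- r) s i).
Proof.
move=> h; elim: r => [|i r IH].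
  rewrite big_nil; apply: csum_to_ext csum_to0 => n; by rewrite big_nil.
rewrite big_cons; apply: csum_to_ext (csum_toD (h i) IH) => n.
by rewrite big_cons.
Qed.

Lemma csum_to_subseq (u v : nat -> C) s (p : nat) : (0 < p)%N -> csum_to u s ->
  (forall n, \sum_(i < n) v i = \sum_(i < p * n) u i) -> csum_to v s.
Proof.
move=> p0 hs h e /hs[N hN]; exists N => n Nn; rewrite h; apply: hN.
by rewrite (leq_trans Nn) // leq_pmull.
Qed.

Lemma csum_to_le u s M : csum_to u s ->
  (forall n, cabs (\sum_(i < n) u i) <= M) -> cabs s <= M.
Proof.
move=> hs h; apply/ler_addgt0Pr => e /hs[N /(_ N (leqnn N)) hN].
rewrite -[s](subKr (\sum_(i < N) u i)); apply: le_trans (cabsB _ _) _.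
by rewrite lerD // ltW.
Qed.

Lemma geo_sum_le (x : R) n : 0 <= x < 1 -> \sum_(i < n) x ^+ i <= (1 - x)^-1.
Proof.
move=> /andP[x0 x1]; have h : 0 < 1 - x by rewrite subr_gt0.
rewrite -(ler_pM2l h) mulfV ?gt_eqF //.
have -> : (1 - x) * (\sum_(i < n) x ^+ i) = 1 - x ^+ n.
  by rewrite -[1 - x]opprB mulNr -subrX1 opprB.
by rewrite gerBl exprn_ge0.
Qed.

Lemma real_series_cvg (v : nat -> R) (B x : R) : 0 <= x < 1 ->
  (forall n, `|v n| <= B * x ^+ n) -> exists l, forall e, 0 < e ->
  exists N, forall n, (N <= n)%N -> `|\sum_(i < n) v i - l| < e.
Proof.
move=> /andP[x0 x1] hv; have B0 : 0 <= B.
  by have := le_trans (normr_ge0 _) (hv 0%N); rewrite expr0 mulr1.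
have cv : cvgn (series v).
  apply: normed_cvg; apply: (@series_le_cvg _ _ (geometric B x)).
  - by move=> n; exact: normr_ge0.
  - by move=> n; rewrite mulr_ge0 // exprn_ge0.
  - exact: hv.
  - by apply: is_cvg_geometric_series; rewrite ger0_norm.
exists (limn (series v)) => e e0.
move/cvgrPdist_lt: cv => /(_ e e0)[N _ hN]; exists N => n Nn.
by rewrite distrC; have := hN n Nn; rewrite /series /= big_mkord.
Qed.

Lemma csum_to_exists u (B x : R) : 0 <= x < 1 ->
  (forall n, cabs (u n) <= B * x ^+ n) -> exists s, csum_to u s.
Proof.
move=> hx hu.
have [a ha] := @real_series_cvg (fun n => complex.Re (u n)) B x hx
  (fun n => le_trans (cabs_ge_Re _) (hu n)).
have [b hb] := @real_series_cvg (fun n => complex.Im (u n)) B x hx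
  (fun n => le_trans (cabs_ge_Im _) (hu n)).
have ReS n : complex.Re (\sum_(i < n) u i) = \sum_(i < n) complex.Re (u i).
  by apply: (big_morph (@complex.Re R)) => // -[? ?] [? ?].
have ImS n : complex.Im (\sum_(i < n) u i) = \sum_(i < n) complex.Im (u i).
  by apply: (big_morph (@complex.Im R)) => // -[? ?] [? ?].
exists (a +i* b) => e e0; have e2 : 0 < e / 2 by rewrite divr_gt0.
have [N hN] := ha _ e2; have [M hM] := hb _ e2.
exists (maxn N M) => n; rewrite geq_max => /andP[/hN h1 /hM h2].
apply: le_lt_trans (cabs_le_ReIm _) _; rewrite (splitr e) ltrD //.
  by move: h1; rewrite -ReS; case: (\sum_(i < n) u i).
by move: h2; rewrite -ImS; case: (\sum_(i < n) u i).
Qed.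

(* Summation in the topology of [R[i]] used by the definitions. *)
Lemma csum_to_cvg u s :
  (series (u : nat -> R[i]^o) @ \oo --> (s : R[i]^o)) -> csum_to u s.
Proof.
move=> /cvgrPdist_lt h e e0.
have e0' : 0 < e%:C by rewrite ltcR.
have [N _ hN] := h _ e0'; exists N => n Nn.
have := hN n Nn; rewrite /= /series /= big_mkord -ltcR -cabsE distrC //.
Qed.
End ComplexModulus.

(** * The complex exponential *)

Section ComplexExponential.
Variable R : realType.
Local Notation C := R[i].
Implicit Types (z w : C) (x y : R).

Definition cexp z : C := (expR (complex.Re z))%:C * (cos (complex.Im z) +i* sin (complex.Im z)).

Definition tpi : C := (2 * pi)%:C * 'i%C.

Lemma cexpD z w : cexp (z + w) = cexp z * cexp w.
Proof.
case: z => a b; case: w => c d; rewrite /cexp /= expRD cosD sinD.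
apply/eqP; rewrite eq_complex /=; apply/andP; split; apply/eqP; ring.
Qed.

Lemma cexp0 : cexp 0 = 1.
Proof. by rewrite /cexp /= expR0 cos0 sin0 mul1r. Qed.

Lemma cexpMn z n : cexp (n%:R * z) = cexp z ^+ n.
Proof.
elim: n => [|n IH]; first by rewrite mul0r cexp0 expr0.
by rewrite -natr1 mulrDl mul1r cexpD IH exprSr.
Qed.

Lemma cabs_cexp z : cabs (cexp z) = expR (complex.Re z).
Proof.
rewrite /cexp cabsM cabs_real ger0_norm ?expR_ge0 // (_ : cabs _ = 1) ?mulr1 //.
apply/eqP; rewrite -(@eqrXn2 _ 2) ?cabs_ge0 // cabs_sqr /= cos2Dsin2 expr1n //.
Qed.

Lemma Re_tpi z : complex.Re (tpi * z) = - (2 * pi * complex.Im z).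
Proof. by case: z => a b; rewrite /tpi /=; ring. Qed.
Lemma Im_tpi z : complex.Im (tpi * z) = 2 * pi * complex.Re z.
Proof. by case: z => a b; rewrite /tpi /=; ring. Qed.

Lemma qparamE z : qparam z = cexp (tpi * z).
Proof. by rewrite /qparam /cexp Re_tpi Im_tpi. Qed.

Lemma qparamD z w : qparam (z + w) = qparam z * qparam w.
Proof. by rewrite !qparamE mulrDr cexpD. Qed.

Lemma qparamMn n z : qparam (n%:R * z) = qparam z ^+ n.
Proof. by rewrite !qparamE mulrCA cexpMn. Qed.

Lemma cabs_qparam z : cabs (qparam z) = expR (- (2 * pi * complex.Im z)).
Proof. by rewrite qparamE cabs_cexp Re_tpi. Qed.

Lemma qparam1 : qparam (1 : C) = 1.
Proof.
rewrite /qparam /= mulr0 oppr0 expR0 mulr1 mulr_natl cos2pi sin2pi mul1r.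
by [].
Qed.

Lemma qparam_nat n : qparam (n%:R : C) = 1.
Proof. by rewrite -[n%:R]mulr1 qparamMn qparam1 expr1n. Qed.

Lemma qparam_int (n : int) : qparam (n%:~R : C) = 1.
Proof.
case: n => n; first by rewrite -pmulrn qparam_nat.
rewrite NegzE rmorphN /= -pmulrn.
have := qparamD (- n.+1%:R) n.+1%:R; rewrite addNr qparam_nat mulr1 => <-.
by rewrite -(qparam_nat 0).
Qed.

Lemma MVT_bound (f df : R -> R) (K b : R) : 0 <= b ->
  (forall x, is_derive x 1 f (df x)) -> (forall x, 0 <= x <= b -> `|df x| <= K) ->
  `|f b - f 0| <= K * b.
Proof.
move=> b0 df' hK.
have cf : {within `[0, b], continuous f}.
  by apply: derivable_within_continuous => x _; have [] := df' x.
have [c] := MVT_segment b0 (fun x _ => df' x) cf.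
rewrite in_itv /= => hc ->; rewrite subr0 normrM (ger0_norm b0).
by apply: ler_wpM2r => //; exact: hK.
Qed.

Lemma sin_le_norm x : 0 <= x -> `|sin x| <= x.
Proof.
move=> x0; have := @MVT_bound sin cos 1 x x0 (fun t => is_derive_sin t).
by rewrite sin0 subr0 mul1r; apply => t _; exact: cos_max.
Qed.

Lemma cos_sub1_le x : `|cos x - 1| <= x ^+ 2.
Proof.
wlog x0 : x / 0 <= x.
  move=> H; case: (lerP 0 x) => [/H//|/ltW x0].
  by rewrite -cosN -sqrrN; apply: H; rewrite oppr_ge0.
have := @MVT_bound cos (fun t => - sin t) x x x0 (fun t => is_derive_cos t).
rewrite cos0 expr2; apply => t /andP[t0 tx]; rewrite normrN.
exact: le_trans (sin_le_norm t0) tx.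
Qed.

Lemma sin_sub_le x : `|sin x - x| <= x ^+ 2.
Proof.
wlog x0 : x / 0 <= x.
  move=> H; case: (lerP 0 x) => [/H//|/ltW x0].
  have -> : sin x - x = - (sin (- x) - (- x)) by rewrite sinN; ring.
  by rewrite normrN -sqrrN; apply: H; rewrite oppr_ge0.
have d (t : R) : is_derive t 1 (fun t => sin t - t) (cos t - 1).
  by apply: is_deriveB.
have := @MVT_bound (fun t => sin t - t) (fun t => cos t - 1) x x x0 d.
rewrite sin0 subr0 subr0 expr2; apply => t /andP[t0 tx].
have := @MVT_bound cos (fun t => - sin t) 1 t t0 (fun t => is_derive_cos t).
rewrite cos0 mul1r => h; apply: le_trans (h _) tx => u _.
by rewrite normrN; exact: sin_max.
Qed.

Lemma expR_sub1_le x : `|expR x - 1| <= `|x| * expR `|x|.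
Proof.
case: (lerP 0 x) => x0.
  rewrite !ger0_norm //; last by rewrite subr_ge0 -expR0 ler_expR.
  have h := expR_ge1Dx (- x); have e0 := expR_gt0 x.
  have : 1 - expR (- x) <= x by lra.
  rewrite -(ler_pM2r e0) mulrBl mul1r -expRD addNr expR0 //.
rewrite ltr0_norm ?(ltr0_norm x0); last by rewrite subr_lt0 expR_lt1.
have h := expR_ge1Dx x; have h2 := expR_ge1Dx (- x).
have : - x * 1 <= - x * expR (- x) by rewrite ler_pM2l; lra.
lra.
Qed.

Lemma expR_sub1x_le x : `|expR x - 1 - x| <= x ^+ 2 * expR `|x|.
Proof.
have h := expR_ge1Dx x; rewrite ger0_norm; last by lra.
case: (lerP 0 x) => x0.
  rewrite (ger0_norm x0) expr2 -mulrA.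
  have h1 := expR_sub1_le x; rewrite !ger0_norm // in h1; last by lra.
  have h2 : x * (expR x - 1) <= x * (x * expR x) by rewrite ler_wpM2l.
  by apply: le_trans h2; rewrite mulrBr mulr1; lra.
rewrite (ltr0_norm x0).
have h2 := expR_ge1Dx (- x); have e0 := expR_gt0 x.
have e1 : expR x * expR (- x) = 1 by rewrite -expRD subrr expR0.
have h3 : expR x * (1 - x) <= 1 by rewrite -[leRHS]e1 ler_pM2l.
have h4 : expR x - 1 - x <= x ^+ 2 by nra.
have h5 : 1 <= expR (- x) by lra.
apply: le_trans h4 _; by rewrite -{1}[x ^+ 2]mulr1 ler_wpM2l // sqr_ge0.
Qed.

(** The constant 3 is 1 from the real part plus 2 from the imaginary part. The bound is explicit in
    w because [fourier_taylor] sums it over all terms of a series. *)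
Lemma cexp_taylor1 w : cabs (cexp w - 1 - w) <= 3 * cabs w ^+ 2 * expR (cabs w).
Proof.
have := cabs_ge_Re w; have := cabs_ge_Im w; have sq := cabs_sqr w.
case: w sq => a b /= sq hb ha; set r := cabs _ in sq hb ha *.
have e0 := expR_gt0 r.
have ea : expR a <= expR r by rewrite ler_expR (le_trans (ler_norm _)).
have ea' : expR `|a| <= expR r by rewrite ler_expR.
have r0 : 0 <= r by exact: cabs_ge0.
have a2 : 0 <= a ^+ 2 by exact: sqr_ge0. have b2 : 0 <= b ^+ 2 by exact: sqr_ge0.
apply: le_trans (cabs_le_ReIm _) _.
have hRe : `|expR a * cos b - 1 - a| <= r ^+ 2 * expR r.
  have -> : expR a * cos b - 1 - a = (expR a - 1 - a) + expR a * (cos b - 1) by ring.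
  apply: le_trans (ler_normD _ _) _; rewrite sq mulrDl lerD //.
    by apply: le_trans (expR_sub1x_le _) _; rewrite ler_wpM2l.
  rewrite normrM (ger0_norm (expR_ge0 _)) mulrC.
  by apply: ler_pM; rewrite ?expR_ge0 ?normr_ge0 ?cos_sub1_le.
have hIm : `|expR a * sin b - b| <= 2 * r ^+ 2 * expR r.
  have -> : expR a * sin b - b = expR a * (sin b - b) + (expR a - 1) * b by ring.
  have -> : 2 * r ^+ 2 * expR r = r ^+ 2 * expR r + r * expR r * r by ring.
  apply: le_trans (ler_normD _ _) _; rewrite lerD // normrM.
    rewrite (ger0_norm (expR_ge0 _)) mulrC; apply: ler_pM; rewrite ?expR_ge0 ?normr_ge0 //.
    by apply: le_trans (sin_sub_le _) _; lra.
  apply: ler_pM; rewrite ?normr_ge0 //; apply: le_trans (expR_sub1_le _) _.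
  by apply: ler_pM; rewrite ?expR_ge0 ?normr_ge0.
apply: le_trans (_ : r ^+ 2 * expR r + 2 * r ^+ 2 * expR r <= _); last by lra.
apply: lerD.
  by apply: le_trans hRe; rewrite le_eqVlt; apply/orP; left; apply/eqP; congr `|_|; rewrite /cexp /=; ring.
by apply: le_trans hIm; rewrite le_eqVlt; apply/orP; left; apply/eqP; congr `|_|; rewrite /cexp /=; ring.
Qed.
End ComplexExponential.

(** * Fourier series on the upper half-plane and their coefficients *)

Section FourierSeries.
Variable R : realType.
Local Notation C := R[i].
Implicit Types (z w : C) (x y : R) (b c : nat -> C).

(** Radius of convergence at least 1, stated through bounded terms. A bound at a radius r > s
    already gives geometric decay at s, as [tame_geometric] shows. *)
Definition tame b := forall r : R, 0 < r < 1 -> exists B, forall n, cabs (b n) * r ^+ n <= B.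

Definition fourier b z : C := xget 0 [set s | csum_to (fun n => b n * qparam z ^+ n) s].

Lemma cabs_qparam_lt1 z : 0 < complex.Im z -> 0 < cabs (qparam z) < 1.
Proof.
move=> hz; rewrite cabs_qparam expR_gt0 /= expR_lt1 oppr_lt0 !mulr_gt0 ?pi_gt0 //.
Qed.

Lemma tame_geometric b (s : R) : tame b -> 0 < s < 1 ->
  exists B x, 0 <= x < 1 /\ forall n, cabs (b n) * s ^+ n <= B * x ^+ n.
Proof.
move=> tb /andP[s0 s1]; pose r := (1 + s) / 2.
have r0 : 0 < r by rewrite /r; lra. have r1 : r < 1 by rewrite /r; lra.
have sr : s < r by rewrite /r; lra.
have [B hB] := tb r (introT andP (conj r0 r1)); exists B, (s / r); split.
  by rewrite divr_ge0 ?(ltW s0) ?(ltW r0) //= ltr_pdivrMr // mul1r.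
move=> n; have rn0 : 0 < r ^+ n by rewrite exprn_gt0.
rewrite expr_div_n mulrA ler_pdivlMr // mulrAC.
by apply: ler_wpM2r => //; rewrite exprn_ge0 // ltW.
Qed.

Lemma fourierP b z : tame b -> 0 < complex.Im z ->
  csum_to (fun n => b n * qparam z ^+ n) (fourier b z).
Proof.
move=> tb /cabs_qparam_lt1 hz; have [B [x [hx hB]]] := tame_geometric tb hz.
have [s hs] : exists s, csum_to (fun n => b n * qparam z ^+ n) s.
  by apply: (csum_to_exists hx (B := B)) => n; rewrite cabsM cabsX; exact: hB.
exact: (xgetPex 0 (ex_intro _ s hs)).
Qed.

Lemma fourier_unique b z s : tame b -> 0 < complex.Im z ->
  csum_to (fun n => b n * qparam z ^+ n) s -> fourier b z = s.
Proof. by move=> tb hz; apply: csum_to_unique; exact: fourierP. Qed.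

Lemma tameD b c : tame b -> tame c -> tame (fun n => b n + c n).
Proof.
move=> tb tc r hr; have [B hB] := tb r hr; have [B' hB'] := tc r hr.
have /andP[r0 _] := hr.
exists (B + B') => n; apply: le_trans (lerD (hB n) (hB' n)).
by rewrite -mulrDl ler_wpM2r ?cabsD // exprn_ge0 // ltW.
Qed.

Lemma tameZ a b : tame b -> tame (fun n => a * b n).
Proof.
move=> tb r hr; have [B hB] := tb r hr; exists (cabs a * B) => n.
by rewrite cabsM -mulrA ler_wpM2l ?cabs_ge0.
Qed.

Lemma tame_le b c : tame b -> (forall n, cabs (c n) <= cabs (b n)) -> tame c.
Proof.
move=> tb h r hr; have [B hB] := tb r hr; exists B => n; apply: le_trans (hB n).
by have /andP[r0 _] := hr; rewrite ler_wpM2r ?h // exprn_ge0 // ltW.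
Qed.

(** As x < 1, each of the n terms of the geometric sum is at least x^n, and the sum is at most 1/(1
    - x). *)
Lemma bernoulli_mul (x : R) n : 0 <= x < 1 -> n%:R * (1 - x) * x ^+ n <= 1.
Proof.
move=> /andP[x0 x1].
have h : n%:R * x ^+ n <= \sum_(i < n) x ^+ i.
  rewrite -[n in n%:R]card_ord -sumr_const mulr_suml; apply: ler_sum => i _.
  by rewrite mul1r ler_wiXn2l ?(ltW x1) // ltnW.
have d : 0 < 1 - x by lra.
have := le_trans h (geo_sum_le n (introT andP (conj x0 x1))).
by rewrite -(ler_pM2l d) mulfV ?gt_eqF // mulrA [_ * n%:R]mulrC.
Qed.

(* Multiplying the coefficients by n costs an arbitrarily small loss of radius. *)
Lemma tame_mulrn b : tame b -> tame (fun n => n%:R * b n).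
Proof.
move=> tb r hr; have [B [x [hx hB]]] := tame_geometric tb hr.
have /andP[x0 x1] := hx; have d : 0 < 1 - x by lra.
have B0 : 0 <= B.
  by have := le_trans _ (hB 0%N); rewrite !expr0 !mulr1; apply; exact: cabs_ge0.
exists (B / (1 - x)) => n; rewrite cabsM cabs_nat -mulrA.
apply: le_trans (_ : n%:R * (B * x ^+ n) <= _); first by rewrite ler_wpM2l.
rewrite ler_pdivlMr // (_ : _ * (1 - x) = B * (n%:R * (1 - x) * x ^+ n)); last by ring.
by rewrite -[leRHS]mulr1 ler_wpM2l // bernoulli_mul.
Qed.

Lemma tame_dilate b (p : nat) : (0 < p)%N -> tame b -> tame (fun n => b (p * n)%N).
Proof.
move=> p0 tb r hr; have /andP[r0 r1] := hr.
(* With s a p-th root of r, the bound at s for the index p n is a bound at r for n. *)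
pose s := r `^ (p%:R^-1).
have s0 : 0 < s by exact: powR_gt0.
have sp : s ^+ p = r.
  by rewrite -powR_mulrn ?(ltW s0) // /s -powRrM mulVf ?powRr1 ?(ltW r0) // pnatr_eq0 -lt0n.
have s1 : s < 1.
  rewrite ltNge; apply/negP => h; move: r1; rewrite -sp ltNge => /negP; apply.
  exact: exprn_ege1.
have [B hB] := tb s (introT andP (conj s0 s1)).
by exists B => n; have := hB (p * n)%N; rewrite exprM sp.
Qed.

Lemma tame_inflate b (p : nat) : (0 < p)%N -> tame b ->
  tame (fun n => if (p %| n)%N then b (n %/ p)%N else 0).
Proof.
move=> p0 tb r hr; have /andP[r0 r1] := hr; have [B hB] := tb r hr.
have B0 : 0 <= B.
  by have := le_trans _ (hB 0%N); rewrite !expr0 !mulr1; apply; exact: cabs_ge0.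
exists B => n; case: ifP => _; last by rewrite cabs0 mul0r.
apply: le_trans (hB (n %/ p)%N); rewrite ler_wpM2l ?cabs_ge0 //.
by rewrite ler_wiXn2l ?(ltW r0) ?(ltW r1) // leq_div.
Qed.

Lemma fourierD b c z : tame b -> tame c -> 0 < complex.Im z ->
  fourier (fun n => b n + c n) z = fourier b z + fourier c z.
Proof.
move=> tb tc hz; apply: fourier_unique => //; first exact: tameD.
apply: csum_to_ext (csum_toD (fourierP tb hz) (fourierP tc hz)) => n.
by rewrite mulrDl.
Qed.

Lemma fourierZ a b z : tame b -> 0 < complex.Im z ->
  fourier (fun n => a * b n) z = a * fourier b z.
Proof.
move=> tb hz; apply: fourier_unique => //; first exact: tameZ.
by apply: csum_to_ext (csum_toZ a (fourierP tb hz)) => n; rewrite mulrA.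
Qed.

Lemma fourier_qparam b z w : qparam z = qparam w -> fourier b z = fourier b w.
Proof. by rewrite /fourier => ->. Qed.

Lemma fourierDz b z (n : int) : fourier b (z + n%:~R) = fourier b z.
Proof. by apply: fourier_qparam; rewrite qparamD qparam_int mulr1. Qed.

Lemma fourier_bound b y : tame b -> 0 < y -> exists2 M, 0 <= M &
  forall z, y <= complex.Im z -> cabs (fourier b z) <= M.
Proof.
move=> tb y0; pose s := expR (- (2 * pi * y)).
have hs : 0 < s < 1 by rewrite expR_gt0 /= expR_lt1 oppr_lt0 !mulr_gt0 ?pi_gt0.
have [B [x [hx hB]]] := tame_geometric tb hs.
have B0 : 0 <= B.
  by have := le_trans _ (hB 0%N); rewrite !expr0 !mulr1; apply; exact: cabs_ge0.
have /andP[x0 x1] := hx.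
exists (B / (1 - x)); first by rewrite divr_ge0 //; lra.
move=> z hz; have hz0 : 0 < complex.Im z by exact: lt_le_trans hz.
apply: (csum_to_le (fourierP tb hz0)) => n.
apply: le_trans (cabs_sum _ _ _) _.
apply: le_trans (_ : B * \sum_(i < n) x ^+ i <= _).
  rewrite mulr_sumr; apply: ler_sum => i _; apply: le_trans (hB i).
  rewrite cabsM cabsX ler_wpM2l ?cabs_ge0 // lerXn2r ?nnegrE ?cabs_ge0 ?expR_ge0 //.
  by rewrite cabs_qparam ler_expR lerN2 ler_wpM2l // mulr_ge0 // pi_ge0.
by rewrite ler_wpM2l // geo_sum_le.
Qed.

End FourierSeries.

Section ImRe.
Variable R : realType.
Implicit Types (z : R[i]) (x : R).

Lemma natr_complex n : n%:R = (n%:R)%:C :> R[i].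
Proof. by rewrite rmorph_nat. Qed.
Lemma Im_realM x z : complex.Im (x%:C * z) = x * complex.Im z.
Proof. by case: z => a b /=; ring. Qed.
Lemma Re_realM x z : complex.Re (x%:C * z) = x * complex.Re z.
Proof. by case: z => a b /=; ring. Qed.
Lemma ImD z w : complex.Im (z + w) = complex.Im z + complex.Im w.
Proof. by case: z; case: w. Qed.
Lemma ReD z w : complex.Re (z + w) = complex.Re z + complex.Re w.
Proof. by case: z; case: w. Qed.
Lemma ImDn z n : complex.Im (z + n%:R) = complex.Im z.
Proof. by rewrite natr_complex ImD /= addr0. Qed.
Lemma ImMn n z : complex.Im (n%:R * z) = n%:R * complex.Im z.
Proof. by rewrite natr_complex Im_realM. Qed.
Lemma Im_divn z n : complex.Im (z / n%:R) = complex.Im z / n%:R.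
Proof. by rewrite natr_complex -fmorphV /= mulrC Im_realM mulrC. Qed.
End ImRe.

(** * Averages over p-th roots of unity *)

Section RootsOfUnity.
Variables (R : realType) (p : nat) (p_pr : prime p).
Local Notation C := R[i].
Implicit Types (z w : C) (x y : R) (b c : nat -> C).

Let p0 : (0 < p)%N. Proof. exact: prime_gt0. Qed.
Let pn0 : p%:R != 0 :> C. Proof. by rewrite pnatr_eq0 -lt0n. Qed.

Definition zeta : C := qparam (p%:R^-1).

Lemma zeta_expp : zeta ^+ p = 1.
Proof. by rewrite -qparamMn mulfV // qparam1. Qed.

Lemma zeta_neq1 : zeta != 1.
Proof.
have p1 : 1 < p%:R :> R by rewrite ltr1n prime_gt1.
have p2 : 2 <= p%:R :> R by rewrite ler_nat prime_gt1.
have pr : (p%:R^-1 : C) = (p%:R^-1)%:C by rewrite fmorphV /= rmorph_nat.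
apply/eqP => /(congr1 (@complex.Re R)).
rewrite /zeta /qparam pr /= !(mulr0, oppr0, expR0, mul0r, mul1r, subr0) => hc.
have pi0 := pi_gt0 R.
(* The real parts give cos(2 pi / p) = cos 0, and 2 pi / p lies in [0, pi], where cos is injective,
   because p >= 2. *)
have h : 2 * pi / p%:R = 0 :> R.
  apply: cos_inj; rewrite ?cos0 // in_itv /= ?lexx ?(ltW pi0) //.
  rewrite divr_ge0 ?mulr_ge0 ?(ltW pi0) ?ler0n //= ler_pdivrMr; last by lra.
  by rewrite mulrC ler_pM2l.
have : 0 < 2 * pi / p%:R :> R by rewrite divr_gt0 ?mulr_gt0 //; lra.
by rewrite h ltxx.
Qed.

Lemma zeta_exp_eq1 n : (zeta ^+ n == 1) = (p %| n)%N.
Proof.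
apply/idP/idP => [/eqP zn|/dvdnP[m ->]]; last by rewrite mulnC exprM zeta_expp expr1n.
apply: contraT; rewrite -prime_coprime // coprime_sym => cop.
have n0 : (0 < n)%N.
  by case: n cop {zn} => //; rewrite /coprime gcd0n => /eqP e; have := prime_gt1 p_pr; rewrite e.
have [u v e _] := egcdnP p n0; move/eqP: cop => cop; rewrite cop in e.
case/eqP: zeta_neq1; have : zeta ^+ (u * n) = 1 by rewrite mulnC exprM zn expr1n.
by rewrite e addn1 exprSr mulnC exprM zeta_expp expr1n mul1r.
Qed.

Lemma Fp_sum_ord (V : zmodType) (F : nat -> V) : \sum_(j : 'F_p) F j = \sum_(j < p) F j.
Proof. by rewrite -[LHS](big_mkord xpredT F) -[RHS](big_mkord xpredT F) Fp_cast. Qed.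

Lemma zeta_sum n : \sum_(j : 'F_p) zeta ^+ ((j : nat) * n)%N = if (p %| n)%N then p%:R else 0.
Proof.
rewrite (Fp_sum_ord (fun j => zeta ^+ (j * n)%N)).
under eq_bigr do rewrite mulnC exprM.
rewrite -zeta_exp_eq1; case: eqP => [->|/eqP z1].
  by under eq_bigr do rewrite expr1n; rewrite sumr_const card_ord.
have d : zeta ^+ n - 1 != 0 by rewrite subr_eq0.
by apply: (mulfI d); rewrite mulr0 -subrX1 -exprM mulnC exprM zeta_expp expr1n subrr.
Qed.

Lemma sum_dilate (V : zmodType) (u : nat -> V) n :
  (forall i, ~~ (p %| i)%N -> u i = 0) -> \sum_(i < p * n) u i = \sum_(i < n) u (p * i)%N.
Proof.
move=> hu; elim: n => [|n IH]; first by rewrite muln0 !big_ord0.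
rewrite big_ord_recr /= -IH mulnS addnC big_split_ord /=; congr (_ + _).
rewrite (bigD1 (Ordinal p0)) //= addn0 big1 ?addr0 // => i i0; apply: hu.
rewrite dvdn_addr ?dvdn_mulr // gtnNdvd //.
by rewrite lt0n; apply: contra i0 => /eqP i0; apply/eqP/val_inj.
Qed.

Lemma qparam_zeta z (j : nat) n :
  qparam ((z + j%:R) / p%:R) ^+ n = qparam (z / p%:R) ^+ n * zeta ^+ (j * n)%N.
Proof.
by rewrite mulrDl qparamD exprMn qparamMn -exprM.
Qed.

(** Summing zeta^(jn) over j removes the terms whose index is not a multiple of p. The partial sums
    on the right are then the partial sums of index p n on the left, with the same limit. *)
Lemma fourier_average b z : tame b -> 0 < complex.Im z ->
  \sum_(j : 'F_p) fourier b ((z + (j : nat)%:R) / p%:R) =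
  fourier (fun n => p%:R * b (p * n)%N) z.
Proof.
move=> tb hz; have Imp (j : nat) : 0 < complex.Im ((z + j%:R) / p%:R).
  by rewrite Im_divn ImDn divr_gt0 // ltr0n.
symmetry; apply: fourier_unique => //; first by apply/tameZ/tame_dilate.
apply: (@csum_to_subseq R (fun n => \sum_(j : 'F_p) b n * qparam ((z + (j : nat)%:R) / p%:R) ^+ n) _ _ p) => //.
  by apply: csum_to_sum => j; apply: fourierP.
have E n : \sum_(j : 'F_p) b n * qparam ((z + (j : nat)%:R) / p%:R) ^+ n =
    b n * qparam (z / p%:R) ^+ n * (if (p %| n)%N then p%:R else 0).
  rewrite -zeta_sum mulr_sumr; apply: eq_bigr => j _.
  by rewrite qparam_zeta mulrA.
move=> n; rewrite (@sum_dilate C (fun n => \sum_(j : 'F_p)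
    b n * qparam ((z + (j : nat)%:R) / p%:R) ^+ n)) => [|i /negPf hi]; last by rewrite E hi mulr0.
apply: eq_bigr => i _; rewrite E dvdn_mulr // exprM.
rewrite -[qparam (z / _) ^+ p]qparamMn [p%:R * (z / _)]mulrC mulfVK //; ring.
Qed.

Lemma fourier_dilate b z : tame b -> 0 < complex.Im z ->
  fourier b (p%:R * z) = fourier (fun n => if (p %| n)%N then b (n %/ p)%N else 0) z.
Proof.
move=> tb hz; have hpz : 0 < complex.Im (p%:R * z) by rewrite ImMn mulr_gt0 // ltr0n.
apply: fourier_unique => //.
apply: (@csum_to_subseq R (fun n => (if (p %| n)%N then b (n %/ p)%N else 0) * qparam z ^+ n) _ _ p) => //.
  by apply: fourierP => //; exact: tame_inflate.
move=> n; rewrite (@sum_dilate C (fun n =>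
    (if (p %| n)%N then b (n %/ p)%N else 0) * qparam z ^+ n)) => [|i /negPf ->]; last by rewrite mul0r.
by apply: eq_bigr => i _; rewrite dvdn_mulr // mulKn // qparamMn exprM.
Qed.
End RootsOfUnity.

Section CoefficientBound.
Variable R : realType.
Local Notation C := R[i].
Implicit Types (z w : C) (x y : R) (b c : nat -> C).

(** [bernoulli_mul] gives x^N <= 1/((1 - x) N), which makes N0 explicit. *)
Lemma geometric_tail_small (B x e : R) : 0 <= x < 1 -> 0 <= B -> 0 < e ->
  exists N0, forall N, (N0 <= N)%N -> B * x ^+ N / (1 - x) < e.
Proof.
move=> hx B0 e0; have /andP[x0 x1] := hx; have d : 0 < 1 - x by lra.
have d2 : 0 < (1 - x) ^+ 2 by rewrite exprn_gt0.
pose K := B / ((1 - x) ^+ 2) / e.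
have K0 : 0 <= K by rewrite !divr_ge0 // ltW.
exists (Num.truncn K).+1 => N hN.
have N1 : K < N%:R by apply: lt_le_trans (truncnS_gt K) _; rewrite ler_nat.
have N0 : 0 < N%:R :> R by exact: le_lt_trans N1.
have h := bernoulli_mul N hx.
have hxN : x ^+ N <= ((1 - x) * N%:R)^-1.
  by rewrite -[leRHS]mul1r ler_pdivlMr ?mulr_gt0 // mulrC [_ * N%:R]mulrC.
apply: le_lt_trans (_ : B * ((1 - x) * N%:R)^-1 / (1 - x) < e).
  by rewrite ler_wpM2r ?invr_ge0 ?(ltW d) // ler_wpM2l.
have -> : B * ((1 - x) * N%:R)^-1 / (1 - x) = B / ((1 - x) ^+ 2) / N%:R.
  by field; rewrite !gt_eqF.
by rewrite ltr_pdivrMr // [e * _]mulrC -ltr_pdivrMr //; exact: N1.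
Qed.

(* Averaging over the p-th roots of unity isolates the coefficients congruent
   to n modulo p; letting p grow leaves the n-th one. *)
Lemma fourier_coef_bound b y (M : R) n : tame b -> 0 < y ->
  (forall x, cabs (fourier b (x +i* y)) <= M) ->
  cabs (b n) * expR (- (2 * pi * y)) ^+ n <= M.
Proof.
move=> tb y0 hM; apply/ler_addgt0Pr => e e0.
pose z : C := 0 +i* y; have hz : 0 < complex.Im z by [].
have hq := cabs_qparam_lt1 hz.
have [B [x [hx hB]]] := tame_geometric tb hq; have /andP[x0 x1] := hx.
have B0 : 0 <= B.
  by have := le_trans _ (hB 0%N); rewrite !expr0 !mulr1; apply; exact: cabs_ge0.
have [N0 hN0] := geometric_tail_small hx B0 e0.
have [p pN p_pr] := prime_above (maxn N0 n).
have np : (n < p)%N by exact: leq_ltn_trans (leq_maxr _ _) pN.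
have Np : (N0 <= p)%N by exact: leq_trans (leq_maxl _ _) (ltnW pN).
have p0 : 0 < p%:R :> R by rewrite ltr0n prime_gt0.
have pC0 : p%:R != 0 :> C by rewrite pnatr_eq0 -lt0n prime_gt0.
pose ze : C := zeta R p.
have absze : cabs ze = 1.
  have /eqP := congr1 (@cabs R) (zeta_expp R p_pr).
  by rewrite cabsX cabs1 pexpr_eq1 ?cabs_ge0 ?prime_gt0 // => /eqP.
pose zj (j : 'F_p) : C := z + (j : nat)%:R / p%:R.
have zjE j : zj j = ((j : nat)%:R / p%:R) +i* y.
  rewrite /zj !natr_complex -fmorphV -rmorphM /= /z /=; congr (_ +i* _); ring.
have hzj j : 0 < complex.Im (zj j) by rewrite zjE.
have qzj j m : qparam (zj j) ^+ m = qparam z ^+ m * ze ^+ (j * m)%N.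
  by rewrite /zj qparamD exprMn; congr (_ * _); rewrite qparamMn -exprM.
(* The exponent p - n plays the part of -n in natural numbers: S retains the m congruent to n modulo
   p. *)
pose S := \sum_(j : 'F_p) ze ^+ (j * (p - n))%N * fourier b (zj j).
have absS : cabs S <= p%:R * M.
  apply: le_trans (cabs_sum _ _ _) _.
  apply: le_trans (_ : \sum_(j : 'F_p) M <= _).
    apply: ler_sum => j _; rewrite cabsM cabsX absze expr1n mul1r zjE; exact: hM.
  by rewrite sumr_const card_Fp // mulr_natl.
pose u m := \sum_(j : 'F_p) ze ^+ (j * (p - n))%N * (b m * qparam (zj j) ^+ m).
have hS : csum_to u S.
  apply: (@csum_to_sum R _ _ (fun (j : 'F_p) m =>
    ze ^+ (j * (p - n))%N * (b m * qparam (zj j) ^+ m))) => j.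
  by apply: csum_toZ; apply: fourierP.
have uE m : u m = if (p %| m + (p - n))%N then p%:R * (b m * qparam z ^+ m) else 0.
  have -> : u m = (\sum_(j : 'F_p) ze ^+ (j * (m + (p - n)))%N) * (b m * qparam z ^+ m).
    rewrite mulr_suml; apply: eq_bigr => j _; rewrite qzj mulnDr exprD; ring.
  by rewrite zeta_sum //; case: ifP => _; rewrite ?mul0r.
have un : u n = p%:R * (b n * qparam z ^+ n).
  by rewrite uE subnKC ?(ltnW np) // dvdnn.
have u0 m : (m < p)%N -> m != n -> u m = 0.
  move=> mp mn; rewrite uE; case: ifP => // /dvdnP[k hk].
  by case: k hk => [|[|k]] hk; move/eqP: mn; clear -hk mp np; lia.
(* Once the n-th term is removed, only indices m >= p are left, and they form a geometric tail. *)
pose v m := if m == n then 0 else u m.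
have hv : csum_to v (S - u n).
  move=> d d0; have [N hN] := hS _ d0; exists (maxn N n.+1) => m.
  rewrite geq_max => /andP[/hN h nm].
  rewrite (bigD1 (Ordinal nm)) //= in h; rewrite (bigD1 (Ordinal nm)) //= {1}/v eqxx add0r.
  rewrite (eq_bigr (fun i : 'I_m => u i)) => [|i]; last first.
    by rewrite -val_eqE /= /v => /negPf ->.
  by move: h; set X := \sum_(i < m | _) _; rewrite (_ : u n + X - S = X - (S - u n)) //; ring.
have absv m : cabs (v m) <= if (m < p)%N then 0 else p%:R * (B * x ^+ m).
  rewrite /v; case: eqP => [->|/eqP mn]; first by rewrite cabs0 np.
  case: ltnP => mp; first by rewrite u0 // cabs0.
  rewrite uE; case: ifP => _; last by rewrite cabs0 !mulr_ge0 ?exprn_ge0 ?ler0n.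
  by rewrite !cabsM cabs_nat cabsX ler_pM2l // hB.
have absSv : cabs (S - u n) <= p%:R * (B * x ^+ p / (1 - x)).
  apply: (csum_to_le hv) => m; apply: le_trans (cabs_sum _ _ _) _.
  have T0 : 0 <= p%:R * (B * x ^+ p / (1 - x)).
    by rewrite mulr_ge0 ?ler0n // divr_ge0 ?mulr_ge0 ?exprn_ge0 //; lra.
  case: (leqP m p) => mp.
    rewrite big1_seq // => i _; apply/eqP; rewrite eq_le cabs_ge0 andbT.
    by have := absv i; rewrite (leq_trans (ltn_ord i) mp).
  rewrite -(subnKC (ltnW mp)) big_split_ord /= big1 => [|i _]; last first.
    by apply/eqP; rewrite eq_le cabs_ge0 andbT; have := absv i; rewrite ltn_ord.
  rewrite add0r; apply: le_trans (_ : \sum_(i < m - p) p%:R * B * x ^+ p * x ^+ i <= _).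
    apply: ler_sum => i _; apply: le_trans (absv _) _.
    by rewrite ltnNge leq_addr /= exprD !mulrA.
  rewrite -mulr_sumr !mulrA ler_wpM2l ?geo_sum_le //.
  by rewrite !mulr_ge0 ?exprn_ge0 ?ler0n.
have : cabs (u n) <= p%:R * M + p%:R * (B * x ^+ p / (1 - x)).
  have -> : u n = S - (S - u n) by ring.
  by apply: le_trans (cabsB _ _) _; exact: lerD.
rewrite un !cabsM cabs_nat cabsX cabs_qparam -mulrDr ler_pM2l // => /le_trans; apply.
by rewrite lerD2l ltW // hN0.
Qed.

(** [fourier_coef_bound] for the difference, with the bound 0 on the line Im z = 1. *)
Lemma fourier_inj b c : tame b -> tame c ->
  (forall z, 0 < complex.Im z -> fourier b z = fourier c z) -> b =1 c.
Proof.
move=> tb tc h n; apply/eqP; rewrite -subr_eq0.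
have td : tame (fun n => b n + (-1) * c n) by apply/tameD/tameZ.
have hz x : 0 < complex.Im (x +i* 1 : C) by [].
have H x : cabs (fourier (fun n => b n + (-1) * c n) (x +i* 1)) <= 0.
  by rewrite fourierD ?fourierZ ?h //; [rewrite mulN1r subrr cabs0|exact: tameZ].
have := fourier_coef_bound n td ltr01 H.
rewrite pmulr_lle0 ?exprn_gt0 ?expR_gt0 // mulN1r => hle.
by rewrite -cabs_eq0 eq_le hle cabs_ge0.
Qed.

Lemma tame_deriv b : tame b -> tame (fun n => tpi R * (n%:R * b n)).
Proof. by move=> tb; apply/tameZ/tame_mulrn. Qed.

Lemma cabs_tpi : cabs (tpi R) = 2 * pi.
Proof.
apply/eqP; have p0 : 0 <= 2 * pi :> R by rewrite mulr_ge0 // pi_ge0.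
rewrite -(@eqrXn2 _ 2) ?cabs_ge0 // cabs_sqr /tpi /=; apply/eqP; ring.
Qed.

(** [cexp_taylor1] is applied term by term. The n-th remainder costs n^2, absorbed by [tame_mulrn],
    and exp(2 pi n |w|); with |w| <= y/2 this leaves the decay exp(-pi n y), whence the choice of
    [s]. *)
Lemma fourier_taylor b y : tame b -> 0 < y -> exists2 M, 0 <= M &
  forall z w, y <= complex.Im z -> cabs w <= y / 2 ->
  cabs (fourier b (z + w) - fourier b z - w * fourier (fun n => tpi R * (n%:R * b n)) z)
    <= M * cabs w ^+ 2.
Proof.
move=> tb y0; have pi0 := pi_gt0 R.
have tb' := tame_deriv tb; have tb2 := tame_mulrn (tame_mulrn tb).
pose s := expR (- (pi * y)).
have hs : 0 < s < 1 by rewrite expR_gt0 /= expR_lt1 oppr_lt0 mulr_gt0.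
have [B [x [hx hB]]] := tame_geometric tb2 hs; have /andP[x0 x1] := hx.
have B0 : 0 <= B.
  by have := le_trans _ (hB 0%N); rewrite !expr0 !mulr1; apply; exact: cabs_ge0.
pose K := 3 * (2 * pi) ^+ 2 * B / (1 - x).
exists K; first by rewrite /K divr_ge0 ?mulr_ge0 ?exprn_ge0 ?cabs_ge0 ?ler0n //; lra.
move=> z w hz hw.
have hz0 : 0 < complex.Im z by lra.
have hzw : 0 < complex.Im (z + w).
  rewrite ImD; have := cabs_ge_Im w; have := ler_norm (- complex.Im w).
  rewrite normrN; lra.
pose u n := b n * qparam (z + w) ^+ n + (-1) * (b n * qparam z ^+ n)
  + (- w) * (tpi R * (n%:R * b n) * qparam z ^+ n).
have hu : csum_to u (fourier b (z + w) - fourier b z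
    - w * fourier (fun n => tpi R * (n%:R * b n)) z).
  rewrite -mulNr -[X in _ + X + _]mulN1r; apply: csum_toD; last first.
    by apply: csum_toZ; exact: fourierP.
  by apply: csum_toD; [exact: fourierP|apply: csum_toZ; exact: fourierP].
apply: (csum_to_le hu) => m; apply: le_trans (cabs_sum _ _ _) _.
apply: le_trans (_ : \sum_(i < m) 3 * (2 * pi) ^+ 2 * cabs w ^+ 2 * B * x ^+ i <= _); last first.
  rewrite -mulr_sumr; have := geo_sum_le m hx; set T := \sum_(i < m) _ => hT.
  have -> : K * cabs w ^+ 2 = 3 * (2 * pi) ^+ 2 * cabs w ^+ 2 * B * (1 - x)^-1.
    by rewrite /K; ring.
  by apply: ler_wpM2l => //; rewrite !mulr_ge0 ?exprn_ge0 ?cabs_ge0 ?ler0n //; lra.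
apply: ler_sum => n _; set t : C := tpi R * (n%:R * w).
have ut : u n = b n * qparam z ^+ n * (cexp t - 1 - t).
  have -> : cexp t = qparam w ^+ n by rewrite -qparamMn qparamE.
  by rewrite /u qparamD exprMn /t; ring.
have ct : cabs t = 2 * pi * (n%:R * cabs w) by rewrite /t cabsM cabs_tpi cabsM cabs_nat.
rewrite ut cabsM; apply: le_trans (ler_wpM2l (cabs_ge0 _) (cexp_taylor1 t)) _.
rewrite cabsM cabsX cabs_qparam.
have e1 : expR (- (2 * pi * complex.Im z)) ^+ n * expR (cabs t) <= s ^+ n.
  rewrite ct /s -!expRM_natl -expRD ler_expR.
  have nn : 0 <= n%:R :> R by [].
  have : 0 <= pi * n%:R * (2 * complex.Im z - 2 * cabs w - y).
    by rewrite !mulr_ge0 //; lra.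
  lra.
apply: le_trans (_ : 3 * (2 * pi) ^+ 2 * cabs w ^+ 2 * (cabs (n%:R * (n%:R * b n)) * s ^+ n) <= _);
  last first.
  rewrite -[leRHS]mulrA; apply: ler_wpM2l; last exact: hB.
  by rewrite !mulr_ge0 ?exprn_ge0 ?cabs_ge0 ?ler0n //; lra.
rewrite [cabs (n%:R * (n%:R * b n))]cabsM [cabs (n%:R * b n)]cabsM cabs_nat.
rewrite ct in e1 *.
set E := expR (- _) ^+ n in e1 *; set F := expR (2 * pi * (n%:R * _)) in e1 *.
have -> : cabs (b n) * E * (3 * (2 * pi * (n%:R * cabs w)) ^+ 2 * F) =
  3 * (2 * pi) ^+ 2 * cabs w ^+ 2 * (n%:R * (n%:R * cabs (b n))) * (E * F) by ring.
rewrite [leRHS]mulrA; apply: ler_wpM2l => //.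
by rewrite !mulr_ge0 ?exprn_ge0 ?cabs_ge0 ?ler0n //; lra.
Qed.
End CoefficientBound.

(** * Eichler integrals *)

Section ComplexDerivative.
Variable R : realType.
Local Notation C := R[i].
Implicit Types (z w l : C) (F G : C -> C).

Definition ccont F z := forall e : R, 0 < e -> exists2 d, 0 < d &
  forall w, cabs (w - z) < d -> cabs (F w - F z) < e.

Definition cder F z l := forall e : R, 0 < e -> exists2 d, 0 < d &
  forall w, cabs (w - z) < d -> cabs (F w - F z - l * (w - z)) <= e * cabs (w - z).

Lemma ccont_cst c z : ccont (fun=> c) z.
Proof. by move=> e e0; exists 1 => // w _; rewrite subrr cabs0. Qed.

Lemma ccontD F G z : ccont F z -> ccont G z -> ccont (fun w => F w + G w) z.
Proof.
move=> hF hG e e0; have e2 : 0 < e / 2 by rewrite divr_gt0.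
have [d d0 hd] := hF _ e2; have [d' d0' hd'] := hG _ e2.
exists (Num.min d d'); first by rewrite lt_min d0.
move=> w; rewrite lt_min => /andP[/hd h1 /hd' h2].
by rewrite opprD addrACA (splitr e); apply: le_lt_trans (cabsD _ _) _; rewrite ltrD.
Qed.

Lemma ccontM F G z : ccont F z -> ccont G z -> ccont (fun w => F w * G w) z.
Proof.
move=> hF hG e e0; pose K := cabs (F z) + cabs (G z) + 1.
have a0 := cabs_ge0 (F z); have b0 := cabs_ge0 (G z).
have K1 : 1 <= K by rewrite /K; lra.
pose e1 := Num.min 1 (e / (2 * K)).
have e10 : 0 < e1 by rewrite lt_min ltr01 divr_gt0 ?mulr_gt0 //; lra.
have e11 : e1 <= 1 by rewrite ge_min lexx.
have e12 : e1 * (2 * K) <= e by rewrite -ler_pdivlMr ?ge_min ?lexx ?orbT // mulr_gt0; lra.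
have [d d0 hd] := hF _ e10; have [d' d0' hd'] := hG _ e10.
exists (Num.min d d'); first by rewrite lt_min d0.
move=> w; rewrite lt_min => /andP[/hd h1 /hd' h2].
have -> : F w * G w - F z * G z =
  (F w - F z) * (G w - G z) + ((F w - F z) * G z + F z * (G w - G z)) by ring.
apply: le_lt_trans (cabsD _ _) _; rewrite cabsM.
have h3 := cabsD ((F w - F z) * G z) (F z * (G w - G z)); rewrite !cabsM in h3.
have p0 := cabs_ge0 (F w - F z); have q0 := cabs_ge0 (G w - G z).
set P := cabs (F w - F z) in h1 h3 p0 *; set Q := cabs (G w - G z) in h2 h3 q0 *.
have hPQ : P * Q <= e1 by rewrite -[leRHS]mulr1; apply: ler_pM => //; lra.
have hPb : P * cabs (G z) <= e1 * cabs (G z) by apply: ler_wpM2r => //; exact: ltW.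
have hQa : cabs (F z) * Q <= cabs (F z) * e1 by apply: ler_wpM2l => //; exact: ltW.
have : e1 * K < e by nra.
rewrite /K; lra.
Qed.

Lemma ccont_comp F G z : ccont G z -> ccont F (G z) -> ccont (fun w => F (G w)) z.
Proof.
move=> hG hF e /hF[d d0 hd]; have [d' d'0 hd'] := hG _ d0.
by exists d' => // w /hd'/hd.
Qed.

(** With the derivative seen as the value of a continuous slope, the rules for sums, products and
    compositions follow from those for continuity. *)
Lemma cder_caratheodory F z l : cder F z l <->
  exists phi, [/\ forall w, F w - F z = phi w * (w - z), phi z = l & ccont phi z].
Proof.
split=> [hF|[phi [hphi <- cphi]] e e0]; last first.
  have [d d0 hd] := cphi e e0; exists d => // w /hd h.
  by rewrite hphi -mulrBl cabsM ler_wpM2r ?cabs_ge0 // ltW.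
exists (fun w => if w == z then l else (F w - F z) / (w - z)); split.
- by move=> w; case: eqP => [->|/eqP wz]; rewrite ?subrr ?mulr0 // divfK // subr_eq0.
- by rewrite eqxx.
move=> e e0; have e2 : 0 < e / 2 by rewrite divr_gt0.
have [d d0 hd] := hF _ e2; exists d => // w wd; rewrite eqxx.
case: eqP => [_|/eqP wz]; first by rewrite subrr cabs0.
have nz : w - z != 0 by rewrite subr_eq0.
have -> : (F w - F z) / (w - z) - l = (F w - F z - l * (w - z)) / (w - z).
  by rewrite [RHS]mulrBl mulfK.
rewrite cabsM cabsV ltr_pdivrMr ?cabs_gt0 //.
apply: le_lt_trans (hd w wd) _; rewrite ltr_pM2r ?cabs_gt0 //; lra.
Qed.

Lemma cder_ccont F z l : cder F z l -> ccont F z.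
Proof.
move=> /cder_caratheodory[phi [hphi _ cphi]] e e0.
have h := ccontM cphi (_ : ccont (fun w => w - z) z).
have [|d d0 hd] := h _ e e0.
  by move=> e' e'0; exists e' => // w; rewrite subrr subr0.
by exists d => // w /hd; rewrite -!hphi subrr subr0.
Qed.

Lemma cder_cst c z : cder (fun=> c) z 0.
Proof. by move=> e e0; exists 1 => // w _; rewrite subrr mul0r subrr cabs0 mulr_ge0 ?cabs_ge0 // ltW. Qed.

Lemma cder_id z : cder id z 1.
Proof. by move=> e e0; exists 1 => // w _; rewrite mul1r subrr cabs0 mulr_ge0 ?cabs_ge0 // ltW. Qed.

Lemma cderD F G z l l' : cder F z l -> cder G z l' -> cder (fun w => F w + G w) z (l + l').
Proof.
move=> /cder_caratheodory[phi [h1 <- c1]] /cder_caratheodory[psi [h2 <- c2]].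
apply/cder_caratheodory; exists (fun w => phi w + psi w); split => //; last exact: ccontD.
by move=> w; rewrite opprD addrACA h1 h2 mulrDl.
Qed.

Lemma cderM F G z l l' : cder F z l -> cder G z l' ->
  cder (fun w => F w * G w) z (l * G z + F z * l').
Proof.
move=> dF dG; have cF := cder_ccont dF.
move: dF dG => /cder_caratheodory[phi [h1 <- c1]] /cder_caratheodory[psi [h2 <- c2]].
apply/cder_caratheodory; exists (fun w => phi w * G z + F w * psi w); split => //.
  move=> w; transitivity ((F w - F z) * G z + F w * (G w - G z)); first by ring.
  by rewrite h1 h2; ring.
by apply: ccontD; apply: ccontM => //; exact: ccont_cst.
Qed.

Lemma cder_comp F G z l l' : cder G z l -> cder F (G z) l' ->
  cder (fun w => F (G w)) z (l' * l).
Proof.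
move=> dG dF; have cG := cder_ccont dG.
move: dG dF => /cder_caratheodory[phi [h1 <- c1]] /cder_caratheodory[psi [h2 <- c2]].
apply/cder_caratheodory; exists (fun w => psi (G w) * phi w); split => //.
  by move=> w; rewrite h2 h1 mulrA.
by apply: ccontM => //; exact: ccont_comp.
Qed.

Lemma cder_ext F G z l : F =1 G -> cder F z l -> cder G z l.
Proof. by move=> /funext ->. Qed.

Lemma cderZ c F z l : cder F z l -> cder (fun w => c * F w) z (c * l).
Proof. by move=> h; have := cderM (cder_cst c z) h; rewrite mul0r add0r. Qed.

Lemma cder_sum (I : Type) (r : seq I) (F : I -> C -> C) (l : I -> C) z :
  (forall i, cder (F i) z (l i)) -> cder (fun w => \sum_(i <- r) F i w) z (\sum_(i <- r) l i).
Proof.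
move=> h; elim: r => [|i r IH].
  by rewrite big_nil; apply: cder_ext (cder_cst 0 z) => w; rewrite big_nil.
by rewrite big_cons; apply: cder_ext (cderD (h i) IH) => w; rewrite big_cons.
Qed.

Lemma cder_horner (Q : {poly C}) z : cder (fun w => Q.[w]) z (Q^`()).[z].
Proof.
elim/poly_ind: Q => [|Q c IH].
  by rewrite deriv0 horner0; apply: cder_ext (cder_cst 0 z) => w; rewrite horner0.
rewrite derivD derivC addr0 derivM derivX mulr1 hornerD hornerM hornerX.
have := cderD (cderM IH (cder_id z)) (cder_cst c z); rewrite addr0 mulr1.
by apply: cder_ext => w; rewrite !hornerE.
Qed.

Lemma cder_inv z : z != 0 -> cder (fun w => - w^-1) z (z ^- 2).
Proof.
move=> z0 e e0; have az : 0 < cabs z by rewrite cabs_gt0.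
(* The remainder has modulus |w - z|^2 / (|z|^2 |w|). The first bound gives |w| > |z|/2; the second
   one then makes it at most e |w - z|. *)
pose d := Num.min (cabs z / 2) (e * cabs z ^+ 3 / 2).
exists d; first by rewrite lt_min !divr_gt0 ?mulr_gt0 ?exprn_gt0.
move=> w; rewrite lt_min => /andP[h1 h2].
have aw : cabs z / 2 < cabs w.
  have := cabsB w (w - z); rewrite (_ : w - (w - z) = z); last by ring.
  lra.
have w0 : w != 0 by rewrite -cabs_gt0; lra.
have -> : - w^-1 - - z^-1 - z ^- 2 * (w - z) = - ((w - z) * (z ^- 2 * w^-1)) * (w - z).
  by field; rewrite w0 z0.
rewrite cabsM ler_wpM2r ?cabs_ge0 // cabsN !cabsM !cabsV cabsX.
have hw : (cabs w)^-1 <= 2 / cabs z.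
  by rewrite -[2]invrK -invfM lef_pV2 ?posrE ?divr_gt0 //; lra.
apply: le_trans (_ : (e * cabs z ^+ 3 / 2) * ((cabs z ^+ 2)^-1 * (2 / cabs z)) <= _).
  apply: ler_pM; rewrite ?cabs_ge0 //; first by rewrite mulr_ge0 ?invr_ge0 ?exprn_ge0 ?cabs_ge0.
    exact: ltW.
  by rewrite ler_wpM2l // invr_ge0 exprn_ge0 // ltW.
by rewrite le_eqVlt; apply/orP; left; apply/eqP; field; rewrite gt_eqF.
Qed.

(** The half-plane is convex: along the segment from z to w the real part of F is a real function
    with derivative 0, and the real mean value theorem applies. *)
Lemma cder0_Re_const F z w : (forall t, 0 < complex.Im t -> cder F t 0) ->
  0 < complex.Im z -> 0 < complex.Im w -> complex.Re (F z) = complex.Re (F w).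
Proof.
move=> dF hz hw; pose path (t : R) : C := z + t%:C * (w - z).
have pathB s t : path s - path t = (s - t)%:C * (w - z).
  by rewrite /path rmorphB /=; ring.
have hpath (t : R) : 0 <= t <= 1 -> 0 < complex.Im (path t).
  move=> /andP[t0 t1]; rewrite /path ImD Im_realM ImD.
  have -> : complex.Im (- z) = - complex.Im z by case: (z).
  have : 0 <= t * complex.Im w by rewrite mulr_ge0 // ltW.
  have [->|tn1] := eqVneq t 1; first by lra.
  have tl : 0 < 1 - t by move: tn1; rewrite neq_lt => /orP[]; lra.
  have : 0 < (1 - t) * complex.Im z by rewrite mulr_gt0.
  lra.
pose f (t : R) : R := complex.Re (F (path t)).
have df (t : R) : 0 <= t <= 1 -> is_derive t 1 f 0.
  move=> ht; have /cder_caratheodory[phi [h1 h2 h3]] := dF _ (hpath t ht).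
  apply/is_derive1_caratheodory; exists (fun s => complex.Re (phi (path s) * (w - z))); split.
  - move=> s; rewrite /f.
    have <- : complex.Re (F (path s) - F (path t)) = complex.Re (F (path s)) - complex.Re (F (path t)).
      by rewrite ReD; congr (_ + _); case: (F (path t)).
    by rewrite h1 pathB [X in phi _ * X]mulrC mulrA mulrC Re_realM mulrC.
  - apply/cvgrPdist_lt => e e0; have K0 : 0 < cabs (w - z) + 1.
      by have := cabs_ge0 (w - z); lra.
    have [d d0 hd] := h3 _ (divr_gt0 e0 K0).
    have d1 : 0 < d / (cabs (w - z) + 1) by rewrite divr_gt0.
    apply/nbhs_ballP; exists (d / (cabs (w - z) + 1)) => //= s.
    rewrite /ball /= distrC => hs.
    have : cabs (path s - path t) < d.
      rewrite pathB cabsM cabs_real; apply: le_lt_trans (_ : `|s - t| * (cabs (w - z) + 1) < d).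
        by rewrite ler_wpM2l // lerDl.
      by rewrite -ltr_pdivlMr.
    move=> /hd h; rewrite -normrN opprB.
    have -> : complex.Re (phi (path s) * (w - z)) - complex.Re (phi (path t) * (w - z))
        = complex.Re ((phi (path s) - phi (path t)) * (w - z)).
      by rewrite mulrBl ReD; congr (_ + _); case: (phi (path t) * (w - z)).
    apply: le_lt_trans (cabs_ge_Re _) _; rewrite cabsM.
    apply: le_lt_trans (_ : cabs (phi (path s) - phi (path t)) * (cabs (w - z) + 1) < e).
      by rewrite ler_wpM2l ?cabs_ge0 // lerDl.
    by rewrite -ltr_pdivlMr.
  - by rewrite h2 mul0r.
have cf : {within `[0, 1], continuous f}.
  by apply: derivable_within_continuous => t; rewrite in_itv /= => /df[].
have [c hc] := MVT_segment ler01 (fun t (h : t \in `]0, 1[) => df t (subset_itv_oo_cc h)) cf.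
rewrite mul0r /f.
have -> : path 1 = w by rewrite /path rmorph1; ring.
have -> : path 0 = z by rewrite /path rmorph0; ring.
by move=> /eqP; rewrite subr_eq0 => /eqP.
Qed.

(** The imaginary part of F is, up to sign, the real part of i F. *)
Lemma cder0_const F z w : (forall t, 0 < complex.Im t -> cder F t 0) ->
  0 < complex.Im z -> 0 < complex.Im w -> F z = F w.
Proof.
move=> dF hz hw; apply/eqP; rewrite eq_complex.
rewrite (cder0_Re_const dF hz hw) eqxx /=.
have dF' t : 0 < complex.Im t -> cder (fun u => 'i%C * F u) t 0.
  by move=> /dF h; rewrite -(mulr0 'i%C); exact: cderZ.
have := cder0_Re_const dF' hz hw; case: (F z) => a b; case: (F w) => a' b' /=.
by rewrite !mul0r !mul1r !sub0r => /oppr_inj ->.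
Qed.
End ComplexDerivative.

Lemma Im_neg_inv (R : realType) (z : R[i]) :
  complex.Im (- z^-1) = complex.Im z / cabs z ^+ 2.
Proof.
rewrite invc_norm cabsE -rmorphXn -fmorphV /= -mulrN Im_realM mulrC; congr (_ * _).
by case: z => x y /=; rewrite opprK.
Qed.

(** * Antiderivatives of f times a polynomial *)

Section EichlerIntegral.
Variable R : realType.
Local Notation C := R[i].
Implicit Types (z w : C) (Q : {poly C}).

Lemma derivn_comp_lin Q (c d : C) m :
  (Q \Po (c *: 'X + d%:P))^`(m) = c ^+ m *: (Q^`(m) \Po (c *: 'X + d%:P)).
Proof.
elim: m => [|m IH]; first by rewrite !derivn0 expr0 scale1r.
rewrite !derivnS IH derivZ deriv_comp derivD derivZ derivX derivC addr0.
by rewrite -scalerAr mulr1 scalerA exprSr.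
Qed.

Lemma hact_scale_comp g (c d e : C) Q : (size Q <= g.+1)%N -> e != 0 ->
  hact g (Mat2 c d 0 e) Q = e ^+ g *: (Q \Po ((c / e) *: 'X + (d / e)%:P)).
Proof.
move=> sQ e0; set L := (c / e) *: 'X + _.
have hL : c *: 'X + d%:P = e *: L :> {poly C}.
  by rewrite /L scalerDr scalerA -!mul_polyC -polyCM mulrCA mulfV // mulr1 mulrCA mulfV // mulr1.
rewrite hactE /= hL {2}(poly_widen sQ) raddf_sum scaler_sumr.
apply: eq_bigr => j _ /=; have hj := ltn_ord j.
rewrite linearZ /= comp_Xn_poly scale0r add0r exprZn -polyC_exp [_ * _%:P]mulrC.
rewrite mul_polyC !scalerA; congr (_ *: _).
by rewrite -mulrA -exprD subnK // mulrC.
Qed.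

Variables (g : nat) (a : nat -> C).
Hypotheses (ta : tame a) (a0 : a 0%N = 0).

(** The coefficients of the m-fold antiderivative. For m > 0 the index n = 0 divides by 0; for a
    cusp form this term is absent. *)
Definition icoef m n : C := a n / (tpi R * n%:R) ^+ m.

Lemma tpi_neq0 : tpi R != 0.
Proof. by rewrite -cabs_gt0 cabs_tpi mulr_gt0 // pi_gt0. Qed.

Lemma tame_icoef m : tame (icoef m).
Proof.
apply: (tame_le ta) => -[|n]; first by rewrite /icoef a0 mul0r.
rewrite /icoef cabsM cabsV cabsX cabsM cabs_tpi cabs_nat -[leRHS]mulr1.
rewrite ler_wpM2l ?cabs_ge0 // invf_le1; last first.
  by rewrite exprn_gt0 // !mulr_gt0 // pi_gt0.
apply: exprn_ege1; have := pi_ge2 R; have : 1 <= n.+1%:R :> R by rewrite ler1n.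
nra.
Qed.

Lemma icoef0 m : icoef m 0 = 0. Proof. by rewrite /icoef a0 mul0r. Qed.

Lemma icoefS m n : tpi R * (n%:R * icoef m.+1 n) = icoef m n.
Proof.
case: n => [|n]; first by rewrite !icoef0 !mulr0.
have n0 : n.+1%:R != 0 :> C by rewrite pnatr_eq0.
have t0 : tpi R * n.+1%:R != 0 by rewrite mulf_neq0 // tpi_neq0.
by rewrite /icoef exprS mulrA invfM mulrCA (mulrA (_ * _)) mulfV // mul1r.
Qed.

Definition iter_int m z : C := fourier (icoef m) z.

Lemma cder_iter_int m z : 0 < complex.Im z -> cder (iter_int m.+1) z (iter_int m z).
Proof.
move=> hz e e0; have [M M0 hM] := fourier_taylor (tame_icoef m.+1) hz.
have K0 : 0 < M + 1 by lra.
exists (Num.min (complex.Im z / 2) (e / (M + 1))).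
  by rewrite lt_min !divr_gt0.
move=> w; rewrite lt_min => /andP[h1 h2].
have := hM z (w - z) (lexx _) (ltW h1).
rewrite (_ : z + (w - z) = w); last by ring.
have -> : fourier (fun n => tpi R * (n%:R * icoef m.+1 n)) z = iter_int m z.
  by congr fourier; apply/funext => n; rewrite icoefS.
rewrite [(w - z) * _]mulrC => /le_trans; apply.
rewrite expr2 mulrA ler_wpM2r ?cabs_ge0 //.
move: h2; rewrite ltr_pdivlMr // => h2; have := cabs_ge0 (w - z); lra.
Qed.

(** Repeated integration by parts of f(z) Q(z) dz, with iterated integrals free of constant term. It
    stops after g + 1 steps because Q has degree at most g. *)
Definition eichler Q z : C :=
  \sum_(m < g.+1) (-1) ^+ m * (Q^`(m)).[z] * iter_int m.+1 z.

Lemma eichlerD P Q z : eichler (P + Q) z = eichler P z + eichler Q z.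
Proof.
rewrite /eichler -big_split; apply: eq_bigr => m _ /=.
by rewrite derivnD hornerD; ring.
Qed.

Lemma eichlerZ c Q z : eichler (c *: Q) z = c * eichler Q z.
Proof.
rewrite /eichler mulr_sumr; apply: eq_bigr => m _ /=.
by rewrite derivnZ hornerZ; ring.
Qed.

Lemma iter_intDz m z (n : int) : iter_int m (z + n%:~R) = iter_int m z.
Proof. exact: fourierDz. Qed.

Lemma eichler_T Q z (n : int) : (size Q <= g.+1)%N ->
  eichler Q (z + n%:~R) = eichler (hact g (Mat2 1 n%:~R 0 1) Q) z.
Proof.
move=> sQ; apply: eq_bigr => m _; rewrite iter_intDz; congr (_ * _ * _).
rewrite hact_scale_comp ?oner_eq0 // expr1n scale1r !divr1 derivn_comp_lin.
by rewrite expr1n scale1r horner_comp !hornerE.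
Qed.

Lemma cder_eichler Q z : (size Q <= g.+1)%N -> 0 < complex.Im z ->
  cder (eichler Q) z (Q.[z] * fourier a z).
Proof.
move=> sQ hz.
have -> : Q.[z] * fourier a z = \sum_(m < g.+1)
   ((-1) ^+ m * ((Q^`(m.+1)).[z] * iter_int m.+1 z + (Q^`(m)).[z] * iter_int m z)).
  (* The derivative telescopes; the upper end contains the derivative of order g + 1 of Q, which is
     0. *)
  pose t m := - ((-1) ^+ m * ((Q^`(m)).[z] * iter_int m z)).
  rewrite -(big_mkord xpredT (fun m => (-1) ^+ m * ((Q^`(m.+1)).[z] * iter_int m.+1 z
    + (Q^`(m)).[z] * iter_int m z))).
  rewrite (eq_bigr (fun m => t m.+1 - t m)) => [|m _]; last by rewrite /t exprS; ring.
  rewrite telescope_sumr // /t derivn_poly0 // horner0 mul0r mulr0 oppr0 add0r opprK.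
  rewrite expr0 mul1r derivn0; congr (_ * _); congr fourier; apply/funext => n.
  by rewrite /icoef expr0 divr1.
apply: cder_sum => m; have h := cderM (cder_horner (Q^`(m)) z) (cder_iter_int m hz).
rewrite derivnS; apply: cder_ext (cderZ ((-1) ^+ m) h) => w.
by rewrite mulrA.
Qed.

(* The difference has zero derivative: with Q homogeneous of degree k - 2,
   f(z) Q(z) dz is invariant under z -> -1/z. *)
Lemma eichler_S (hS : forall z, 0 < complex.Im z ->
    fourier a (- z^-1) = z ^+ g.+2 * fourier a z) Q : (size Q <= g.+1)%N ->
  exists c, forall z, 0 < complex.Im z ->
    eichler Q (- z^-1) = eichler (hact g (Mat2 0 (-1) 1 0) Q) z + c.
Proof.
move=> sQ; set Q' := hact _ _ _; have sQ' : (size Q' <= g.+1)%N by exact: size_hact.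
have ImS z : 0 < complex.Im z -> 0 < complex.Im (- z^-1).
  move=> hz; rewrite Im_neg_inv divr_gt0 // exprn_gt0 // cabs_gt0.
  by apply: contraTneq hz => ->; rewrite /= ltxx.
pose D z := eichler Q (- z^-1) + (-1) * eichler Q' z.
have dD z : 0 < complex.Im z -> cder D z 0.
  move=> hz; have z0 : z != 0 by apply: contraTneq hz => ->; rewrite /= ltxx.
  have h1 := cder_comp (cder_inv z0) (cder_eichler sQ (ImS z hz)).
  have h2 := cderZ (-1) (cder_eichler sQ' hz).
  have := cderD h1 h2; rewrite hS // (_ : _ + _ = 0) //.
  rewrite (horner_hev _ sQ) (horner_hev _ sQ') hev_hact /=.
  have -> : hev g Q (0 * z + -1 * 1) (1 * z + 0 * 1) = z ^+ g * hev g Q (- z^-1) 1.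
    rewrite -hev_scale; congr hev; first by rewrite mulrN mulfV //; ring.
    ring.
  by rewrite !exprS; field; rewrite z0.
have i0 : 0 < complex.Im ('i%C : C) by rewrite /= ltr01.
have [c hc] : exists c, forall z, 0 < complex.Im z -> D z = c.
  by exists (D 'i%C) => z hz; exact: cder0_const dD hz i0.
have E (u v w : C) : u + (-1) * v = w -> u = v + w by move=> <-; ring.
by exists c => z hz; apply: E; exact: hc.
Qed.

End EichlerIntegral.

(** * The modular symbol of an eigenform *)

Section Moebius.
Variable R : realType.
Local Notation C := R[i].
Implicit Types (z w : C) (M N : mat2 int).

Definition mob M z : C :=
  ((m00 M)%:~R * z + (m01 M)%:~R) / ((m10 M)%:~R * z + (m11 M)%:~R).

Lemma intr_complex (n : int) : n%:~R = (n%:~R)%:C :> C.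
Proof. by rewrite rmorph_int. Qed.

Lemma mob_den_neq0 M z : 0 < det2 M -> 0 < complex.Im z ->
  (m10 M)%:~R * z + (m11 M)%:~R != 0.
Proof.
move=> dM hz; apply/negP => /eqP e.
have c0 : m10 M = 0.
  have := congr1 (@complex.Im R) e; rewrite !intr_complex ImD Im_realM /= addr0.
  move/eqP; rewrite mulf_eq0 (gt_eqF hz) orbF intr_eq0 => /eqP //.
have d0 : m11 M = 0.
  by move: e; rewrite c0 mul0r add0r => /eqP; rewrite intr_eq0 => /eqP.
by move: dM; rewrite /det2 c0 d0 !mulr0 subrr ltxx.
Qed.

Lemma Im_mob M z : 0 < det2 M -> 0 < complex.Im z ->
  complex.Im (mob M z) = (det2 M)%:~R * complex.Im z
    / cabs ((m10 M)%:~R * z + (m11 M)%:~R) ^+ 2.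
Proof.
move=> dM hz; rewrite /mob invc_norm cabsE -rmorphXn -fmorphV /= mulrCA Im_realM mulrC.
congr (_ * _); rewrite !intr_complex; case: z {hz} => x y /=.
by rewrite /det2 rmorphB !rmorphM /=; ring.
Qed.

Lemma mob_dom M z : 0 < det2 M -> 0 < complex.Im z -> 0 < complex.Im (mob M z).
Proof.
move=> dM hz; rewrite Im_mob //; apply: divr_gt0; first by rewrite mulr_gt0 ?ltr0z.
by rewrite exprn_gt0 // cabs_gt0 mob_den_neq0.
Qed.

Lemma det2_mul M N : det2 (mul2 M N) = det2 M * det2 N.
Proof. by rewrite /det2 /=; ring. Qed.

Lemma mob_mul M N z : 0 < det2 M -> 0 < det2 N -> 0 < complex.Im z ->
  mob M (mob N z) = mob (mul2 M N) z.
Proof.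
move=> dM dN hz; have n0 := mob_den_neq0 dN hz.
have n1 := mob_den_neq0 dM (mob_dom dN hz).
have n2 : (m10 (mul2 M N))%:~R * z + (m11 (mul2 M N))%:~R != 0.
  by apply: mob_den_neq0 => //; rewrite det2_mul mulr_gt0.
move: n0 n1 n2; rewrite /mob /= !(rmorphD, rmorphM) /=.
move: ((m00 M)%:~R : C) ((m01 M)%:~R : C) ((m10 M)%:~R : C) ((m11 M)%:~R : C) => A B E F.
move: ((m00 N)%:~R : C) ((m01 N)%:~R : C) ((m10 N)%:~R : C) ((m11 N)%:~R : C) => A' B' E' F'.
move=> n0 n1 n2; field; rewrite n0 n2 /=.
move: n1; rewrite (_ : E * ((A' * z + B') / (E' * z + F')) + F =
  ((E * A' + F * E') * z + (E * B' + F * F')) / (E' * z + F')); last by field.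
by rewrite mulf_eq0 negb_or => /andP[].
Qed.

Lemma mob_id z : mob (Mat2 1 0 0 1) z = z.
Proof. by rewrite /mob /= mul0r add0r addr0 mul1r divr1. Qed.
End Moebius.

Lemma mul2A (M N P : mat2 int) : mul2 M (mul2 N P) = mul2 (mul2 M N) P.
Proof. by congr Mat2; rewrite /=; ring. Qed.

Lemma mul2_adjr (M : mat2 int) : det2 M = 1 -> mul2 M (adj2 M) = Mat2 1 0 0 1.
Proof. by move=> dM; rewrite -dM; congr Mat2; rewrite /det2 /=; ring. Qed.

Lemma mul2_adjl (M : mat2 int) : det2 M = 1 -> mul2 (adj2 M) M = Mat2 1 0 0 1.
Proof. by move=> dM; rewrite -dM; congr Mat2; rewrite /det2 /=; ring. Qed.

Lemma mul2_1l (M : mat2 int) : mul2 (Mat2 1 0 0 1) M = M.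
Proof. by case: M => A B E F; congr Mat2; rewrite /=; ring. Qed.

Lemma mul2_1r (M : mat2 int) : mul2 M (Mat2 1 0 0 1) = M.
Proof. by case: M => A B E F; congr Mat2; rewrite /=; ring. Qed.

Lemma det2_adj (M : mat2 int) : det2 (adj2 M) = det2 M.
Proof. by rewrite /det2 /=; ring. Qed.

Lemma adj2_mul (M N : mat2 int) : adj2 (mul2 M N) = mul2 (adj2 N) (adj2 M).
Proof. by congr Mat2; rewrite /=; ring. Qed.

(* By Bezout, carries the cusp x to oo. *)
Definition gam (x : vec) : mat2 int :=
  Mat2 (egcdz x.1 x.2).1 (egcdz x.1 x.2).2 (- (x.2 %/ gcdz x.1 x.2)%Z) (x.1 %/ gcdz x.1 x.2)%Z.

Lemma gamP (x : vec) : x != 0 -> det2 (gam x) = 1 /\ (vact (gam x) x).2 = 0.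
Proof.
move=> x0; have g0 := vgcd_neq0 x0.
have e1 := divzK (dvdz_gcdl x.1 x.2); have e2 := divzK (dvdz_gcdr x.1 x.2).
rewrite /gam /det2 /vact /=; case: egcdzP => u v e _ /=.
move: e e1 e2 g0; rewrite /vgcd; set d := gcdz _ _ => e e1 e2 g0.
move: (x.1 %/ d)%Z (x.2 %/ d)%Z e1 e2 => q1 q2; move: d g0 e => d g0 e e1 e2.
split; last by rewrite -e1 -e2; ring.
by apply: (mulfI g0); rewrite mulr1 -[RHS]e -e1 -e2; ring.
Qed.

(** * From equivariant antiderivatives to modular symbols *)

Section EquivariantDifference.
Variables (R : realType) (g : nat).
Local Notation C := R[i].
Definition hdom (z : C) := 0 < complex.Im z.

Variable G : vec -> {poly int} -> C -> C.
Hypothesis G_eqv : equivariant hdom (@mob R) g G.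
Hypothesis G_add : forall x P Q z, G x (P + Q) z = G x P z + G x Q z.
Hypothesis G_trunc : forall x Q z, G x (hact g (Mat2 1 0 0 1) Q) z = G x Q z.
Hypothesis G_scale : forall (m : int) (x : vec) (Q : {poly int}) z, m != 0 -> x != 0 -> hdom z ->
  (size Q <= g.+1)%N -> G (vscale m x) Q z = G x Q z.
Hypothesis G_base : forall Q : {poly int}, (size Q <= g.+1)%N ->
  exists c, forall z, hdom z -> G cusp_oo Q z = G cusp_0 Q z + c.

Lemma mob_adjK M z : det2 M = 1 -> hdom z -> mob M (mob (adj2 M) z) = z.
Proof.
by move=> dM hz; rewrite mob_mul ?det2_adj ?dM // (mul2_adjr dM) mob_id.
Qed.

Lemma hdom_adj M z : det2 M = 1 -> hdom z -> hdom (mob (adj2 M) z).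
Proof. by move=> dM hz; apply: mob_dom; rewrite ?det2_adj ?dM. Qed.

Lemma equivariant_adj M (x : vec) (Q : {poly int}) z : det2 M = 1 -> x != 0 -> hdom z ->
  (size Q <= g.+1)%N -> G (vact M x) Q z = G x (hact g M Q) (mob (adj2 M) z).
Proof.
move=> dM x0 hz sQ; rewrite -(G_eqv dM x0 (hdom_adj dM hz) sQ).
by rewrite mob_adjK.
Qed.

(** Independence of the point is a relation between two cusps, stable under S and T;
    [cusp_rel_total] reduces it to the cusps 0 and oo, where it is [G_base]. *)
Lemma equivariant_diff_const (x y : vec) (Q : {poly int}) z w : x != 0 -> y != 0 ->
  (size Q <= g.+1)%N -> hdom z -> hdom w ->
  G y Q z - G x Q z = G y Q w - G x Q w.
Proof.
move=> x0 y0 sQ hz hw.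
pose Z (x y : vec) := forall (Q : {poly int}) (z w : C), (size Q <= g.+1)%N ->
  hdom z -> hdom w -> G y Q z - G x Q z = G y Q w - G x Q w.
suff : Z x y by apply.
have step M (u v : vec) : det2 M = 1 -> u != 0 -> v != 0 -> Z u v -> Z (vact M u) (vact M v).
  move=> dM u0 v0 h P z1 w1 sP hz1 hw1; rewrite !equivariant_adj //.
  by apply: h; [exact: size_hact|exact: hdom_adj|exact: hdom_adj].
apply: (@cusp_rel_total Z) => // {x y Q z w x0 y0 sQ hz hw}.
- by move=> s t h P z w sP hz hw; rewrite -opprB (h P z w) // opprB.
- move=> s t u _ _ _ h1 h2 P z w sP hz hw.
  have E (A B D : C) : D - A = (D - B) + (B - A) by ring.
  by rewrite (E (G s P z) (G t P z)) (E (G s P w) (G t P w)) (h1 P z w) // (h2 P z w).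
- by move=> m s m0 s0 P z w sP hz hw; rewrite !G_scale // !subrr.
- by move=> s t s0 t0; apply: step.
- by move=> n s t s0 t0; apply: step => //; rewrite /det2 /=; ring.
move=> P z w sP hz hw; have [c hc] := G_base sP; rewrite !hc //.
by rewrite ![_ + c]addrC !addrK.
Qed.

Definition difference (x y : vec) (Q : {poly int}) : C :=
  G y Q 'i%C - G x Q 'i%C.

Lemma hdom_i : hdom 'i%C. Proof. by rewrite /hdom /= ltr01. Qed.

Lemma differenceE (x y : vec) (Q : {poly int}) z : x != 0 -> y != 0 ->
  (size Q <= g.+1)%N -> hdom z -> difference x y Q = G y Q z - G x Q z.
Proof. by move=> x0 y0 sQ hz; apply: equivariant_diff_const => //; exact: hdom_i. Qed.

Lemma difference_symbol : symbol g difference.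
Proof.
split.
- by move=> x y P Q; rewrite /difference !G_add; ring.
- by move=> x y z Q _ _ _; rewrite /difference; ring.
(* The scaling clause of [symbol] concerns polynomials of any degree; [G_trunc] first cuts Q down to
   degree g. *)
- move=> m x Q m0 x0; rewrite /difference -(G_trunc (vscale m x)) G_scale ?size_hact //.
    by rewrite G_trunc subrr.
  exact: hdom_i.
move=> M x Q y dM x0 y0 sQ.
have sM : (size (hact g M Q) <= g.+1)%N by exact: size_hact.
rewrite (differenceE x0 y0 sM (hdom_adj dM hdom_i)).
by rewrite /difference !equivariant_adj //; exact: hdom_i.
Qed.

(** Each summand of T_p may be evaluated at its own point [mob M z], so T_p of the symbol is the
    difference of T_p [G] at oo and at 0. The eigenvalue is given at oo, and S carries it to 0. *)
Lemma difference_hecke p (l : C) (Q : {poly int}) : prime p -> (size Q <= g.+1)%N ->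
  (forall z (P : {poly int}), hdom z -> (size P <= g.+1)%N ->
     heckeT (@mob R) p g G cusp_oo P z = l * G cusp_oo P z) ->
  symT p g difference cusp_0 cusp_oo Q = l * difference cusp_0 cusp_oo Q.
Proof.
move=> p_pr sQ hoo; have hi := hdom_i; have p0 : (0 < p)%N := prime_gt0 p_pr.
have n0 : cusp_0 != 0 by []. have noo : cusp_oo != 0 by [].
have dU b : 0 < det2 (Mup p b) by rewrite det_Mup; lia.
have dD : 0 < det2 (Mdiag p) by rewrite det_Mdiag; lia.
have vU b (x : vec) : x != 0 -> vact (Mup p b) x != 0 by apply: vact_neq0; rewrite gt_eqF.
have vD (x : vec) : x != 0 -> vact (Mdiag p) x != 0 by apply: vact_neq0; rewrite gt_eqF.
have e0 z : hdom z -> symT p g difference cusp_0 cusp_oo Q =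
    heckeT (@mob R) p g G cusp_oo Q z - heckeT (@mob R) p g G cusp_0 Q z.
  move=> hz; rewrite /symT /heckeT opprD addrACA -sumrB /=.
  congr (_ + _).
    apply: eq_bigr => b _; apply: differenceE; rewrite ?vU ?size_hact //.
    exact: mob_dom.
  by apply: differenceE; rewrite ?vD ?size_hact //; exact: mob_dom.
rewrite (e0 'i%C) // hoo //.
have dS : det2 Smat = 1 by [].
have hS : hdom (mob (adj2 Smat) 'i%C) by exact: hdom_adj.
have eS : cusp_0 = vact Smat cusp_oo by [].
have -> : heckeT (@mob R) p g G cusp_0 Q 'i%C = l * G cusp_0 Q 'i%C.
  rewrite eS -{1}(mob_adjK dS hi) (heckeT_S (dom := hdom)) //; first last.
  - by move=> M N z; exact: mob_mul.
  - by move=> M z; exact: mob_dom.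
  by rewrite hoo ?size_hact // -equivariant_adj.
by rewrite -mulrBr.
Qed.
End EquivariantDifference.

Section EichlerSymbol.
Variables (R : realType) (g : nat) (a : nat -> R[i]).
Local Notation C := R[i].
Hypotheses (g_even : ~~ odd g) (ta : tame a) (a0 : a 0%N = 0).
Hypothesis f_S : forall z, 0 < complex.Im z -> fourier a (- z^-1) = z ^+ g.+2 * fourier a z.

Definition eich (Q : {poly int}) (z : C) : C := eichler g a (map_poly intr Q) z.

Lemma hact_intr M (Q : {poly int}) :
  map_poly (intr : int -> C) (hact g M Q) = hact g (map2 intr M) (map_poly intr Q).
Proof. exact: (hact_map (intr : {rmorphism int -> C})). Qed.

Lemma size_intr (Q : {poly int}) : (size Q <= g.+1)%N ->
  (size (map_poly (intr : int -> C) Q) <= g.+1)%N.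
Proof. by apply: leq_trans; exact: size_poly. Qed.

(** An element of SL_2(Z) fixing oo is a translation up to sign, and the even degree removes the
    sign. *)
Lemma eich_stab M (Q : {poly int}) z : det2 M = 1 -> m10 M = 0 -> (size Q <= g.+1)%N ->
  eich Q (mob M z) = eich (hact g M Q) z.
Proof.
case: M => m n c d /=; rewrite /det2 /= => dM c0 sQ; subst c.
have [e em] : exists2 e : int, e * e = 1 & m = e /\ d = e.
  have : m * d = 1 by move: dM; rewrite mulr0 subr0.
  move=> md; have := congr1 absz md; rewrite abszM => /eqP.
  by rewrite muln_eq1 => /andP[/eqP h1 /eqP h2]; exists m; [|split => //]; nia.
move=> [? ?]; subst m d; rewrite /eich hact_intr /map2 /=.
have e0 : e%:~R != 0 :> C by rewrite intr_eq0; apply/eqP => z0; move: em; rewrite z0 mul0r.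
have eV : (e%:~R : C)^-1 = e%:~R.
  by apply: (mulfI e0); rewrite mulfV // -rmorphM em.
have eg : (e%:~R : C) ^+ g = 1.
  rewrite -(odd_double_half g) (negPf g_even) add0n -mul2n exprM expr2 -rmorphM em.
  by rewrite rmorph1 expr1n.
have hz : mob (Mat2 e n 0 e) z = z + (n * e)%:~R.
  by rewrite /mob /= mul0r add0r mulrDl eV mulrAC -!rmorphM /= em mul1r.
rewrite hz; have sP := size_intr sQ; move: (map_poly _ Q) sP => P sP.
have hP : hact g (Mat2 (e%:~R : C) n%:~R 0%:~R e%:~R) P = hact g (Mat2 1 (n * e)%:~R 0 1) P.
  rewrite (@hact_scale_comp R g _ _ _ P sP e0) (@hact_scale_comp R g _ _ _ P sP (oner_neq0 _)).
  by rewrite eg mulfV // expr1n !divr1 eV -rmorphM.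
by rewrite hP; exact: eichler_T.
Qed.

(* The antiderivative of f(z) Q(z, 1) dz that vanishes at the cusp x. *)
Definition cusp_int (x : vec) (Q : {poly int}) (z : C) : C :=
  eich (hact g (adj2 (gam x)) Q) (mob (gam x) z).

(** Two matrices carrying x to oo differ by one that fixes oo, and [eich_stab] applies to it. So
    every such matrix computes the same function, whence equivariance. *)
Lemma cusp_intE (x : vec) (Q : {poly int}) z M : x != 0 -> 0 < complex.Im z ->
  det2 M = 1 -> (vact M x).2 = 0 -> (size Q <= g.+1)%N ->
  cusp_int x Q z = eich (hact g (adj2 M) Q) (mob M z).
Proof.
move=> x0 hz dM Mx sQ; have [dG Gx] := gamP x0; rewrite /cusp_int; move: (gam x) dG Gx => G dG Gx.
pose D := mul2 M (adj2 G).
have dD : det2 D = 1 by rewrite det2_mul dM mul1r det2_adj.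
have eM : M = mul2 D G by rewrite /D -mul2A mul2_adjl // mul2_1r.
have D0 : m10 D = 0.
  have Gn0 : (vact G x).1 != 0.
    have := vact_neq0 (_ : det2 G != 0) x0; rewrite dG vec_neq0 Gx eqxx orbF; exact.
  have : m10 D * (vact G x).1 = 0.
    move: Mx; rewrite {1}eM -vact_mul /vact /= -/(vact G x).1 => h.
    by move: Gx h; rewrite /vact /= => ->; rewrite mulr0 addr0.
  by move=> /eqP; rewrite mulf_eq0 (negPf Gn0) orbF => /eqP.
have h1 : 0 < det2 D by rewrite dD.
have h2 : 0 < det2 G by rewrite dG.
have -> : mob M z = mob D (mob G z) by rewrite mob_mul // -eM.
have hA : hact g (adj2 G) Q = hact g D (hact g (adj2 M) Q).
  by rewrite hact_comp /D mul2A mul2_adjl // mul2_1l.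
by rewrite hA; apply/esym/eich_stab => //; exact: size_hact.
Qed.

Lemma cusp_int_equivariant : equivariant (@hdom R) (@mob R) g cusp_int.
Proof.
move=> M x Q z dM x0 hz sQ; have y0 : vact M x != 0 by apply: vact_neq0; rewrite ?dM.
have [dG Gx] := gamP y0; rewrite {1}/cusp_int; move: (gam _) dG Gx => G dG Gx.
have dGM : det2 (mul2 G M) = 1 by rewrite det2_mul dG dM.
have E1 : cusp_int x (hact g M Q) z =
    eich (hact g (adj2 (mul2 G M)) (hact g M Q)) (mob (mul2 G M) z).
  apply: cusp_intE => //; last exact: size_hact.
  by rewrite -vact_mul.
have E2 : hact g (adj2 (mul2 G M)) (hact g M Q) = hact g (adj2 G) Q.
  by rewrite hact_comp adj2_mul mul2A (mul2_adjr dM) (mul2_1l (adj2 G)).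
have E3 : mob G (mob M z) = mob (mul2 G M) z by apply: mob_mul; rewrite ?dG ?dM.
by rewrite E1 E2 E3.
Qed.

Lemma cusp_int_oo (m : int) (Q : {poly int}) z : m != 0 -> hdom z -> (size Q <= g.+1)%N ->
  cusp_int (m, 0) Q z = eich Q z.
Proof.
move=> m0 hz sQ; have E2 : hact g (adj2 (Mat2 1 0 0 1)) Q = Q.
  by rewrite /adj2 /= oppr0 hact_id.
have E1 : cusp_int (m, 0) Q z = eich (hact g (adj2 (Mat2 1 0 0 1)) Q) (mob (Mat2 1 0 0 1) z).
  apply: cusp_intE => //; last by rewrite /vact /=; ring.
  by rewrite vec_neq0 /= m0.
by rewrite E1 E2; exact: (congr1 (eich Q) (mob_id z)).
Qed.

Lemma cusp_int_scale (m : int) (x : vec) (Q : {poly int}) z : m != 0 -> x != 0 -> hdom z ->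
  (size Q <= g.+1)%N -> cusp_int (vscale m x) Q z = cusp_int x Q z.
Proof.
move=> m0 x0 hz sQ; have [dG Gx] := gamP x0; have ms0 := vscale_neq0 m0 x0.
have Gm : (vact (gam x) (vscale m x)).2 = 0.
  by rewrite vact_scale -[LHS]/(m * (vact (gam x) x).2) Gx mulr0.
exact: (cusp_intE ms0 hz dG Gm sQ).
Qed.

Lemma cusp_int_base (P : {poly int}) : (size P <= g.+1)%N ->
  exists c, forall z, hdom z -> cusp_int cusp_oo P z = cusp_int cusp_0 P z + c.
Proof.
move=> sP; pose P' := hact g (adj2 Smat) P.
have sP' := size_intr (size_hact g (adj2 Smat) P : (size P' <= g.+1)%N).
have [c hc] := eichler_S ta a0 f_S sP'; exists (- c) => z hz.
have dS : det2 Smat = 1 by [].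
have S0 : (vact Smat cusp_0).2 = 0 by [].
have e0 : cusp_int cusp_0 P z = eich P' (- z^-1).
  have -> : - z^-1 = mob Smat z.
    by rewrite /mob /= mul0r add0r mul1r addr0 rmorphN rmorph1 mulN1r.
  exact: (cusp_intE (isT : cusp_0 != 0) hz dS S0 sP).
have eP : hact g (Mat2 0 (-1) 1 0) (map_poly (intr : int -> C) P') = map_poly intr P.
  transitivity (map_poly (intr : int -> C) (hact g Smat P')).
    by rewrite hact_intr; congr (hact g _ _); rewrite /map2 /= rmorphN rmorph0 rmorph1.
  congr map_poly; rewrite /P' hact_comp -[RHS](hact_id sP).
  by rewrite (mul2_adjl dS).
have e1 : eich P' (- z^-1) = eich P z + c.
  have := hc z hz; rewrite eP; exact.
by rewrite e0 e1 addrK; exact: (cusp_int_oo (oner_neq0 _) hz sP).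
Qed.

Lemma eichD P Q z : eich (P + Q) z = eich P z + eich Q z.
Proof. by rewrite /eich rmorphD /= eichlerD. Qed.

Lemma cusp_intD (x : vec) P Q z : cusp_int x (P + Q) z = cusp_int x P z + cusp_int x Q z.
Proof. by rewrite /cusp_int hactD eichD. Qed.

Lemma cusp_int_trunc (x : vec) Q z :
  cusp_int x (hact g (Mat2 1 0 0 1) Q) z = cusp_int x Q z.
Proof. by rewrite /cusp_int hact_comp mul2_1l. Qed.

End EichlerSymbol.

(** * Hecke operators on Eichler integrals *)

Section HeckeRelation.
Variables (R : realType) (g : nat) (a : nat -> R[i]).
Local Notation C := R[i].
Hypotheses (g_even : ~~ odd g) (ta : tame a) (a0 : a 0%N = 0).
Hypothesis a_hecke : forall p n, prime p ->
  a (p * n)%N + (if (p %| n)%N then p%:R ^+ g.+1 * a (n %/ p)%N else 0) = a p * a n.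

(** The relation between the a_n, divided by (2 pi i n)^(m+1): rewriting it in [icoef] turns the
    coefficients 1 and p^(g+1) into p^(m+1) and p^(g-m). *)
Lemma icoef_hecke p m n : prime p -> (m < g.+1)%N ->
  p%:R ^+ m * (p%:R * icoef a m.+1 (p * n)%N)
  + p%:R ^+ (g - m) * (if (p %| n)%N then icoef a m.+1 (n %/ p)%N else 0)
  = a p * icoef a m.+1 n.
Proof.
move=> p_pr hm; have p0 : p%:R != 0 :> C by rewrite pnatr_eq0 -lt0n prime_gt0.
rewrite mulrA -exprSr {3}/icoef mulrA -(a_hecke n p_pr) mulrDl /icoef.
have [->|n0] := posnP n; first by rewrite muln0 dvdn0 div0n a0; ring.
have n0' : n%:R != 0 :> C by rewrite pnatr_eq0 -lt0n.
have t0 := tpi_neq0 R; congr (_ + _).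
  rewrite natrM [tpi R * (_ * _)]mulrCA [(p%:R * _) ^+ _]exprMn.
  have : p%:R ^+ m.+1 != 0 :> C by apply: expf_neq0.
  have : (tpi R * n%:R) ^+ m.+1 != 0 by apply/expf_neq0/mulf_neq0.
    move: ((tpi R * n%:R) ^+ m.+1) (p%:R ^+ m.+1) => A B A0 B0.
  by field; rewrite A0.
case: ifP => [/dvdnP[k ek]|_]; last by rewrite mulr0 mul0r.
rewrite ek mulnK ?prime_gt0 // natrM; have k0 : k%:R != 0 :> C.
  by move: n0'; rewrite ek natrM mulf_eq0 negb_or => /andP[].
rewrite (_ : g.+1 = (g - m) + m.+1)%N; last by lia.
rewrite exprD [tpi R * (_ * _)]mulrA [(tpi R * k%:R * _) ^+ _]exprMn.
have : p%:R ^+ m.+1 != 0 :> C by apply: expf_neq0.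
have : (tpi R * k%:R) ^+ m.+1 != 0 by apply/expf_neq0/mulf_neq0.
move: ((tpi R * k%:R) ^+ m.+1) (p%:R ^+ m.+1) (p%:R ^+ (g - m)) => A B D A0 B0.
by field; rewrite B0.
Qed.

Lemma eichler_Mup p b (Q : {poly C}) z : prime p -> (size Q <= g.+1)%N ->
  eichler g a (hact g (Mat2 p%:R (- b%:R) 0 1) Q) ((z + b%:R) / p%:R) =
  \sum_(m < g.+1) (-1) ^+ m * Q^`(m).[z] * (p%:R ^+ m * iter_int a m.+1 ((z + b%:R) / p%:R)).
Proof.
move=> p_pr sQ; have p0 : p%:R != 0 :> C by rewrite pnatr_eq0 -lt0n prime_gt0.
rewrite (@hact_scale_comp R g _ _ _ Q sQ (oner_neq0 _)) expr1n scale1r !divr1.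
apply: eq_bigr => m _; rewrite derivn_comp_lin hornerZ horner_comp.
have -> : (p%:R *: 'X + (- b%:R)%:P).[(z + b%:R) / p%:R] = z :> C.
  by rewrite hornerD hornerZ hornerX hornerC; field.
by ring.
Qed.

Lemma eichler_Mdiag p (Q : {poly C}) z : prime p -> (size Q <= g.+1)%N ->
  eichler g a (hact g (Mat2 1 0 0 p%:R) Q) (p%:R * z) =
  \sum_(m < g.+1) (-1) ^+ m * Q^`(m).[z] * (p%:R ^+ (g - m) * iter_int a m.+1 (p%:R * z)).
Proof.
move=> p_pr sQ; have p0 : p%:R != 0 :> C by rewrite pnatr_eq0 -lt0n prime_gt0.
rewrite (@hact_scale_comp R g _ _ _ Q sQ p0) mul0r mul1r.
apply: eq_bigr => m _; rewrite derivnZ derivn_comp_lin !hornerZ horner_comp.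
have -> : (p%:R^-1 *: 'X + 0%:P).[p%:R * z] = z :> C.
  by rewrite hornerD hornerZ hornerX hornerC addr0 mulKf.
have hm := ltn_ord m.
rewrite -[in p%:R ^+ g](@subnK m g) // exprD exprVn.
by move: (iter_int _ _ _) => I; field; apply: expf_neq0.
Qed.

(** At the transformed point, the m-th derivative of the transformed polynomial is that of Q at z
    times p^m for [Mup] and p^(g-m) for [Mdiag]. So the terms can be collected by m, and
    [icoef_hecke] settles each of them. *)
Lemma eich_heckeT p (Q : {poly int}) z : prime p -> hdom z -> (size Q <= g.+1)%N ->
  heckeT (@mob R) p g (cusp_int g a) cusp_oo Q z = a p * cusp_int g a cusp_oo Q z.
Proof.
move=> p_pr hz sQ; have p0 : (0 < p)%N := prime_gt0 p_pr.
have sP := size_intr R sQ; set P := map_poly intr Q in sP.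
have p0' : 0 < p%:R :> R by rewrite ltr0n.
have eU (b : nat) : cusp_int g a (vact (Mup p b) cusp_oo) (hact g (adj2 (Mup p b)) Q) (mob (Mup p b) z)
   = eichler g a (hact g (Mat2 p%:R (- b%:R) 0 1) P) ((z + b%:R) / p%:R).
  have -> : vact (Mup p b) cusp_oo = (1, 0) by rewrite /vact /=; congr pair; ring.
  have -> : mob (Mup p b) z = (z + b%:R) / p%:R by rewrite /mob /= mul1r mul0r add0r.
  have hw : hdom ((z + b%:R) / p%:R) by rewrite /hdom Im_divn ImDn divr_gt0.
  apply: (etrans (cusp_int_oo a g_even (oner_neq0 _) hw (size_hact _ _ _))).
  by rewrite /eich hact_intr /map2 /= rmorphN /=.
have eD : cusp_int g a (vact (Mdiag p) cusp_oo) (hact g (adj2 (Mdiag p)) Q) (mob (Mdiag p) z)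
   = eichler g a (hact g (Mat2 1 0 0 p%:R) P) (p%:R * z).
  have -> : vact (Mdiag p) cusp_oo = (p%:Z, 0) by rewrite /vact /=; congr pair; ring.
  have -> : mob (Mdiag p) z = p%:R * z by rewrite /mob /= mul0r add0r addr0 divr1.
  have hw : hdom (p%:R * z) by rewrite /hdom ImMn mulr_gt0.
  have pz0 : p%:Z != 0 by rewrite eqz_nat -lt0n.
  apply: (etrans (cusp_int_oo a g_even pz0 hw (size_hact _ _ _))).
  by rewrite /eich hact_intr /map2 /= oppr0.
transitivity (\sum_(m < g.+1) (-1) ^+ m * P^`(m).[z] *
    (\sum_(b : 'F_p) p%:R ^+ m * iter_int a m.+1 ((z + (b : nat)%:R) / p%:R)
     + p%:R ^+ (g - m) * iter_int a m.+1 (p%:R * z))).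
  under [RHS]eq_bigr do rewrite mulrDr mulr_sumr; rewrite big_split /= exchange_big /=.
  rewrite /heckeT; congr (_ + _); last by rewrite eD; exact: eichler_Mdiag.
  by apply: eq_bigr => b _; rewrite eU; exact: eichler_Mup.
rewrite (cusp_int_oo a g_even (oner_neq0 _) hz sQ) /eich -/P /eichler mulr_sumr.
apply: eq_bigr => m _; rewrite -mulr_sumr [RHS]mulrCA; congr (_ * _).
have ti := tame_icoef ta a0 m.+1.
rewrite /iter_int (fourier_average p_pr ti hz) (fourier_dilate p_pr ti hz).
have t1 : tame (fun n => p%:R * icoef a m.+1 (p * n)%N) by apply/tameZ/tame_dilate.
have t2 : tame (fun n => if (p %| n)%N then icoef a m.+1 (n %/ p)%N else 0) by exact: tame_inflate.
rewrite -(fourierZ _ t1 hz) -(fourierZ _ t2 hz) -(fourierZ _ ti hz).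
apply: etrans (esym (fourierD (tameZ _ t1) (tameZ _ t2) hz)) _.
by congr (fourier _ z); apply/funext => n; exact: icoef_hecke.
Qed.
End HeckeRelation.

(** * Non-vanishing of the periods *)

Section NegativeWeight.
Variables (R : realType) (m : nat) (b : nat -> R[i]).
Local Notation C := R[i].
Hypotheses (m_gt0 : (0 < m)%N) (tb : tame b).
Hypothesis F_S : forall z, hdom z -> fourier b z = z ^+ m.*2 * fourier b (- z^-1).

(* |F(z)| Im(z)^-m is invariant under SL_2(Z), and bounded on Im z >= 1/2. *)
Lemma negative_weight_growth : exists2 K, 0 <= K &
  forall z : C, hdom z -> cabs (fourier b z) <= K * complex.Im z ^+ m.
Proof.
have h2 : 0 < 2^-1 :> R by rewrite invr_gt0.
have [M M0 hM] := fourier_bound tb h2; exists (M * 2 ^+ m).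
  by rewrite mulr_ge0 // exprn_ge0.
suff H n (z : C) : hdom z -> 2^-1 <= 2 ^+ n * complex.Im z ->
    cabs (fourier b z) <= M * 2 ^+ m * complex.Im z ^+ m.
  move=> z hz; have y0 : 0 < complex.Im z by [].
  pose n := Num.bound (complex.Im z)^-1; apply: (H n z hz).
  have hn : (complex.Im z)^-1 < n%:R by apply: archi_boundP; rewrite invr_ge0 ltW.
  have hn2 : n%:R <= 2 ^+ n :> R by rewrite -natrX ler_nat ltnW // ltn_expl.
  have : 1 <= 2 ^+ n * complex.Im z.
    rewrite -ler_pdivrMr // div1r.
    exact: le_trans (ltW hn) hn2.
  by lra.
have base (w : C) : hdom w -> 2^-1 <= complex.Im w ->
    cabs (fourier b w) <= M * 2 ^+ m * complex.Im w ^+ m.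
  move=> hw hy; apply: le_trans (hM w hy) _; rewrite -mulrA -exprMn ler_peMr //.
  by apply: exprn_ege1; lra.
(* Descent to Im z >= 1/2: after a translation |Re w| <= 1/2, and if Im w < 1/2 then |w|^2 <= 1/2,
   so -1/w has at least twice the imaginary part. *)
elim: n z => [|n IH] z hz hy; first by apply: base => //; move: hy; rewrite expr0 mul1r.
have [h|h] := lerP 2^-1 (complex.Im z); first exact: base.
pose k := - Num.floor (complex.Re z + 2^-1); pose w := z + k%:~R.
have Iw : complex.Im w = complex.Im z by rewrite /w intr_complex ImD /= addr0.
have Rw : `|complex.Re w| <= 2^-1.
  rewrite /w intr_complex ReD /= /k rmorphN /=.
  have := floor_le_tmp (complex.Re z + 2^-1); have := floorD1_gt (complex.Re z + 2^-1).
  rewrite rmorphD /= => h3 h4; rewrite ler_norml; lra.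
have hw : hdom w by rewrite /hdom Iw.
have w0 : w != 0 by apply: contraTneq hw => ->; rewrite /hdom /= ltxx.
have cw : 0 < cabs w by rewrite cabs_gt0.
have cw2 : cabs w ^+ 2 <= 2^-1.
  rewrite cabs_sqr Iw; have : complex.Re w ^+ 2 <= 2^-1 ^+ 2.
    by rewrite -real_normK ?num_real // ler_pXn2r ?nnegrE.
  by move: hz h; rewrite /hdom => hz h h5; nra.
have hS : hdom (- w^-1) by rewrite /hdom Im_neg_inv divr_gt0 // exprn_gt0.
have eI : complex.Im (- w^-1) * cabs w ^+ 2 = complex.Im z.
  by rewrite Im_neg_inv Iw mulfVK // expf_neq0 // gt_eqF.
have -> : fourier b z = fourier b w by rewrite /w fourierDz.
rewrite F_S // cabsM cabsX -mul2n exprM.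
apply: le_trans (_ : (cabs w ^+ 2) ^+ m * (M * 2 ^+ m * complex.Im (- w^-1) ^+ m) <= _).
  rewrite ler_wpM2l ?exprn_ge0 ?cabs_ge0 //; apply: IH => //.
  move: hy eI; rewrite exprS => hy eI.
  have p2 : 0 < 2 ^+ n :> R by rewrite exprn_gt0.
  have : complex.Im z <= 2^-1 * complex.Im (- w^-1).
    by rewrite -eI mulrC ler_wpM2r // ltW.
  move: (2 ^+ n) p2 hy => P P0 hy h6; nra.
by rewrite mulrCA -exprMn [_ ^+ 2 * _]mulrC eI.
Qed.

(** The growth estimate and [fourier_coef_bound] give |b_n| exp(-2 pi n y) <= K y^m, and y tends to
    0. The constant c is the exponential at y = 1, its least value for y <= 1. *)
Lemma negative_weight_eq0 n : b n = 0.
Proof.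
have [K K0 hK] := negative_weight_growth.
set c := expR (- (2 * pi * 1)) ^+ n : R; have c0 : 0 < c by rewrite exprn_gt0 // expR_gt0.
have H y : 0 < y <= 1 -> cabs (b n) * c <= K * y.
  move=> /andP[y0 y1]; have hx x : cabs (fourier b (x +i* y)) <= K * y ^+ m := hK (x +i* y) y0.
  have h := fourier_coef_bound n tb y0 hx.
  apply: le_trans (_ : K * y ^+ m <= _); last first.
    rewrite ler_wpM2l // -[leRHS]expr1 ler_wiXn2l ?(ltW y0) //.
  apply: le_trans h; rewrite ler_wpM2l ?cabs_ge0 // /c lerXn2r ?nnegrE ?expR_ge0 //.
  by rewrite ler_expR lerN2 ler_wpM2l // mulr_ge0 // pi_ge0.
apply: cabs_small_eq0 => e e0; rewrite -(ltr_pM2r c0).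
have K1 : 0 < K + 1 by lra.
pose y := Num.min 1 (e * c / (K + 1)).
have y0 : 0 < y by rewrite lt_min ltr01 divr_gt0 // mulr_gt0.
have y1 : y <= 1 by rewrite ge_min lexx.
have hy : y * (K + 1) <= e * c by rewrite -ler_pdivlMr // ge_min lexx orbT.
apply: le_lt_trans (H y (introT andP (conj y0 y1))) _; nra.
Qed.
End NegativeWeight.

Lemma hact_linX (A : comNzRingType) g (M : mat2 A) (z : A) :
  hact g M (('X - z%:P) ^+ g) =
  ((m00 M - z * m10 M) *: 'X + (m01 M - z * m11 M)%:P) ^+ g.
Proof.
rewrite /hact rmorphXn /= rmorphB /= map_polyX map_polyC /=.
rewrite (_ : 'X - _ = 1 *: 'X + (- z%:P)%:P); last by rewrite scale1r polyCN.
rewrite hev_linX; congr (_ ^+ _); rewrite mul1r -!mul_polyC !(polyCB, polyCM); ring.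
Qed.

Lemma horner_derivn_linX (R : realType) g j (z : R[i]) : (j <= g)%N ->
  ((('X - z%:P) ^+ g)^`(j)).[z] = if j == g then (g`!)%:R else 0.
Proof.
move=> hj; have -> : ('X - z%:P) ^+ g = 'X^g \Po (1 *: 'X + (- z)%:P).
  by rewrite comp_Xn_poly scale1r polyCN.
rewrite derivn_comp_lin derivnXn expr1n scale1r horner_comp hornerMn hornerXn.
rewrite hornerD hornerZ hornerX hornerC mul1r subrr expr0n subn_eq0.
have [->|ne] := eqVneq j g; first by rewrite leqnn ffactnn.
by rewrite leqNgt ltn_neqAle ne hj mul0rn.
Qed.

Section NonVanishing.
Variables (R : realType) (g : nat) (a : nat -> R[i]).
Local Notation C := R[i].
Hypotheses (g_gt1 : (1 < g)%N) (g_even : ~~ odd g) (ta : tame a) (a0 : a 0%N = 0).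
Hypothesis f_S : forall z, 0 < complex.Im z -> fourier a (- z^-1) = z ^+ g.+2 * fourier a z.
Hypothesis a_hecke : forall p n, prime p ->
  a (p * n)%N + (if (p %| n)%N then p%:R ^+ g.+1 * a (n %/ p)%N else 0) = a p * a n.

Definition eichler_symbol := difference (cusp_int g a).

Lemma eichler_symbolP : symbol g eichler_symbol.
Proof.
apply: difference_symbol.
- exact: cusp_int_equivariant.
- exact: cusp_intD.
- exact: cusp_int_trunc.
- exact: cusp_int_scale.
- exact: cusp_int_base.
Qed.

Lemma eichler_symbol_hecke l (Q : {poly int}) : prime l -> (size Q <= g.+1)%N ->
  symT l g eichler_symbol cusp_0 cusp_oo Q = a l * eichler_symbol cusp_0 cusp_oo Q.
Proof.
move=> l_pr sQ; apply: difference_hecke; last first.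
- by move=> z P hz sP; exact: eich_heckeT.
- exact: sQ.
- exact: l_pr.
- exact: cusp_int_base.
- exact: cusp_int_scale.
- exact: cusp_int_equivariant.
Qed.

(** The matrix is the adjugate of [Smat], so the second term is the antiderivative attached to the
    cusp 0, and the period is the difference of the two at z. *)
Lemma eichler_period j z : (j <= g)%N -> hdom z ->
  eichler g a 'X^j z = eichler g a (hact g (Mat2 0 1 (-1) 0) 'X^j) (- z^-1)
    + period eichler_symbol j.
Proof.
move=> hj hz.
have sP : (size ('X^j : {poly int}) <= g.+1)%N by rewrite size_polyXn.
have e : period eichler_symbol j = cusp_int g a cusp_oo 'X^j z - cusp_int g a cusp_0 'X^j z.
  apply: differenceE (isT : cusp_0 != 0) (isT : cusp_oo != 0) sP hz.
  - exact: cusp_int_equivariant.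
  - exact: cusp_int_scale.
  - exact: cusp_int_base.
have e1 : cusp_int g a cusp_oo 'X^j z = eichler g a 'X^j z.
  apply: (etrans (cusp_int_oo a g_even (oner_neq0 _) hz sP)).
  by rewrite /eich map_polyXn.
have dS : det2 Smat = 1 by [].
have S0 : (vact Smat cusp_0).2 = 0 by [].
have e0 : cusp_int g a cusp_0 'X^j z = eichler g a (hact g (Mat2 0 1 (-1) 0) 'X^j) (- z^-1).
  have -> : - z^-1 = mob Smat z.
    by rewrite /mob /= mul0r add0r mul1r addr0 rmorphN rmorph1 mulN1r.
  apply: (etrans (cusp_intE a g_even (isT : cusp_0 != 0) hz dS S0 sP)).
  rewrite /eich hact_intr map_polyXn; congr (eichler g a (hact g _ _) _).
have E (A B P A' B' : C) : P = A - B -> A = A' -> B = B' -> A' = B' + P.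
  by move=> -> -> ->; rewrite addrC subrK.
exact: E e e1 e0.
Qed.

Lemma eichler0 z : eichler g a 0 z = 0.
Proof. by rewrite -(scale0r 0) eichlerZ mul0r. Qed.

Lemma eichler_sum n (F : 'I_n -> {poly C}) z :
  eichler g a (\sum_(i < n) F i) z = \sum_(i < n) eichler g a (F i) z.
Proof.
elim/big_rec2: _ => [|i u v _ <-]; [exact: eichler0|exact: eichlerD].
Qed.

Lemma eichler_period_poly (Q : {poly C}) z : (size Q <= g.+1)%N -> hdom z ->
  eichler g a Q z = eichler g a (hact g (Mat2 0 1 (-1) 0) Q) (- z^-1)
    + \sum_(j < g.+1) Q`_j * period eichler_symbol j.
Proof.
move=> sQ hz; have hA : hact g (Mat2 0 1 (-1) 0) Q =
    \sum_(j < g.+1) Q`_j *: hact g (Mat2 0 1 (-1) 0) 'X^j.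
  rewrite {1}(poly_widen sQ); elim/big_rec2: _ => [|i u v _ <-].
    by have := hactZ g (Mat2 0 1 (-1) 0) 0 (0 : {poly C}); rewrite !scale0r.
  by rewrite hactD hactZ.
rewrite hA {1}(poly_widen sQ) !eichler_sum -big_split; apply: eq_bigr => j _ /=.
rewrite !eichlerZ -mulrDr; congr (_ * _); apply: eichler_period => //.
by have := ltn_ord j.
Qed.

(* With Q = (X - z)^g only the top iterated integral survives. *)
Lemma top_integral_S z : hdom z -> (forall j, (0 < j < g)%N -> period eichler_symbol j = 0) ->
  (g`!)%:R * iter_int a g.+1 z = z ^+ g * ((g`!)%:R * iter_int a g.+1 (- z^-1))
    + (1 - z ^+ g) * period eichler_symbol g.
Proof.
move=> hz hv; have z0 : z != 0 by apply: contraTneq hz => ->; rewrite /hdom /= ltxx.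
have top w : eichler g a (('X - w%:P) ^+ g) w = (g`!)%:R * iter_int a g.+1 w.
  rewrite /eichler big_ord_recr /= big1 => [|m _]; last first.
    by rewrite horner_derivn_linX ?ltn_eqF ?mulr0 ?mul0r // ltnW.
  by rewrite horner_derivn_linX // eqxx add0r -signr_odd (negPf g_even) mul1r.
have sQ : (size (('X - z%:P) ^+ g) <= g.+1)%N by rewrite size_exp_XsubC.
have hR : eichler g a (hact g (Mat2 0 1 (-1) 0) (('X - z%:P) ^+ g)) (- z^-1) =
    z ^+ g * ((g`!)%:R * iter_int a g.+1 (- z^-1)).
  rewrite hact_linX /=.
  have -> : (0 - z * -1) *: 'X + (1 - z * 0)%:P = z *: ('X - (- z^-1)%:P).
    rewrite mulrN1 opprK add0r mulr0 subr0 scalerBr; congr (_ + _).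
    by rewrite -mul_polyC -polyCM mulrN mulfV // polyCN opprK.
  by rewrite exprZn eichlerZ top.
have hC : \sum_(j < g.+1) (('X - z%:P) ^+ g)`_j * period eichler_symbol j =
    (1 - z ^+ g) * period eichler_symbol g.
  have p0 := period0 g_even eichler_symbolP.
  have c0 : (('X - z%:P) ^+ g)`_0 = z ^+ g.
    by rewrite -horner_coef0 horner_exp hornerXsubC sub0r exprNn -signr_odd (negPf g_even) mul1r.
  have cg : (('X - z%:P) ^+ g)`_g = 1.
    have := monic_exp g (monicXsubC z); move/monicP; rewrite /lead_coef size_exp_XsubC; exact.
  move: (period eichler_symbol) hv p0 c0 cg => r hv p0 c0 cg.
  have [n en] : exists n, g = n.+1 by exists g.-1; lia.
  rewrite big_ord_recr /= cg.
  (* The inner periods vanish by [hv]; the two extreme ones are opposite by [period0], which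
     produces the factor 1 - z^g. *)
  have -> : \sum_(j < g) (('X - z%:P) ^+ g)`_j * r j = z ^+ g * r 0%N.
    move: c0 hv; rewrite {1 3}en => c0 hv; rewrite [in LHS]en big_ord_recl /= -en.
    rewrite -{1}en in c0; rewrite c0 big1 ?addr0 // => i _.
    by rewrite hv ?mulr0 // /bump /= -en; have := ltn_ord i; lia.
  by rewrite p0; ring.
apply: etrans (esym (top z)) _.
exact: etrans (eichler_period_poly sQ hz) (f_equal2 +%R hR hC).
Qed.

(** If all inner periods vanished, [top_integral_S] would make the (g+1)-fold integral minus r_g /
    g! modular of weight -g, hence zero; but its first coefficient is (2 pi i)^-(g+1). *)
Lemma period_neq0 : a 1%N = 1 -> exists2 j, (0 < j < g)%N & period eichler_symbol j != 0.
Proof.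
move=> a1; apply: contrapT => hn.
have hv j : (0 < j < g)%N -> period eichler_symbol j = 0.
  by move=> hj; apply/eqP/negP => hp; apply: hn; exists j => //; exact/negP.
have hS z (hz : hdom z) := top_integral_S hz hv.
move: (period eichler_symbol g) hS => r hS.
have f0 : (g`!)%:R != 0 :> C by rewrite pnatr_eq0 -lt0n fact_gt0.
pose e := - r / (g`!)%:R; pose d n : C := if n == 0%N then e else 0.
pose b n := icoef a g.+1 n + d n.
have td : tame d.
  move=> s /andP[s0 s1]; exists (cabs e) => n; rewrite /d; case: eqP => [->|_].
    by rewrite expr0 mulr1.
  by rewrite cabs0 mul0r cabs_ge0.
have ti := tame_icoef ta a0 g.+1.
have fd z : hdom z -> fourier d z = e.
  move=> hz; apply: fourier_unique => // x x0; exists 1%N => -[//|n] _.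
  rewrite big_ord_recl big1 => [|i _]; last by rewrite /d mul0r.
  by rewrite /d eqxx expr0 mulr1 addr0 subrr cabs0.
have fb z : hdom z -> fourier b z = iter_int a g.+1 z + e.
  by move=> hz; rewrite -(fd z hz); exact: fourierD.
have hF z : hdom z -> fourier b z = z ^+ (g./2).*2 * fourier b (- z^-1).
  move=> hz; have hz' : hdom (- z^-1).
    by rewrite /hdom Im_neg_inv divr_gt0 // exprn_gt0 // cabs_gt0; apply: contraTneq hz => ->; rewrite /hdom /= ltxx.
  rewrite even_halfK // (fb z hz) (fb _ hz'); apply: (mulfI f0).
  move: (hS z hz); move: (iter_int _ _ z) (iter_int _ _ (- z^-1)) => I J h.
  have ee : (g`!)%:R * e = - r by rewrite /e mulrC mulfVK.
  by rewrite [RHS]mulrCA !mulrDr h ee; ring.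
have h2 : (0 < g./2)%N by lia.
have := negative_weight_eq0 h2 (tameD ti td) hF 1; rewrite /b /d /= addr0.
rewrite /icoef a1 mulr1 mul1r => /eqP; rewrite invr_eq0 expf_eq0 /=.
by rewrite (negPf (tpi_neq0 R)).
Qed.
End NonVanishing.

(** * Hecke eigenforms *)

Section SeriesTerms.
Variable R : realType.
Local Notation C := R[i].

Lemma csum_to_bounded (u : nat -> C) s : csum_to u s -> exists B, forall n, cabs (u n) <= B.
Proof.
move=> hs; have [N hN] := hs 1 ltr01.
exists (\sum_(i < N) cabs (u i) + 2) => n; have [nN|Nn] := ltnP n N.
  rewrite (bigD1 (Ordinal nN)) //= -addrA lerDl addr_ge0 //.
  by apply: sumr_ge0 => i _; exact: cabs_ge0.
have h1 := hN n Nn; have h2 := hN n.+1 (leqW Nn).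
have -> : u n = (\sum_(i < n.+1) u i - s) - (\sum_(i < n) u i - s).
  by rewrite big_ord_recr /=; ring.
have h3 : 0 <= \sum_(i < N) cabs (u i) by apply: sumr_ge0 => i _; exact: cabs_ge0.
apply: le_trans (cabsB _ _) _; lra.
Qed.

(** Convergence at the point iy where q has modulus r bounds the terms at radius r. *)
Lemma has_qexpansion_tame (f : C -> C) a : has_qexpansion f a -> tame a.
Proof.
move=> hf r /andP[r0 r1]; have pi0 := pi_gt0 R.
pose y := - ln r / (2 * pi); have y0 : 0 < y.
  by rewrite divr_gt0 ?mulr_gt0 // oppr_gt0 ln_lt0 // r0.
have [B hB] := csum_to_bounded (csum_to_cvg (hf (0 +i* y) y0)).
exists B => n; apply: le_trans (hB n); rewrite cabsM cabsX cabs_qparam /=.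
rewrite (_ : expR _ = r) // /y mulrC mulfVK; last by rewrite gt_eqF // mulr_gt0.
by rewrite opprK lnK.
Qed.

Lemma has_qexpansion_fourier (f : C -> C) a z : has_qexpansion f a -> 0 < complex.Im z ->
  f z = fourier a z.
Proof.
move=> hf hz; apply/esym/fourier_unique => //; first exact: has_qexpansion_tame hf.
exact: csum_to_cvg (hf z hz).
Qed.
End SeriesTerms.

Lemma divisors_prime p : prime p -> divisors p = [:: 1; p]%N.
Proof.
move=> p_pr; have p0 := prime_gt0 p_pr; have p1 := prime_gt1 p_pr.
apply: (irr_sorted_eq ltn_trans ltnn (sorted_divisors_ltn p)); first by rewrite /= p1.
move=> d; rewrite -dvdn_divisors // !inE.
by apply/idP/orP => [|[]/eqP -> //]; have [_ h] := primeP p_pr; move/h => /orP.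
Qed.

Section Eigenform.
Variables (R : realType) (k : nat) (f : R[i] -> R[i]).
Local Notation C := R[i].
Hypotheses (k12 : (12 <= k)%N) (hf : normalized_hecke_eigenform k f).
Let a := qcoef f.
Let g := (k - 2)%N.
Let kg : k = g.+2. Proof. by rewrite -addn2 subnK //; exact: leq_trans k12. Qed.

Lemma eigen_qexpansion : has_qexpansion f a.
Proof.
have [[_ _ hq _] _ _] := hf; have [b hb] := hq.
exact: (@xgetPex _ (fun=> 0) [set a | has_qexpansion f a] (ex_intro _ b hb)).
Qed.

Lemma eigen_tame : tame a. Proof. exact: has_qexpansion_tame eigen_qexpansion. Qed.

Lemma eigen_fourier z : 0 < complex.Im z -> f z = fourier a z.
Proof. exact: has_qexpansion_fourier eigen_qexpansion. Qed.

Lemma eigen_a0 : a 0%N = 0. Proof. by have [[]] := hf. Qed.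
Lemma eigen_a1 : a 1%N = 1. Proof. by have [] := hf. Qed.

Lemma eigen_S z : 0 < complex.Im z -> fourier a (- z^-1) = z ^+ g.+2 * fourier a z.
Proof.
move=> hz; have [[_ wm _ _] _ _] := hf.
have hz' : 0 < complex.Im (- z^-1).
  rewrite Im_neg_inv divr_gt0 // exprn_gt0 // cabs_gt0.
  by apply: contraTneq hz => ->; rewrite /= ltxx.
rewrite -!eigen_fourier // -kg.
pose S : 'M[int]_2 := \matrix_(i, j) if i == 0 then (if j == 0 then 0 else -1)
  else (if j == 0 then 1 else 0).
have dS : \det S = 1 by rewrite (expand_det_row _ 0) !big_ord_recl big_ord0 /cofactor !det_mx11 !mxE /=; ring.
have := wm S dS z hz; rewrite !mxE /= !(mul0r, add0r, addr0) mul1r.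
by rewrite rmorphN rmorph1 mulN1r.
Qed.

(** Uniqueness of Fourier coefficients applied to T_p f = l f; the coefficient of index 1 identifies
    l with a_p. *)
Lemma eigen_hecke p n : prime p ->
  a (p * n)%N + (if (p %| n)%N then p%:R ^+ g.+1 * a (n %/ p)%N else 0) = a p * a n.
Proof.
move=> p_pr; have p0 := prime_gt0 p_pr; have pn0 : p%:R != 0 :> C by rewrite pnatr_eq0 -lt0n.
have ta := eigen_tame; have [_ /(_ p p0)[l hl] _] := hf.
have ti : tame (fun n => if (p %| n)%N then a (n %/ p)%N else 0) by exact: tame_inflate.
have td : tame (fun n => a (p * n)%N) by exact: tame_dilate.
pose b n := a (p * n)%N + p%:R ^+ g.+1 * (if (p %| n)%N then a (n %/ p)%N else 0).
have e : b =1 (fun n => l * a n).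
  apply: fourier_inj => [||z hz]; [exact/tameD/tameZ|exact: tameZ|].
  have -> : fourier (fun n => l * a n) z = hecke k p f z.
    by rewrite fourierZ // -eigen_fourier // hl.
  have t1 : \sum_(b < 1) 1%:R ^- k * f (((p %/ 1)%N%:R * z + b%:R) / 1%:R) =
      fourier (fun n => if (p %| n)%N then a (n %/ p)%N else 0) z.
    rewrite big_ord1 divn1 expr1n invr1 mul1r addr0 mulr1.
    have hpz : 0 < complex.Im (p%:R * z) by rewrite ImMn mulr_gt0 // ltr0n.
    have h := fourier_dilate p_pr ta hz.
    rewrite (eigen_fourier hpz).
    exact: h.
  have tp : \sum_(b < p) p%:R ^- k * f (((p %/ p)%N%:R * z + b%:R) / p%:R) =
      p%:R ^- k * (p%:R * fourier (fun n => a (p * n)%N) z).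
    rewrite -mulr_sumr divnn p0 mul1r; congr (_ * _).
    rewrite -(Fp_sum_ord p_pr (fun j => f ((z + j%:R) / p%:R))).
    apply: etrans (esym _) (etrans (fourier_average p_pr ta hz) (fourierZ p%:R td hz)).
    apply: eq_bigr => j _; apply/esym/eigen_fourier.
    by rewrite Im_divn ImDn divr_gt0 // ltr0n.
  rewrite /hecke divisors_prime // big_cons big_seq1 t1 tp.
  have E := fourierD td (tameZ (p%:R ^+ g.+1) ti) hz; rewrite fourierZ // in E.
  apply: etrans E _; rewrite kg /= mulrDr addrC; congr (_ + _).
  (* The powers of p in the average cancel: p^(k-1) p^(-k) p = 1. *)
  move: (fourier _ z) => F; rewrite [p%:R ^+ g.+2]exprS.
  have : p%:R ^+ g.+1 != 0 :> C by exact: expf_neq0.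
  by move: (p%:R ^+ g.+1) => A A0; field; rewrite A0.
have l1 : l = a p.
  have := e 1%N; rewrite /b muln1 eigen_a1 mulr1 gtnNdvd ?prime_gt1 // mulr0 addr0.
  by [].
by have := e n; rewrite /b l1 => <-; congr (_ + _); case: ifP => _; rewrite ?mulr0.
Qed.
End Eigenform.

(** For p > 12, h = t - 2 is good. For p = 2 and 3 parity makes h = 2 congruent to k - 2. For the
    other primes t - 2 is lowered modulo p - 1 where needed: 12 becomes 4, 6, 2 for p = 5, 7, 11. *)
Lemma good_weight_exists p k t : prime p -> ~~ odd k -> (12 <= k)%N ->
  t \in [:: 4; 6; 8; 10; 14]%N -> (p%:Z - 1 %| k%:Z - t%:Z)%Z ->
  exists2 h, good_weight p h & (k - 2 = h %[mod p.-1])%N.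
Proof.
move=> p_pr k_even k12 ht hd; have p1 := prime_gt1 p_pr.
have gt : (k - 2 = t - 2 %[mod p.-1])%N.
  have ep : p%:Z - 1 = p.-1%:Z by lia.
  rewrite ep -eqz_mod_dvd !modz_nat eqz_nat in hd.
  have k2 : (2 <= k)%N by lia.
  have t2 : (2 <= t)%N by move: ht; rewrite !inE => /or4P[|||/orP[]] /eqP ->.
  by apply/eqP; rewrite -(eqn_modDr 2) !subnK.
have [p12|p12] := ltnP 12 p.
  exists (t - 2)%N => //; move: ht; rewrite !inE /good_weight p12.
  have [-> -> ->] : [/\ 4 < p, 6 < p & 8 < p]%N by split; lia.
  by move=> /or4P[|||/orP[]] /eqP ->.
have : p \in [:: 2; 3; 5; 7; 11]%N.
  by move: p_pr p12 {p1 hd gt}; do 13?[case: p => [|p] //].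
rewrite !inE => /or4P[|||/orP[]] /eqP ep; subst p.
- by exists 2%N; rewrite ?modn1.
- exists 2%N => //; rewrite !modn2; congr nat_of_bool.
  by rewrite oddB ?(negPf k_even) //; lia.
all: move: ht gt; rewrite !inE => /or4P[|||/orP[]] /eqP -> gt.
all: by [exists 2%N|exists 4%N|exists 6%N|exists 8%N].
Qed.

Lemma integral_fmorph (L : fieldType) (C : fieldType) (iota : {rmorphism L -> C}) u :
  integralOver (intr : int -> C) (iota u) -> integralOver (intr : int -> L) u.
Proof.
move=> [q mq rq]; exists q => //.
have e : map_poly (intr : int -> C) q = map_poly iota (map_poly intr q).
  by rewrite -map_poly_comp; apply: eq_map_poly => z /=; rewrite rmorph_int.
by move: rq; rewrite e fmorph_root.
Qed.

Section Stabilizer.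
Variables (C : numFieldType) (n g : nat) (r : nat -> C) (a : nat -> C).
Hypotheses (a0 : a 0%N = 0) (a1 : a 1%N = 1).
Hypothesis a_hecke : forall p n, prime p ->
  a (p * n)%N + (if (p %| n)%N then p%:R ^+ g.+1 * a (n %/ p)%N else 0) = a p * a n.
Hypothesis a_stab : forall p, prime p -> stabilizer n r (a p).

(** Strong induction: for m = p q, the Hecke relation at p expresses a_m through a_p, a_q and
    a_(q/p). *)
Lemma stabilizer_hecke m : stabilizer n r (a m).
Proof.
elim/ltn_ind: m => m IH; have [m1|m1] := leqP m 1.
  case: m m1 {IH} => [_|[_|//]]; rewrite ?a0 ?a1; [exact: stabilizer0|exact: stabilizer1].
have p_pr := pdiv_prime m1; have /dvdnP[q eq] := pdiv_dvd m.
move: (pdiv m) p_pr eq => p p_pr eq; have p1 := prime_gt1 p_pr.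
have qm : (q < m)%N by rewrite eq; nia.
have -> : a m = a p * a q - (if (p %| q)%N then p%:R ^+ g.+1 * a (q %/ p)%N else 0).
  by rewrite -a_hecke // addrK eq mulnC.
apply: stabilizerB; first by apply: stabilizerM; [exact: a_stab|exact: IH].
case: ifP => _; last exact: stabilizer0.
apply: stabilizerM; first by rewrite -natrX; exact: stabilizer_nat.
by apply: IH; apply: leq_ltn_trans qm; exact: leq_div.
Qed.
End Stabilizer.

(** All the coefficients and b = a_p^2 / p lie in the integers of one number field. There a_p^2 = b
    p belongs to a prime ideal above p, hence so does a_p. *)
Lemma non_ordinary_of_stabilizer (R : realType) (f : R[i] -> R[i]) p n (r : nat -> R[i]) :
  prime p -> (exists2 i, (i < n)%N & r i != 0) ->
  (forall m, stabilizer n r (qcoef f m)) ->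
  stabilizer n r (qcoef f p * qcoef f p / p%:R) -> non_ordinary f p.
Proof.
move=> p_pr r0 hs hb; have pn0 : p%:R != 0 :> R[i] by rewrite pnatr_eq0 -lt0n prime_gt0.
have [L [iota hL]] := stabilizer_number_field r0.
have lift y : stabilizer n r y -> exists u : ringOfIntegers L, iota (val u) = y.
  move=> sy; have [u eu] := hL y sy.
  have iu : u \in @algint L.
    have hi : integralOver (intr : int -> R[i]) (iota u).
      by rewrite eu; exact: stabilizer_integral sy.
    by apply/asboolP; exact: integral_fmorph hi.
  by exists (RingOfIntegers iu).
have /choice[c hc] (m : nat) : exists u : ringOfIntegers L, iota (val u) = qcoef f m by exact: lift.
have [b eb] := lift _ hb; have [P hP] := ringOfIntegers_prime_above L p_pr.
exists L, iota, c; split => //; exists P; split => //.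
have ec : c p * c p = b * p%:R.
  apply/val_inj/(fmorph_inj iota); rewrite !rmorphM hc eb.
  by rewrite !rmorph_nat mulfVK.
have : c p * c p \in (P : pred _).
  by rewrite ec idealMr //; have := hP p%:Z; rewrite dvdzz -pmulrn.
by rewrite prime_idealrM orbb.
Qed.

Theorem mainTheorem2 (R : realType) (S : set nat) (hSfin : finite_set S)
    (hSprime : forall p : nat, S p -> prime p)
    (k : nat) (hk12 : (12 <= k)%N) (hkeven : ~~ odd k)
    (hS : forall p : nat, S p ->
       exists2 t : nat, t \in [:: 4; 6; 8; 10; 14]%N &
         (p%:Z - 1 %| k%:Z - t%:Z)%Z) :
  forall f : R[i] -> R[i], normalized_hecke_eigenform k f ->
  forall p : nat, S p -> non_ordinary f p.
Proof.
move=> f hf p Sp; have p_pr := hSprime p Sp; have [t ht hd] := hS p Sp.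
have [h hgood hmod] := good_weight_exists p_pr hkeven hk12 ht hd.
have ta := eigen_tame hf; have a0 := eigen_a0 hf; have a1 := eigen_a1 hf.
have aS := eigen_S hk12 hf.
have aT := eigen_hecke hk12 hf.
have g1 : (1 < k - 2)%N by clear -hk12; lia.
have gev : ~~ odd (k - 2) by rewrite oddB ?(negPf hkeven) //; lia.
have hPhi := eichler_symbolP gev ta a0 aS.
have hT := fun l Q => @eichler_symbol_hecke R _ _ gev ta a0 aS aT l Q.
have [j hj pj] := period_neq0 g1 gev ta a0 aS a1.
(* From the analysis only the symbol, its Hecke relations and one nonzero inner period are
   retained. *)
move: (k - 2)%N (eichler_symbol _ _) hmod aT g1 gev hPhi hT hj pj => g Phi hmod aT g1 gev hPhi hT hj pj.
apply: (@non_ordinary_of_stabilizer R f p g.-1 (fun i => period Phi i.+1)) => //.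
- by exists j.-1; [clear -hj; lia|rewrite prednK //; case/andP: hj].
- apply: (stabilizer_hecke a0 a1 aT) => l l_pr x hx.
  exact: (hecke_period_span g1 gev hPhi hT l_pr hx).
(* Divided by p, the inclusion of a_p^2 times the lattice in p times the lattice says that a_p^2 / p
   is a multiplier. *)
move=> x hx; have [l hl e] := hecke_square_span g1 gev hPhi hT p_pr hgood hmod hx.
have pn0 : p%:R != 0 :> R[i] by rewrite pnatr_eq0 -lt0n prime_gt0.
by rewrite mulrAC e mulrAC mulfV // mul1r.
Qed.
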